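(* Let $r>0$ and let $h:\overline{\mathbb D}_r\to\mathbb R^3$ be a branched minimal immersion with Weierstrass–Enneper representation $(f,g)$, where $$f(z)=\sum_{j=k}^\infty b_jz^j,\qquad g(z)=a_0+\sum_{j=m}^\infty a_jz^j,$$ with $m>0$, $a_m\neq 0$, $b_k\neq0$. If $r$ is strictly larger than the smallest positive root of the polynomial $$P_m(r)=-m|b_ka_m|^2r^{2m}+\sum_{j=0}^{m-1}(m-j)|b_{k+j}|^2(1+|a_0|^2)^2r^{2j},$$ then $h$ is unstable.
   Context: $\mathbb D_r=\{z\in\mathbb C:|z|<r\}$. A branched minimal immersion is a nonconstant smooth map that is harmonic and conformal. The Weierstrass–Enneper representation $(f,g)$ of $h=(h_1,h_2,h_3)$ (with $f$ holomorphic, $g$ meromorphic, $fg^2$ holomorphic; here both given by power series converging on a neighborhood of $\overline{\mathbb D}_r$) means $\big(\tfrac{\partial h_1}{\partial z},\tfrac{\partial h_2}{\partial z},\tfrac{\partial h_3}{\partial z}\big)=\big(\tfrac12 f(1-g^2),\tfrac i2 f(1+g^2),fg\big)$. $h$ is unstable on $\overline{\mathbb D}_r$ if there is a smooth $W:\overline{\mathbb D}_r\to\mathbb R^3$ vanishing on $\partial\mathbb D_r$ with $\frac{d^2}{dt^2}\big|_{t=0}A(h+tW)<0$, $A$ the area functional. *)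

(* Defs.v *)
From Stdlib Require Import Reals List.
Import ListNotations.
From Coquelicot Require Import Coquelicot.
Open Scope R_scope.

Definition V3 := (R * R * R)%type.
Definition v3 (a b c : R) : V3 := (a, b, c).
Definition c1 (v : V3) : R := fst (fst v).
Definition c2 (v : V3) : R := snd (fst v).
Definition c3 (v : V3) : R := snd v.

Definition map3 := R -> R -> V3.
Definition comp1 (u : map3) : R -> R -> R := fun x y => c1 (u x y).
Definition comp2 (u : map3) : R -> R -> R := fun x y => c2 (u x y).
Definition comp3 (u : map3) : R -> R -> R := fun x y => c3 (u x y).

Definition Dx (u : R -> R -> R) : R -> R -> R := fun x y => Derive (fun t => u t y) x.
Definition Dy (u : R -> R -> R) : R -> R -> R := fun x y => Derive (fun t => u x t) y.

Fixpoint pder (w : list bool) (u : R -> R -> R) : R -> R -> R :=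
  match w with
  | nil => u
  | b :: w' => if b then Dx (pder w' u) else Dy (pder w' u)
  end.

Definition smooth2 (u : R -> R -> R) : Prop :=
  forall (w : list bool) (x y : R),
    ex_derive (fun t => pder w u t y) x /\
    ex_derive (fun t => pder w u x t) y /\
    continuous (fun p : R * R => pder w u (fst p) (snd p)) (x, y).

Definition smooth3 (u : map3) : Prop :=
  smooth2 (comp1 u) /\ smooth2 (comp2 u) /\ smooth2 (comp3 u).

Definition Dx3 (u : map3) (x y : R) : V3 :=
  v3 (Dx (comp1 u) x y) (Dx (comp2 u) x y) (Dx (comp3 u) x y).
Definition Dy3 (u : map3) (x y : R) : V3 :=
  v3 (Dy (comp1 u) x y) (Dy (comp2 u) x y) (Dy (comp3 u) x y).

Definition dot3 (a b : V3) : R := c1 a * c1 b + c2 a * c2 b + c3 a * c3 b.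
Definition cross3 (a b : V3) : V3 :=
  v3 (c2 a * c3 b - c3 a * c2 b) (c3 a * c1 b - c1 a * c3 b) (c1 a * c2 b - c2 a * c1 b).
Definition norm3 (a : V3) : R := sqrt (dot3 a a).

Definition in_cdisc (r x y : R) : Prop := x ^ 2 + y ^ 2 <= r ^ 2.

Definition harmonic_on (r : R) (u : map3) : Prop :=
  forall x y, in_cdisc r x y ->
    pder (true :: true :: nil) (comp1 u) x y + pder (false :: false :: nil) (comp1 u) x y = 0 /\
    pder (true :: true :: nil) (comp2 u) x y + pder (false :: false :: nil) (comp2 u) x y = 0 /\
    pder (true :: true :: nil) (comp3 u) x y + pder (false :: false :: nil) (comp3 u) x y = 0.

Definition conformal_on (r : R) (u : map3) : Prop :=
  forall x y, in_cdisc r x y ->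
    dot3 (Dx3 u x y) (Dy3 u x y) = 0 /\
    dot3 (Dx3 u x y) (Dx3 u x y) = dot3 (Dy3 u x y) (Dy3 u x y).

Definition nonconstant_on (r : R) (u : map3) : Prop :=
  exists x y x' y', in_cdisc r x y /\ in_cdisc r x' y' /\ u x y <> u x' y'.

Definition branched_minimal_immersion (r : R) (h : map3) : Prop :=
  smooth3 h /\ harmonic_on r h /\ conformal_on r h /\ nonconstant_on r h.

Definition area (r : R) (u : map3) : R :=
  RInt (fun x => RInt (fun y => norm3 (cross3 (Dx3 u x y) (Dy3 u x y)))
                      (- sqrt (r ^ 2 - x ^ 2)) (sqrt (r ^ 2 - x ^ 2))) (- r) r.

Definition add_smul (h : map3) (t : R) (W : map3) : map3 :=
  fun x y => v3 (c1 (h x y) + t * c1 (W x y)) (c2 (h x y) + t * c2 (W x y))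
                (c3 (h x y) + t * c3 (W x y)).

Definition unstable (r : R) (h : map3) : Prop :=
  exists W : map3,
    smooth3 W /\
    (forall x y, x ^ 2 + y ^ 2 = r ^ 2 -> W x y = v3 0 0 0) /\
    exists (A' : R -> R) (d eps : R),
      0 < eps /\
      (forall t, Rabs t < eps -> is_derive (fun s => area r (add_smul h s W)) t (A' t)) /\
      is_derive A' 0 d /\ d < 0.

Definition dz (u : R -> R -> R) (x y : R) : C :=
  (RtoC (Dx u x y / 2) - Ci * RtoC (Dy u x y / 2))%C.

Definition WE_rep (r : R) (h : map3) (f g : C -> C) : Prop :=
  forall x y, in_cdisc r x y ->
    let z := (x, y) : C in
    dz (comp1 h) x y = (RtoC (1/2) * f z * (RtoC 1 - g z * g z))%C /\
    dz (comp2 h) x y = (Ci * RtoC (1/2) * f z * (RtoC 1 + g z * g z))%C /\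
    dz (comp3 h) x y = (f z * g z)%C.

Definition Pm (m k : nat) (a b : nat -> C) (s : R) : R :=
  - INR m * (Cmod (b k * a m)%C) ^ 2 * s ^ (2 * m)
  + sum_f_R0 (fun j => INR (m - j) * (Cmod (b (k + j)%nat)) ^ 2
                       * (1 + (Cmod (a 0%nat)) ^ 2) ^ 2 * s ^ (2 * j)) (m - 1).

(* Main.v *)
(** Let c = conj(a_m), w = z^m and g = a_0 + w G.  In the equation P_m(s0) = 0 the terms with j > 0 have the sign of the
    term with j = 0, so s0 < r forces (1 + |a_0|^2)^2 < |a_m|^2 r^(2m); only this inequality is used.

    Let e' = ((1 - a_0^2)/2, i (1 + a_0^2)/2, a_0), the value of h_z / f where g = a_0.  The destabilizing variation is
    W = kappa Re ((c / w) e') with kappa = chi tau, where tau = 1 - |w|^2 / r^(2m) vanishes on the boundary circle and chi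
    is a cutoff vanishing at 0 and at the zeros of f.  Up to a null Lagrangian, the second variation of the area at W is
    4 \int (u^2 |kappa_z|^2 + kappa^2 J), where u is the normal component of Re ((c / w) e') and J = - u Re (c conj(g') w' G^2) / (1 + |g|^2)^2.
    When chi = 1, adding an explicit divergence turns the integrand into
    |w'|^2 / 4 (|c|^2 (1 + |a_0|^2)^2 / r^(4m) - |a_m|^4 / r^(2m)) minus a square, which has negative integral.

    With F = w f^2, s = |F|^2 + exp(-L) and v = ln s, the cutoff is chi = (|F|^2 / s) (1 + v / L).  The function v is subharmonic
    and, by a Jensen type inequality, bounded in L^1 uniformly in L; hence the weighted Dirichlet energy of chi is O(1 / L).

    Finally W_z is divisible by f, so the area density of h + t W is |f|^2 times the square root of a quartic polynomial
    in t with constant term bounded away from 0, and the area can be differentiated under the integral sign. *)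

From Stdlib Require Import Reals Lra Lia List Classical ClassicalEpsilon FunctionalExtensionality.
From Coquelicot Require Import Coquelicot.
Require Import Defs.
Open Scope R_scope.

(** * Integration over a disc *)

(** With N the Gauss map, e'.N = (g - a_0)(1 + a_0 conj(g)) / (1 + |g|^2). This is a complex Jacobi
    function, the normal part of a translation, and it vanishes to order m at 0; dividing by w = z^m
    keeps u smooth although the field (c / w) e' blows up at 0. Since c / w is meromorphic, the
    Jacobi operator Lap + |grad N|^2 applied to u sees only the derivative of c / w, and J is - u /
    4 times the result. The field is cut off at 0 because its tangential part has a pole there, and
    at the zeros of f because differentiating the area relies on W_z being divisible by f. Points
    have zero capacity in the plane, so a logarithmic cutoff costs arbitrarily little energy. F
    contains f^2 rather than f: the z-derivative of |f|^4 is still f times a continuous function,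
    that of |f|^2 in general is not. The factor w in F removes the pole: kappa c / w = (kappa /
    |w|^2) c conj(w). *)

Lemma continuous_Rplus {U : UniformSpace} (f g : U -> R) (x : U) :
  continuous f x -> continuous g x -> continuous (fun y => f y + g y) x.
Proof. intros; now apply (continuous_plus (V := R_NormedModule) f g). Qed.

Lemma continuous_Rmult {U : UniformSpace} (f g : U -> R) (x : U) :
  continuous f x -> continuous g x -> continuous (fun y => f y * g y) x.
Proof. intros; now apply (continuous_mult (K := R_AbsRing) f g). Qed.

Lemma continuous_Ropp {U : UniformSpace} (f : U -> R) (x : U) :
  continuous f x -> continuous (fun y => - f y) x.
Proof. intros; now apply (continuous_opp (V := R_NormedModule) f). Qed.

Lemma continuous_Rminus {U : UniformSpace} (f g : U -> R) (x : U) :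
  continuous f x -> continuous g x -> continuous (fun y => f y - g y) x.
Proof. intros; apply continuous_Rplus; auto; now apply continuous_Ropp. Qed.

Lemma continuous_Rinv' {U : UniformSpace} (f : U -> R) (x : U) :
  continuous f x -> f x <> 0 -> continuous (fun y => / f y) x.
Proof.
  intros Hf H0. apply (continuous_comp f (fun x : R => / x)); auto.
  now apply continuous_Rinv.
Qed.

Lemma continuous_Rdiv {U : UniformSpace} (f g : U -> R) (x : U) :
  continuous f x -> continuous g x -> g x <> 0 -> continuous (fun y => f y / g y) x.
Proof. intros; apply continuous_Rmult; auto; now apply continuous_Rinv'. Qed.

Lemma continuous_Rsqrt {U : UniformSpace} (f : U -> R) (x : U) :
  continuous f x -> continuous (fun y => sqrt (f y)) x.
Proof. intros Hf; apply (continuous_comp f sqrt); auto; apply continuous_sqrt. Qed.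

Lemma continuous_Rln {U : UniformSpace} (f : U -> R) (x : U) :
  continuous f x -> 0 < f x -> continuous (fun y => ln (f y)) x.
Proof. intros Hf H0; apply (continuous_comp f ln); auto; now apply continuous_ln. Qed.

Lemma continuous_Rabs' {U : UniformSpace} (f : U -> R) (x : U) :
  continuous f x -> continuous (fun y => Rabs (f y)) x.
Proof. intros Hf; apply (continuous_comp f Rabs); auto; apply continuous_Rabs. Qed.

Lemma continuous_Rpow {U : UniformSpace} (f : U -> R) (n : nat) (x : U) :
  continuous f x -> continuous (fun y => f y ^ n) x.
Proof.
  intros Hf; induction n as [|n IH]; simpl.
  - apply continuous_const.
  - now apply continuous_Rmult.
Qed.

Lemma continuous_fstC (z : C) : continuous (fun z : C => fst z) z.
Proof. destruct z; apply continuous_fst. Qed.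

Lemma continuous_sndC (z : C) : continuous (fun z : C => snd z) z.
Proof. destruct z; apply continuous_snd. Qed.

Lemma continuous_pairC {U : UniformSpace} (f g : U -> R) (x : U) :
  continuous f x -> continuous g x -> continuous (fun y => (f y, g y) : C) x.
Proof.
  intros Hf Hg P [d Hd].
  assert (H1 : locally x (fun y => ball (f x) d (f y))) by apply (Hf _ (locally_ball _ d)).
  assert (H2 : locally x (fun y => ball (g x) d (g y))) by apply (Hg _ (locally_ball _ d)).
  change (locally x (fun y => P (f y, g y))).
  generalize (filter_and _ _ H1 H2). apply filter_imp.
  intros y [Hy1 Hy2]. apply Hd. now split.
Qed.

Ltac cont1 :=
  lazymatch goal with
  | |- continuous (fun _ => ?c) _ => apply continuous_const
  | |- continuous (fun x => x) _ => apply continuous_id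
  | |- continuous (fun x => _ + _) _ => apply continuous_Rplus
  | |- continuous (fun x => _ - _) _ => apply continuous_Rminus
  | |- continuous (fun x => _ * _) _ => apply continuous_Rmult
  | |- continuous (fun x => _ / _) _ => apply continuous_Rdiv
  | |- continuous (fun x => - _) _ => apply continuous_Ropp
  | |- continuous (fun x => / _) _ => apply continuous_Rinv'
  | |- continuous (fun x => _ ^ _) _ => apply continuous_Rpow
  | |- continuous (fun x => sqrt _) _ => apply continuous_Rsqrt
  | |- continuous (fun x => Rabs _) _ => apply continuous_Rabs'
  | |- continuous (fun x => ln _) _ => apply continuous_Rln
  | |- continuous (fun x => fst x) _ => first [apply continuous_fstC | apply continuous_fst]
  | |- continuous (fun x => snd x) _ => first [apply continuous_sndC | apply continuous_snd]
  | |- continuous fst _ => first [apply continuous_fstC | apply continuous_fst]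
  | |- continuous snd _ => first [apply continuous_sndC | apply continuous_snd]
  end.

(** * Compactness of intervals and integrals depending on a parameter *)

Lemma tube {T : UniformSpace} (P : T -> R -> Prop) (p : T) (a b : R) :
  (forall xi, a <= xi <= b -> locally ((p, xi) : T * R) (fun q => P (fst q) (snd q))) ->
  locally p (fun q => forall xi, a <= xi <= b -> P q xi).
Proof.
  intros H.
  (* [compactness_value_1d] takes a gauge on all of R, so a radius is chosen for every xi, with the
     default 1 outside [a, b]. *)
  assert (Hd : forall xi, exists d : posreal, a <= xi <= b ->
     forall q eta, ball p d q -> Rabs (eta - xi) < d -> P q eta).
  { intros xi. destruct (classic (a <= xi <= b)) as [Hx|Hx].
    - destruct (H xi Hx) as [d Hd]. exists d. intros _ q eta Hq He.
      apply (Hd (q, eta)). split; auto.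
    - exists (mkposreal 1 Rlt_0_1). intros; contradiction. }
  pose (delta := fun xi => proj1_sig (constructive_indefinite_description _ (Hd xi))).
  assert (Hdelta : forall xi, a <= xi <= b ->
     forall q eta, ball p (delta xi) q -> Rabs (eta - xi) < delta xi -> P q eta).
  { intros xi. exact (proj2_sig (constructive_indefinite_description _ (Hd xi))). }
  destruct (compactness_value_1d a b delta) as [d Hdd].
  exists d. intros q Hq xi Hxi.
  apply NNPP. intros HP. apply (Hdd xi Hxi). intros (t & Ht & Hxt & Hdt).
  apply HP. apply (Hdelta t Ht); auto.
  now apply ball_le with d.
Qed.

(** Heine-Borel in the form of a supremum argument: if c is the supremum of the ends up to which one
    bound works, the local bound at c covers the gap below c and reaches beyond c unless c = b. The
    predicate is abstract because [plane_bounded] also uses it with a neighbourhood statement for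
    [P]. *)
Lemma compact_bounded_1d (P : R -> R -> Prop) (a b : R) :
  (forall x M M', P x M -> M <= M' -> P x M') ->
  (forall x, a <= x <= b -> exists M, locally x (fun y => P y M)) ->
  exists M, forall x, a <= x <= b -> P x M.
Proof.
  intros HP H.
  destruct (Rle_or_lt a b) as [Hab|Hab].
  2:{ exists 0. intros; lra. }
  pose (S := fun c => a <= c <= b /\ exists M, forall x, a <= x <= c -> P x M).
  assert (Sa : S a).
  { split; [lra|]. destruct (H a) as [M HM]; [lra|]. exists M. intros x Hx.
    replace x with a by lra. now apply locally_singleton in HM. }
  destruct (completeness S) as [c [Hc1 Hc2]].
  - exists b. intros c [Hc _]; lra.
  - now exists a.
  - assert (Hac : a <= c) by now apply Hc1.
    assert (Hcb : c <= b) by (apply Hc2; intros y [Hy _]; lra).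
    destruct (H c) as [M [d HM]]; [lra|].
    assert (Hex : exists c', S c' /\ c - d < c').
    { apply NNPP. intros Hn. assert (c <= c - d).
      { apply Hc2. intros y Hy. apply Rnot_lt_le. intros Hl. apply Hn. now exists y. }
      destruct d; simpl in *; lra. }
    destruct Hex as (c' & [Hc' [M' HM']] & Hlt).
    assert (Hb : forall x, a <= x <= b -> x < c + d -> P x (Rmax M M')).
    { intros x Hx Hxd. destruct (Rle_or_lt x c') as [Hl|Hl].
      - apply HP with M'; [apply HM'; lra|apply Rmax_r].
      - apply HP with M; [|apply Rmax_l]. apply HM.
        apply Rabs_lt_between. unfold minus, plus, opp; simpl. lra. }
    destruct (Rlt_or_le c b) as [Hlb|Hlb].
    + exfalso. pose (c2 := Rmin b (c + d / 2)).
      assert (Hd : 0 < d) by apply cond_pos.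
      assert (S c2).
      { split.
        - unfold c2. split; [apply Rmin_glb; lra|apply Rmin_l].
        - exists (Rmax M M'). intros x Hx. pose proof (Rmin_l b (c + d/2)).
          pose proof (Rmin_r b (c + d/2)). unfold c2 in Hx. apply Hb; lra. }
      apply Hc1 in H0. unfold c2 in H0. unfold Rmin in H0. destruct (Rle_dec b (c + d/2)); lra.
    + exists (Rmax M M'). intros x Hx. apply Hb; auto. assert (Hd : 0 < d) by apply cond_pos. lra.
Qed.

Lemma continuous_locally_lt {U : UniformSpace} (f : U -> R) (x : U) (e : R) :
  continuous f x -> 0 < e -> locally x (fun y => Rabs (f y - f x) < e).
Proof.
  intros Hf He. exact (Hf _ (locally_ball (f x) (mkposreal e He))).
Qed.

Lemma continuous_of_locally_lt {U : UniformSpace} (f : U -> R) (x : U) :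
  (forall e, 0 < e -> locally x (fun y => Rabs (f y - f x) < e)) -> continuous f x.
Proof.
  intros H P [e He]. change (locally x (fun y => P (f y))).
  generalize (H e (cond_pos e)). apply filter_imp.
  intros y Hy. apply He, Hy.
Qed.

Lemma continuous_RInt_param {T : UniformSpace} (Psi : T -> R -> R) (p : T) (a b : R) :
  a <= b ->
  locally p (fun q => ex_RInt (Psi q) a b) ->
  (forall xi, a <= xi <= b ->
     continuous (fun q : T * R => Psi (fst q) (snd q)) (p, xi)) ->
  continuous (fun q => RInt (Psi q) a b) p.
Proof.
  intros Hab Hex Hc. apply continuous_of_locally_lt. intros e He.
  (* The [+ 1] keeps the denominator positive when a = b. The factor 2 pays for comparing both
     [Psi q eta] and [Psi p eta] with the value at the centre of the neighbourhood. *)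
  assert (He' : 0 < e / (2 * (b - a + 1))).
  { apply Rdiv_lt_0_compat; lra. }
  assert (Ht : locally p (fun q => forall xi, a <= xi <= b ->
            Rabs (Psi q xi - Psi p xi) < 2 * (e / (2 * (b - a + 1))))).
  { apply (tube (fun q xi => Rabs (Psi q xi - Psi p xi) < 2 * (e / (2 * (b - a + 1))))).
    intros xi Hxi.
    destruct (continuous_locally_lt _ _ _ (Hc xi Hxi) He') as [d Hd].
    exists d. intros [q eta] [Hq Heta]; simpl in *.
    generalize (Hd (q, eta) (conj Hq Heta)); simpl; intros H1.
    generalize (Hd (p, eta) (conj (ball_center p d) Heta)); simpl; intros H2.
    replace (Psi q eta - Psi p eta) with ((Psi q eta - Psi p xi) - (Psi p eta - Psi p xi)) by ring.
    eapply Rle_lt_trans; [apply Rabs_triang|]. rewrite Rabs_Ropp. lra. }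
  generalize (filter_and _ _ Hex Ht). apply filter_imp. intros q [Hq1 Hq2].
  assert (Hp : ex_RInt (Psi p) a b) by now apply locally_singleton in Hex.
  replace (RInt (Psi q) a b - RInt (Psi p) a b) with (RInt (fun xi => Psi q xi - Psi p xi) a b)
    by (apply (RInt_minus (V := R_CompleteNormedModule)); auto).
  apply Rle_lt_trans with ((b - a) * (2 * (e / (2 * (b - a + 1))))).
  - apply abs_RInt_le_const; auto.
    + now apply (ex_RInt_minus (V := R_NormedModule)).
    + intros t Htt. now left; apply Hq2.
  - replace ((b - a) * (2 * (e / (2 * (b - a + 1))))) with (e * ((b - a) / (b - a + 1))) by (field; lra).
    rewrite <- (Rmult_1_r e) at 2. apply Rmult_lt_compat_l; auto.
    apply (Rmult_lt_reg_r (b - a + 1)); [lra|]. field_simplify; lra.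
Qed.

(** * The integral over the disc, by vertical chords *)

Definition half_chord (r x : R) : R := sqrt (r ^ 2 - x ^ 2).

(** Order and limits of integration copy those of [area], so that an area is a [dint] by
    conversion. *)
Definition dint (r : R) (F : C -> R) : R :=
  RInt (fun x => RInt (fun y => F (x, y)) (- half_chord r x) (half_chord r x)) (- r) r.

Definition cdisc (r : R) (z : C) : Prop := fst z ^ 2 + snd z ^ 2 <= r ^ 2.

Definition cont_cdisc (r : R) (F : C -> R) : Prop := forall z, cdisc r z -> continuous F z.

Lemma half_chord_pos (r x : R) : 0 <= half_chord r x.
Proof. apply sqrt_pos. Qed.

Lemma half_chord_sqr (r x : R) : - r <= x <= r -> half_chord r x ^ 2 = r ^ 2 - x ^ 2.
Proof. intros H. unfold half_chord. rewrite pow2_sqrt; auto. nra. Qed.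

Lemma cdisc_chord (r x y : R) :
  - r <= x <= r -> - half_chord r x <= y <= half_chord r x -> cdisc r (x, y).
Proof.
  intros Hx Hy. unfold cdisc; cbn [fst snd].
  pose proof (half_chord_sqr r x Hx). nra.
Qed.

Lemma continuous_half_chord (r x : R) : continuous (half_chord r) x.
Proof. unfold half_chord. repeat cont1. Qed.

(* Radial retraction of the plane onto the closed disc: it turns a function that is continuous on the closed disc into one continuous on the plane with the same disc integral. *)
Definition retract (r : R) (z : C) : C :=
  let k := r / Rmax r (sqrt (fst z ^ 2 + snd z ^ 2)) in (k * fst z, k * snd z).

Lemma retract_cdisc (r : R) (z : C) : 0 < r -> cdisc r (retract r z).
Proof.
  intros Hr.
  set (n := sqrt (fst z ^ 2 + snd z ^ 2)).
  assert (Hn : n ^ 2 = fst z ^ 2 + snd z ^ 2) by (unfold n; apply pow2_sqrt; nra).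
  assert (0 <= n) by apply sqrt_pos.
  pose proof (Rmax_l r n). pose proof (Rmax_r r n). set (mx := Rmax r n) in *.
  assert (E : (r / mx * fst z) ^ 2 + (r / mx * snd z) ^ 2 = r ^ 2 * (n ^ 2 / mx ^ 2))
    by (rewrite Hn; field; lra).
  change ((r / mx * fst z) ^ 2 + (r / mx * snd z) ^ 2 <= r ^ 2).
  rewrite E.
  apply Rle_trans with (r ^ 2 * 1); [|lra]. apply Rmult_le_compat_l; [nra|].
  apply (Rmult_le_reg_r (mx ^ 2)); [nra|]. field_simplify; [|lra]. nra.
Qed.

Lemma retract_id (r : R) (z : C) : 0 < r -> cdisc r z -> retract r z = z.
Proof.
  intros Hr Hz. unfold cdisc in Hz. unfold retract. destruct z as [x y]; cbn [fst snd] in *.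
  rewrite Rmax_left.
  - unfold Rdiv. rewrite Rinv_r by lra. now rewrite !Rmult_1_l.
  - rewrite <- (sqrt_pow2 r) by lra. now apply sqrt_le_1_alt.
Qed.

Lemma continuous_retract (r : R) (z : C) : 0 < r -> continuous (retract r) z.
Proof.
  intros Hr. unfold retract.
  assert (H : continuous (fun z : C => r / Rmax r (sqrt (fst z ^ 2 + snd z ^ 2))) z).
  { apply continuous_Rdiv; [apply continuous_const| |].
    - assert (E : forall z : C, Rmax r (sqrt (fst z ^ 2 + snd z ^ 2)) =
         (r + sqrt (fst z ^ 2 + snd z ^ 2) + Rabs (r - sqrt (fst z ^ 2 + snd z ^ 2))) / 2).
      { intros t. unfold Rmax, Rabs. destruct (Rle_dec _ _), (Rcase_abs _); lra. }
      eapply continuous_ext; [intros t; symmetry; apply E|].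
      repeat cont1. lra.
    - pose proof (Rmax_l r (sqrt (fst z ^ 2 + snd z ^ 2))). lra. }
  apply continuous_pairC; apply continuous_Rmult; auto; cont1.
Qed.

Lemma continuous_comp_retract (r : R) (F : C -> R) (z : C) :
  0 < r -> cont_cdisc r F -> continuous (fun z => F (retract r z)) z.
Proof.
  intros Hr HF. apply (continuous_comp (retract r) F).
  - now apply continuous_retract.
  - now apply HF, retract_cdisc.
Qed.

Lemma dint_ext (r : R) (F G : C -> R) :
  0 < r -> (forall z, fst z ^ 2 + snd z ^ 2 < r ^ 2 -> F z = G z) -> dint r F = dint r G.
Proof.
  intros Hr H. apply RInt_ext. intros x. rewrite Rmin_left, Rmax_right by lra. intros Hx.
  pose proof (half_chord_pos r x). pose proof (half_chord_sqr r x ltac:(lra)).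
  apply RInt_ext. intros y. rewrite Rmin_left, Rmax_right by lra. intros Hy.
  apply H. cbn [fst snd]. nra.
Qed.

(** The integrand after the substitution y = [half_chord r x] xi. It moves every chord to the fixed
    interval [-1, 1], where continuity in the parameter x is available, and it divides by nothing,
    so the chords of length 0 are included. *)
Definition box (r : R) (F : C -> R) (x xi : R) : R :=
  half_chord r x * F (x, half_chord r x * xi).

Lemma chord_box (r : R) (F : C -> R) (x : R) :
  ex_RInt (fun y => F (x, y)) (- half_chord r x) (half_chord r x) ->
  RInt (fun y => F (x, y)) (- half_chord r x) (half_chord r x) = RInt (box r F x) (-1) 1.
Proof.
  intros Hex.
  generalize (RInt_comp_lin (V := R_CompleteNormedModule) (fun y => F (x, y)) (half_chord r x) 0 (-1) 1).
  replace (half_chord r x * -1 + 0) with (- half_chord r x) by ring.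
  replace (half_chord r x * 1 + 0) with (half_chord r x) by ring.
  intros H. rewrite <- (H Hex). apply RInt_ext. intros y _. unfold box, scal; simpl.
  unfold mult; simpl. now rewrite Rplus_0_r.
Qed.

Section PlaneContinuous.
Variables (r : R) (F : C -> R).
Hypothesis Hr : 0 < r.
Hypothesis HF : forall z, continuous F z.

Lemma plane_ex_chord (x a b : R) : ex_RInt (fun y => F (x, y)) a b.
Proof.
  apply (ex_RInt_continuous (V := R_CompleteNormedModule)). intros y _.
  apply (continuous_comp (fun y => (x, y) : C) F); [|apply HF].
  apply continuous_pairC; cont1.
Qed.

Lemma plane_continuous_box (x xi : R) :
  continuous (fun q : R * R => box r F (fst q) (snd q)) (x, xi).
Proof.
  unfold box.
  assert (H : continuous (fun q : R * R => half_chord r (fst q)) (x, xi)).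
  { apply (continuous_comp fst (half_chord r)); [cont1|apply continuous_half_chord]. }
  apply continuous_Rmult; auto.
  apply (continuous_comp (fun q : R * R => (fst q, half_chord r (fst q) * snd q) : C) F).
  - apply continuous_pairC; [cont1|]. apply continuous_Rmult; auto. cont1.
  - apply HF.
Qed.

Lemma plane_ex_box (x : R) : ex_RInt (box r F x) (-1) 1.
Proof.
  apply (ex_RInt_continuous (V := R_CompleteNormedModule)). intros xi _.
  apply (continuous_comp_2 (fun _ => x) (fun xi => xi) (box r F)).
  - apply continuous_const.
  - apply continuous_id.
  - apply plane_continuous_box.
Qed.

Lemma plane_continuous_chord (x : R) :
  continuous (fun x => RInt (fun y => F (x, y)) (- half_chord r x) (half_chord r x)) x.
Proof.
  apply continuous_ext with (f := fun x => RInt (box r F x) (-1) 1).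
  - intros t. symmetry. apply chord_box, plane_ex_chord.
  - apply continuous_RInt_param; [lra| |].
    + exists (mkposreal 1 Rlt_0_1). intros; apply plane_ex_box.
    + intros xi _. apply plane_continuous_box.
Qed.

(** Compactness of the square is used one variable at a time: the inner application bounds F near a
    whole vertical segment, and [tube] makes the neighbourhood of that segment uniform. *)
Lemma plane_bounded : exists M, forall z, cdisc r z -> Rabs (F z) <= M.
Proof.
  destruct (compact_bounded_1d
    (fun x M => forall xi, - r <= xi <= r -> Rabs (F (x, xi)) <= M) (- r) r) as [M HM].
  - intros x M M' H HM xi Hxi. generalize (H xi Hxi); lra.
  - intros x _.
    destruct (compact_bounded_1d
       (fun xi M => locally ((x, xi) : R * R) (fun q => Rabs (F q) <= M)) (- r) r) as [M HM].
    + intros xi M M' H HM. revert H. apply filter_imp. intros; lra.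
    + intros xi _. exists (Rabs (F (x, xi)) + 1).
      generalize (continuous_locally_lt _ _ _ (HF (x, xi)) Rlt_0_1). intros Hl.
      destruct Hl as [d Hd].
      exists (mkposreal (d / 2) ltac:(destruct d; simpl; lra)).
      intros y Hy. exists (mkposreal (d / 2) ltac:(destruct d; simpl; lra)).
      intros q [Hq1 Hq2].
      assert (Hb : ball ((x, xi) : C) d q).
      { split; simpl.
        - apply ball_le with (d / 2); auto. destruct d; simpl; lra.
        - replace (pos d) with (d / 2 + d / 2) by field.
          now apply ball_triangle with y. }
      generalize (Hd q Hb). intros Hl.
      replace (F q) with ((F q - F (x, xi)) + F (x, xi)) by ring.
      eapply Rle_trans; [apply Rabs_triang|]. simpl in *. lra.
    + exists M. apply (tube (fun x xi => Rabs (F (x, xi)) <= M)).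
      intros xi Hxi. generalize (HM xi Hxi). apply filter_imp. intros [u v]; auto.
  - exists M. intros [x y] Hz. unfold cdisc in Hz; simpl in Hz. apply HM; nra.
Qed.

End PlaneContinuous.

Section DiscContinuous.
Variable r : R.
Hypothesis Hr : 0 < r.

Lemma cont_cdisc_bounded (F : C -> R) :
  cont_cdisc r F -> exists M, 0 <= M /\ forall z, cdisc r z -> Rabs (F z) <= M.
Proof.
  intros HF.
  destruct (plane_bounded r (fun z => F (retract r z))) as [M HM].
  - exact Hr.
  - intros z. now apply continuous_comp_retract.
  - exists (Rabs M). split; [apply Rabs_pos|].
    intros z Hz. generalize (HM z Hz). rewrite retract_id by auto.
    pose proof (Rle_abs M). lra.
Qed.

Lemma chord_retract (F : C -> R) (x : R) : - r <= x <= r ->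
  RInt (fun y => F (x, y)) (- half_chord r x) (half_chord r x) =
  RInt (fun y => F (retract r (x, y))) (- half_chord r x) (half_chord r x).
Proof.
  intros Hx. pose proof (half_chord_pos r x).
  apply RInt_ext. intros y. rewrite Rmin_left, Rmax_right by lra. intros Hy.
  rewrite retract_id; auto. apply cdisc_chord; lra.
Qed.

Lemma dint_retract (F : C -> R) : dint r F = dint r (fun z => F (retract r z)).
Proof.
  apply dint_ext; auto. intros z Hz. rewrite retract_id; auto. unfold cdisc; lra.
Qed.

Lemma ex_chord (F : C -> R) (x : R) : cont_cdisc r F -> - r <= x <= r ->
  ex_RInt (fun y => F (x, y)) (- half_chord r x) (half_chord r x).
Proof.
  intros HF Hx. pose proof (half_chord_pos r x).
  apply (ex_RInt_ext (fun y => F (retract r (x, y)))).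
  - intros y. rewrite Rmin_left, Rmax_right by lra. intros Hy.
    rewrite retract_id; auto. apply cdisc_chord; lra.
  - apply (plane_ex_chord (fun z => F (retract r z))). intros; now apply continuous_comp_retract.
Qed.

Lemma ex_dint (F : C -> R) : cont_cdisc r F ->
  ex_RInt (fun x => RInt (fun y => F (x, y)) (- half_chord r x) (half_chord r x)) (- r) r.
Proof.
  intros HF. apply (ex_RInt_ext (fun x => RInt (fun y => F (retract r (x, y))) (- half_chord r x) (half_chord r x))).
  - intros x. rewrite Rmin_left, Rmax_right by lra. intros Hx. symmetry. apply chord_retract; lra.
  - apply (ex_RInt_continuous (V := R_CompleteNormedModule)). intros x _.
    apply (plane_continuous_chord r (fun z => F (retract r z))); auto. intros; now apply continuous_comp_retract.
Qed.

Lemma dint_plus (F G : C -> R) : cont_cdisc r F -> cont_cdisc r G ->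
  dint r (fun z => F z + G z) = dint r F + dint r G.
Proof.
  intros HF HG. unfold dint.
  rewrite <- (RInt_plus (V := R_CompleteNormedModule)) by now apply ex_dint.
  apply RInt_ext. intros x. rewrite Rmin_left, Rmax_right by lra. intros Hx.
  apply (RInt_plus (V := R_CompleteNormedModule)); apply ex_chord; auto; lra.
Qed.

Lemma dint_scal (k : R) (F : C -> R) : cont_cdisc r F ->
  dint r (fun z => k * F z) = k * dint r F.
Proof.
  intros HF. unfold dint.
  rewrite <- (RInt_scal (V := R_CompleteNormedModule) _ _ _ k) by now apply ex_dint.
  apply RInt_ext. intros x. rewrite Rmin_left, Rmax_right by lra. intros Hx.
  apply (RInt_scal (V := R_CompleteNormedModule)); apply ex_chord; auto; lra.
Qed.

Lemma dint_le (F G : C -> R) : cont_cdisc r F -> cont_cdisc r G ->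
  (forall z, cdisc r z -> F z <= G z) -> dint r F <= dint r G.
Proof.
  intros HF HG H. apply RInt_le; [lra|now apply ex_dint|now apply ex_dint|].
  intros x Hx. pose proof (half_chord_pos r x). apply RInt_le; [lra|apply ex_chord; auto; lra|apply ex_chord; auto; lra|].
  intros y Hy. apply H, cdisc_chord; lra.
Qed.

Lemma dint_minus (F G : C -> R) : cont_cdisc r F -> cont_cdisc r G ->
  dint r (fun z => F z - G z) = dint r F - dint r G.
Proof.
  intros HF HG. transitivity (dint r (fun z => F z + (-1) * G z)).
  - apply dint_ext; auto; intros; ring.
  - rewrite dint_plus, dint_scal; auto. ring.
    intros z Hz. apply continuous_Rmult; [cont1|auto].
Qed.

Lemma dint_one_pos : 0 < dint r (fun _ => 1).
Proof.
  apply RInt_gt_0; [lra| |].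
  - intros x Hx. rewrite RInt_const. unfold scal; simpl; unfold mult; simpl.
    assert (0 < half_chord r x) by (apply sqrt_lt_R0; nra). lra.
  - intros x _. apply (plane_continuous_chord r (fun _ => 1)); auto. intros; apply continuous_const.
Qed.

End DiscContinuous.

(** * Wirtinger derivatives and the divergence theorem *)

Lemma is_derive_Rplus (f g : R -> R) (x df dg : R) :
  is_derive f x df -> is_derive g x dg -> is_derive (fun t => f t + g t) x (df + dg).
Proof. intros; now apply (is_derive_plus (V := R_NormedModule) f g). Qed.

Lemma is_derive_Rminus (f g : R -> R) (x df dg : R) :
  is_derive f x df -> is_derive g x dg -> is_derive (fun t => f t - g t) x (df - dg).
Proof. intros; now apply (is_derive_minus (V := R_NormedModule) f g). Qed.

Lemma is_derive_Rmult (f g : R -> R) (x df dg : R) :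
  is_derive f x df -> is_derive g x dg -> is_derive (fun t => f t * g t) x (df * g x + f x * dg).
Proof. intros; apply (is_derive_mult f g); auto. intros; apply Rmult_comm. Qed.

Lemma is_derive_Ropp (f : R -> R) (x df : R) :
  is_derive f x df -> is_derive (fun t => - f t) x (- df).
Proof. intros; now apply (is_derive_opp (V := R_NormedModule) f). Qed.

Lemma is_derive_Rcomp (f g : R -> R) (x df dg : R) :
  is_derive f (g x) df -> is_derive g x dg -> is_derive (fun t => f (g t)) x (dg * df).
Proof. intros; now apply (is_derive_comp (V := R_NormedModule) f g). Qed.

Lemma is_derive_eq (f : R -> R) (x d d' : R) : is_derive f x d -> d = d' -> is_derive f x d'.
Proof. now intros H <-. Qed.

Definition odisc (rho : R) (z : C) : Prop := fst z ^ 2 + snd z ^ 2 < rho ^ 2.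

Lemma odisc_open (rho : R) (z : C) : odisc rho z -> locally z (odisc rho).
Proof.
  intros Hz. unfold odisc in Hz.
  assert (Hc : continuous (fun z : C => fst z ^ 2 + snd z ^ 2) z) by repeat cont1.
  generalize (continuous_locally_lt _ _ (rho ^ 2 - (fst z ^ 2 + snd z ^ 2)) Hc ltac:(lra)).
  apply filter_imp. intros y Hy. apply Rabs_lt_between in Hy. unfold odisc. lra.
Qed.

Lemma cdisc_odisc (r rho : R) (z : C) : 0 < r < rho -> cdisc r z -> odisc rho z.
Proof. unfold cdisc, odisc. intros H1 H2. nra. Qed.

Lemma dint_dy (r rho : R) (b b' : C -> R) :
  0 < r < rho ->
  (forall z, odisc rho z -> is_derive (fun t => b (fst z, t)) (snd z) (b' z)) ->
  (forall z, odisc rho z -> continuous b' z) ->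
  (forall z, fst z ^ 2 + snd z ^ 2 = r ^ 2 -> b z = 0) ->
  dint r b' = 0.
Proof.
  intros Hr Hd Hc H0. unfold dint.
  rewrite (RInt_ext _ (fun _ => 0)).
  { rewrite RInt_const. unfold scal; simpl; unfold mult; simpl. ring. }
  intros x. rewrite Rmin_left, Rmax_right by lra. intros Hx.
  pose proof (half_chord_pos r x) as Hs. pose proof (half_chord_sqr r x ltac:(lra)) as Hs2.
  assert (Hin : forall y, Rmin (- half_chord r x) (half_chord r x) <= y
                          <= Rmax (- half_chord r x) (half_chord r x) -> odisc rho (x, y)).
  { intros y. rewrite Rmin_left, Rmax_right by lra. intros Hy.
    apply cdisc_odisc with r; auto. apply cdisc_chord; lra. }
  apply is_RInt_unique.
  replace 0 with (minus (b (x, half_chord r x)) (b (x, - half_chord r x))).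
  - apply (is_RInt_derive (V := R_CompleteNormedModule) (fun y => b (x, y)) (fun y => b' (x, y))).
    + intros y Hy. apply (Hd (x, y)). now apply Hin.
    + intros y Hy. apply (continuous_comp (fun y => (x, y) : C) b').
      * apply continuous_pairC; cont1.
      * apply Hc. now apply Hin.
  - rewrite !H0; cbn [fst snd]; [|nra|nra]. unfold minus, plus, opp; simpl; ring.
Qed.

Lemma is_derive_half_chord (r x : R) : - r < x < r ->
  is_derive (half_chord r) x (- x / half_chord r x).
Proof.
  intros Hx. unfold half_chord. assert (0 < r ^ 2 - x ^ 2) by nra.
  assert (0 < sqrt (r ^ 2 - x ^ 2)) by now apply sqrt_lt_R0.
  auto_derive; [lra|].
  change (r * (r * 1) + - (x * (x * 1))) with (r ^ 2 - x ^ 2). field. lra.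
Qed.

Lemma continuous_slice (b : C -> R) (x y : R) :
  continuous b (x, y) -> continuous (fun y => b (x, y)) y.
Proof.
  intros H. apply (continuous_comp (fun y => (x, y) : C) b); auto.
  apply continuous_pairC; cont1.
Qed.

(** Leibniz rule with moving limits. The two boundary terms contain the values of b at the ends of
    the chord, which lie on the circle, and vanish. *)
Lemma is_derive_chord (r rho : R) (b b' : C -> R) (x : R) :
  0 < r < rho ->
  (forall z, odisc rho z -> is_derive (fun t => b (t, snd z)) (fst z) (b' z)) ->
  (forall z, odisc rho z -> continuous b z) ->
  (forall z, odisc rho z -> continuous b' z) ->
  (forall z, fst z ^ 2 + snd z ^ 2 = r ^ 2 -> b z = 0) ->
  - r < x < r ->
  is_derive (fun x => RInt (fun y => b (x, y)) (- half_chord r x) (half_chord r x)) x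
            (RInt (fun y => b' (x, y)) (- half_chord r x) (half_chord r x)).
Proof.
  intros Hr Hd Hcb Hc H0 Hx.
  set (s := half_chord r x).
  pose proof (half_chord_pos r x) as Hs. pose proof (half_chord_sqr r x ltac:(lra)) as Hs2.
  fold s in Hs, Hs2.
  (* Moving the chord sideways by less than d and lengthening it by d at both ends raises the
     squared distance from 0 by at most 6 r d, so this d keeps everything inside the disc of radius
     rho. *)
  pose (d := Rmin r ((rho ^ 2 - r ^ 2) / (8 * r))).
  assert (Hq : 0 < (rho ^ 2 - r ^ 2) / (8 * r)) by (apply Rdiv_lt_0_compat; nra).
  assert (Hd0 : 0 < d) by (apply Rmin_pos; lra).
  assert (Hd1 : d <= r) by apply Rmin_l.
  assert (Hd2 : 8 * r * d <= rho ^ 2 - r ^ 2).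
  { replace (rho ^ 2 - r ^ 2) with (8 * r * ((rho ^ 2 - r ^ 2) / (8 * r))) by (field; lra).
    apply Rmult_le_compat_l; [lra|apply Rmin_r]. }
  assert (Hsr : s <= r) by nra.
  assert (Hin : forall u t, Rabs (u - x) < d -> - s - d <= t <= s + d -> odisc rho (u, t)).
  { intros u t Hu Ht. apply Rabs_lt_between in Hu. unfold odisc; cbn [fst snd].
    assert (u ^ 2 <= x ^ 2 + 2 * r * d + d ^ 2) by nra.
    assert (t ^ 2 <= (s + d) ^ 2) by nra. nra. }
  assert (Hloc : locally x (fun u => Rabs (u - x) < d)).
  { exists (mkposreal d Hd0). intros u Hu. exact Hu. }
  assert (Hex : forall u a c, Rabs (u - x) < d -> - s - d <= a -> c <= s + d -> a <= c ->
                ex_RInt (fun t => b (u, t)) a c).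
  { intros u a c Hu Ha Hc' Hac. apply (ex_RInt_continuous (V := R_CompleteNormedModule)).
    intros t. rewrite Rmin_left, Rmax_right by lra. intros Ht.
    apply continuous_slice, Hcb, Hin; auto; lra. }
  assert (Hcd : forall u t, odisc rho (u, t) ->
     continuity_2d_pt (fun u v => Derive (fun z => b (z, v)) u) u t).
  { intros u t Hz. apply continuity_2d_pt_filterlim.
    change (continuous (fun z : C => Derive (fun u => b (u, snd z)) (fst z)) (u, t)).
    apply continuous_ext_loc with b'; [|now apply Hc].
    generalize (odisc_open _ _ Hz). apply filter_imp.
    intros z Hz'. symmetry. now apply is_derive_unique, Hd. }
  assert (Hx0 : Rabs (x - x) < d) by (rewrite Rminus_diag, Rabs_R0; lra).
  assert (Hcp : forall t, odisc rho (x, t) -> continuity_pt (fun t => b (x, t)) t).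
  { intros t Ht. apply continuity_pt_filterlim. now apply continuous_slice, Hcb. }
  evar_last.
  - apply (is_derive_RInt_param_bound_comp (fun u v => b (u, v)) (fun x => - half_chord r x) (half_chord r) x
             (- (- x / s)) (- x / s)).
    + revert Hloc. apply filter_imp. intros u Hu. apply Hex; auto; fold s; lra.
    + exists (mkposreal d Hd0). revert Hloc. apply filter_imp. intros u Hu.
      apply Hex; auto; fold s; simpl; lra.
    + exists (mkposreal d Hd0). revert Hloc. apply filter_imp. intros u Hu.
      apply Hex; auto; fold s; simpl; lra.
    + apply is_derive_Ropp. now apply is_derive_half_chord.
    + now apply is_derive_half_chord.
    + exists (mkposreal d Hd0). revert Hloc. apply filter_imp. intros u Hu t.
      fold s. simpl pos. rewrite Rmin_left, Rmax_right by lra. intros Ht.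
      exists (b' (u, t)). apply (Hd (u, t)). apply Hin; auto; lra.
    + intros t. fold s. rewrite Rmin_left, Rmax_right by lra. intros Ht. apply Hcd, Hin; auto; lra.
    + fold s. assert (Hz : odisc rho (x, - s)) by (apply Hin; auto; lra).
      apply locally_2d_locally. generalize (odisc_open _ _ Hz).
      apply filter_imp. intros [u t]. apply Hcd.
    + fold s. assert (Hz : odisc rho (x, s)) by (apply Hin; auto; lra).
      apply locally_2d_locally. generalize (odisc_open _ _ Hz).
      apply filter_imp. intros [u t]. apply Hcd.
    + apply Hcp. fold s. apply Hin; auto; lra.
    + apply Hcp. fold s. apply Hin; auto; lra.
  - fold s. rewrite !H0; cbn [fst snd]; [|nra|nra].
    rewrite Ropp_0, !Rmult_0_l, !Rplus_0_r.
    apply RInt_ext. intros t. rewrite Rmin_left, Rmax_right by lra. intros Ht.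
    apply is_derive_unique, (Hd (x, t)), Hin; auto; lra.
Qed.

(** The slope of [half_chord] is infinite at the ends, so the chord integral J b is differentiable
    only for - r < x < r. The mean value theorem applied to J b minus the primitive of J b' asks for
    no more than continuity at the ends, and the retraction makes J continuous on all of R. *)
Lemma dint_dx (r rho : R) (b b' : C -> R) :
  0 < r < rho ->
  (forall z, odisc rho z -> is_derive (fun t => b (t, snd z)) (fst z) (b' z)) ->
  (forall z, odisc rho z -> continuous b z) ->
  (forall z, odisc rho z -> continuous b' z) ->
  (forall z, fst z ^ 2 + snd z ^ 2 = r ^ 2 -> b z = 0) ->
  dint r b' = 0.
Proof.
  intros Hr Hd Hcb Hc H0.
  pose (J := fun c x => RInt (fun y : R => c (retract r (x, y)) : R) (- half_chord r x) (half_chord r x)).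
  assert (Hret : forall c : C -> R, (forall z, odisc rho z -> continuous c z) ->
            forall z, continuous (fun z => c (retract r z)) z).
  { intros c Hcc z. apply continuous_comp_retract; [lra|]. intros y Hy.
    apply Hcc. now apply cdisc_odisc with r. }
  assert (HJc : forall c : C -> R, (forall z, odisc rho z -> continuous c z) -> forall x, continuous (J c) x).
  { intros c Hcc x. apply (plane_continuous_chord r (fun z => c (retract r z))); auto. }
  assert (HJ : forall x, - r < x < r -> is_derive (J b) x (J b' x)).
  { intros x Hx.
    assert (E : forall c : C -> R, locally x (fun t => RInt (fun y : R => c (t, y) : R) (- half_chord r t) (half_chord r t) = J c t)).
    { intros c. exists (mkposreal (Rmin (r - x) (x + r)) ltac:(apply Rmin_pos; lra)).
      intros t Ht. change (Rabs (t - x) < Rmin (r - x) (x + r)) in Ht. apply Rabs_lt_between in Ht.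
      pose proof (Rmin_l (r - x) (x + r)). pose proof (Rmin_r (r - x) (x + r)).
      apply chord_retract; lra. }
    apply (is_derive_ext_loc _ _ _ _ (E b)).
    rewrite <- (locally_singleton _ _ (E b')).
    now apply is_derive_chord with rho. }
  assert (Hend : forall x, x ^ 2 = r ^ 2 -> J b x = 0).
  { intros x Hx. unfold J, half_chord. rewrite Hx, Rminus_diag, sqrt_0, Ropp_0. now rewrite RInt_point. }
  assert (HI : forall x, is_derive (fun x => RInt (J b') (- r) x) x (J b' x)).
  { intros x. apply (is_derive_RInt (V := R_NormedModule) (J b') (fun x => RInt (J b') (- r) x) (- r)).
    - exists (mkposreal 1 Rlt_0_1). intros y _.
      apply (RInt_correct (V := R_CompleteNormedModule)), (ex_RInt_continuous (V := R_CompleteNormedModule)).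
      intros t _. now apply HJc.
    - now apply HJc. }
  destruct (MVT_gen (fun x => J b x - RInt (J b') (- r) x) (- r) r (fun _ => 0)) as (c & _ & Hcc).
  - rewrite Rmin_left, Rmax_right by lra. intros x Hx.
    apply is_derive_eq with (J b' x - J b' x); [|ring].
    apply is_derive_Rminus; auto.
  - intros x _. apply continuity_pt_filterlim.
    apply (continuous_Rminus (J b) (fun x => RInt (J b') (- r) x)); [now apply HJc|].
    apply (ex_derive_continuous (V := R_NormedModule) (fun x => RInt (J b') (- r) x)). eexists. apply HI.
  - rewrite !Hend in Hcc by ring. rewrite RInt_point in Hcc. unfold zero in Hcc; simpl in Hcc.
    rewrite dint_retract by lra. unfold dint.
    change (RInt (J b') (- r) r = 0). lra.
Qed.

(** In real terms F_x = p + q and F_y = i (p - q), written by components. *)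
Definition wirt (F : C -> C) (z p q : C) : Prop :=
  is_derive (fun t => fst (F (t, snd z))) (fst z) (fst p + fst q) /\
  is_derive (fun t => snd (F (t, snd z))) (fst z) (snd p + snd q) /\
  is_derive (fun t => fst (F (fst z, t))) (snd z) (snd q - snd p) /\
  is_derive (fun t => snd (F (fst z, t))) (snd z) (fst p - fst q).

Definition contC (F : C -> C) (z : C) : Prop :=
  continuous (fun z => fst (F z)) z /\ continuous (fun z => snd (F z)) z.

(* [p] and [q] are the derivatives of [F] with respect to z and to its conjugate. *)
Definition dC1 (rho : R) (F p q : C -> C) : Prop :=
  forall z, odisc rho z -> wirt F z (p z) (q z) /\ contC F z /\ contC p z /\ contC q z.

Lemma dC1_contC rho F p q z : dC1 rho F p q -> odisc rho z -> contC F z.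
Proof. intros H Hz; now destruct (H z Hz). Qed.

Lemma contC_const (c : C) z : contC (fun _ => c) z.
Proof. split; cont1. Qed.

Lemma contC_id z : contC (fun z => z) z.
Proof. split; cont1. Qed.

Lemma contC_conj F z : contC F z -> contC (fun z => Cconj (F z)) z.
Proof. intros [H1 H2]; split; simpl; auto. now apply continuous_Ropp. Qed.

Lemma contC_plus F G z : contC F z -> contC G z -> contC (fun z => F z + G z)%C z.
Proof. intros [H1 H2] [H3 H4]; split; simpl; now apply continuous_Rplus. Qed.

Lemma contC_opp F z : contC F z -> contC (fun z => - F z)%C z.
Proof. intros [H1 H2]; split; simpl; now apply continuous_Ropp. Qed.

Lemma contC_minus F G z : contC F z -> contC G z -> contC (fun z => F z - G z)%C z.
Proof. intros; apply contC_plus; auto; now apply contC_opp. Qed.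

Lemma contC_mult F G z : contC F z -> contC G z -> contC (fun z => F z * G z)%C z.
Proof.
  intros [H1 H2] [H3 H4]; split; simpl.
  - apply continuous_Rminus; now apply continuous_Rmult.
  - apply continuous_Rplus; now apply continuous_Rmult.
Qed.

Lemma contC_RtoC (k : C -> R) z : continuous k z -> contC (fun z => RtoC (k z)) z.
Proof. intros H; split; simpl; auto. cont1. Qed.

Lemma contC_pow F n z : contC F z -> contC (fun z => F z ^ n)%C z.
Proof.
  intros HF; induction n as [|n IH]; simpl; [apply contC_const|now apply contC_mult].
Qed.

Ltac contC1 :=
  lazymatch goal with
  | |- contC (fun _ => ?c) _ => apply contC_const
  | |- contC (fun x => x) _ => apply contC_id
  | |- contC (fun x => (_ + _)%C) _ => apply contC_plus
  | |- contC (fun x => (_ - _)%C) _ => apply contC_minus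
  | |- contC (fun x => (_ * _)%C) _ => apply contC_mult
  | |- contC (fun x => (- _)%C) _ => apply contC_opp
  | |- contC (fun x => (_ ^ _)%C) _ => apply contC_pow
  | |- contC (fun x => Cconj _) _ => apply contC_conj
  | |- contC (fun x => RtoC _) _ => apply contC_RtoC
  end.

Ltac split4 := split; [|split; [|split]].

Section dC1_rules.
Variable rho : R.

Lemma dC1_eq F p q F' p' q' : dC1 rho F p q ->
  (forall z, F z = F' z) -> (forall z, odisc rho z -> p z = p' z) -> (forall z, odisc rho z -> q z = q' z) ->
  dC1 rho F' p' q'.
Proof.
  intros H HF Hp Hq. replace F' with F by now apply functional_extensionality.
  intros z Hz. destruct (H z Hz) as (H1 & H2 & [H3 H3'] & [H4 H4']).
  assert (E : forall (k k' : C -> C) (pr : C -> R), (forall z, odisc rho z -> k z = k' z) ->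
     continuous (fun z => pr (k z)) z -> continuous (fun z => pr (k' z)) z).
  { intros k k' pr Hk. apply continuous_ext_loc.
    generalize (odisc_open _ _ Hz). apply filter_imp. intros y Hy. now rewrite Hk. }
  rewrite <- Hp, <- Hq by auto.
  split; [exact H1|split; [exact H2|split; split]].
  - now apply (E p).
  - now apply (E p p' snd).
  - now apply (E q).
  - now apply (E q q' snd).
Qed.

Lemma dC1_const (c : C) : dC1 rho (fun _ => c) (fun _ => RtoC 0) (fun _ => RtoC 0).
Proof.
  intros z _. split; [|split; [|split]; apply contC_const].
  split4; simpl; (eapply is_derive_eq; [apply (is_derive_const (V := R_NormedModule))|]);
    unfold zero; simpl; ring.
Qed.

Lemma dC1_id : dC1 rho (fun z => z) (fun _ => RtoC 1) (fun _ => RtoC 0).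
Proof.
  intros z _. split; [|split; [apply contC_id|split; apply contC_const]].
  assert (Hid : forall x : R, is_derive (fun t : R => t) x 1) by (intros; apply (is_derive_id (K := R_AbsRing))).
  assert (Hcst : forall x c : R, is_derive (fun _ : R => c) x 0)
    by (intros; apply (is_derive_const (V := R_NormedModule))).
  split4; cbn [fst snd RtoC].
  - apply is_derive_eq with 1; [apply Hid|ring].
  - apply is_derive_eq with 0; [apply Hcst|ring].
  - apply is_derive_eq with 0; [apply Hcst|ring].
  - apply is_derive_eq with 1; [apply Hid|ring].
Qed.

Lemma dC1_plus F Fp Fq G Gp Gq : dC1 rho F Fp Fq -> dC1 rho G Gp Gq ->
  dC1 rho (fun z => F z + G z)%C (fun z => Fp z + Gp z)%C (fun z => Fq z + Gq z)%C.
Proof.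
  intros HF HG z Hz. destruct (HF z Hz) as ((A1 & A2 & A3 & A4) & A5 & A6 & A7).
  destruct (HG z Hz) as ((B1 & B2 & B3 & B4) & B5 & B6 & B7).
  split; [|split; [|split]; apply contC_plus; auto].
  split4; simpl.
  - eapply is_derive_eq; [apply (is_derive_Rplus _ _ _ _ _ A1 B1)|simpl; ring].
  - eapply is_derive_eq; [apply (is_derive_Rplus _ _ _ _ _ A2 B2)|simpl; ring].
  - eapply is_derive_eq; [apply (is_derive_Rplus _ _ _ _ _ A3 B3)|simpl; ring].
  - eapply is_derive_eq; [apply (is_derive_Rplus _ _ _ _ _ A4 B4)|simpl; ring].
Qed.

Lemma dC1_opp F Fp Fq : dC1 rho F Fp Fq ->
  dC1 rho (fun z => - F z)%C (fun z => - Fp z)%C (fun z => - Fq z)%C.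
Proof.
  intros HF z Hz. destruct (HF z Hz) as ((A1 & A2 & A3 & A4) & A5 & A6 & A7).
  split; [|split; [|split]; apply contC_opp; auto].
  split4; simpl.
  - eapply is_derive_eq; [apply (is_derive_Ropp _ _ _ A1)|simpl; ring].
  - eapply is_derive_eq; [apply (is_derive_Ropp _ _ _ A2)|simpl; ring].
  - eapply is_derive_eq; [apply (is_derive_Ropp _ _ _ A3)|simpl; ring].
  - eapply is_derive_eq; [apply (is_derive_Ropp _ _ _ A4)|simpl; ring].
Qed.

Lemma dC1_minus F Fp Fq G Gp Gq : dC1 rho F Fp Fq -> dC1 rho G Gp Gq ->
  dC1 rho (fun z => F z - G z)%C (fun z => Fp z - Gp z)%C (fun z => Fq z - Gq z)%C.
Proof. intros HF HG. apply dC1_plus; auto. now apply dC1_opp. Qed.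

Lemma dC1_conj F Fp Fq : dC1 rho F Fp Fq ->
  dC1 rho (fun z => Cconj (F z)) (fun z => Cconj (Fq z)) (fun z => Cconj (Fp z)).
Proof.
  intros HF z Hz. destruct (HF z Hz) as ((A1 & A2 & A3 & A4) & A5 & A6 & A7).
  split; [|split; [|split]; apply contC_conj; auto].
  split4; simpl.
  - eapply is_derive_eq; [apply A1|simpl; ring].
  - eapply is_derive_eq; [apply (is_derive_Ropp _ _ _ A2)|simpl; ring].
  - eapply is_derive_eq; [apply A3|simpl; ring].
  - eapply is_derive_eq; [apply (is_derive_Ropp _ _ _ A4)|simpl; ring].
Qed.

Lemma dC1_mult F Fp Fq G Gp Gq : dC1 rho F Fp Fq -> dC1 rho G Gp Gq ->
  dC1 rho (fun z => F z * G z)%C (fun z => Fp z * G z + F z * Gp z)%C (fun z => Fq z * G z + F z * Gq z)%C.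
Proof.
  intros HF HG z Hz. destruct (HF z Hz) as ((A1 & A2 & A3 & A4) & A5 & A6 & A7).
  destruct (HG z Hz) as ((B1 & B2 & B3 & B4) & B5 & B6 & B7).
  split; [|split; [|split]; [apply contC_mult|apply contC_plus; apply contC_mult..]; auto].
  destruct z as [x y]; cbn [fst snd] in *.
  split4; cbn [fst snd Cmult Cplus].
  - eapply is_derive_eq;
    [apply is_derive_Rminus; [apply (is_derive_Rmult _ _ _ _ _ A1 B1)|apply (is_derive_Rmult _ _ _ _ _ A2 B2)]|simpl; ring].
  - eapply is_derive_eq;
    [apply is_derive_Rplus; [apply (is_derive_Rmult _ _ _ _ _ A1 B2)|apply (is_derive_Rmult _ _ _ _ _ A2 B1)]|simpl; ring].
  - eapply is_derive_eq;
    [apply is_derive_Rminus; [apply (is_derive_Rmult _ _ _ _ _ A3 B3)|apply (is_derive_Rmult _ _ _ _ _ A4 B4)]|simpl; ring].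
  - eapply is_derive_eq;
    [apply is_derive_Rplus; [apply (is_derive_Rmult _ _ _ _ _ A3 B4)|apply (is_derive_Rmult _ _ _ _ _ A4 B3)]|simpl; ring].
Qed.

Lemma dC1_pow F Fp Fq n : dC1 rho F Fp Fq ->
  dC1 rho (fun z => F z ^ n)%C (fun z => RtoC (INR n) * F z ^ (n - 1) * Fp z)%C
                              (fun z => RtoC (INR n) * F z ^ (n - 1) * Fq z)%C.
Proof.
  intros HF. induction n as [|n IH].
  - apply (dC1_eq _ _ _ _ _ _ (dC1_const (RtoC 1))); intros; simpl; ring.
  - apply (dC1_eq _ _ _ _ _ _ (dC1_mult _ _ _ _ _ _ HF IH)); intros z; [reflexivity| |]; intros _;
    (replace (S n - 1)%nat with n by lia; rewrite S_INR, RtoC_plus; destruct n as [|n];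
     [simpl; ring|replace (S n - 1)%nat with n by lia; rewrite Cpow_S; ring]).
Qed.

Lemma dC1_Rcomp (k : C -> R) (phi phi' : R -> R) p q :
  dC1 rho (fun z => RtoC (k z)) p q ->
  (forall z, odisc rho z -> is_derive phi (k z) (phi' (k z))) ->
  (forall z, odisc rho z -> continuous phi' (k z)) ->
  dC1 rho (fun z => RtoC (phi (k z))) (fun z => RtoC (phi' (k z)) * p z)%C (fun z => RtoC (phi' (k z)) * q z)%C.
Proof.
  intros HF Hd Hc z Hz. destruct (HF z Hz) as ((A1 & A2 & A3 & A4) & [A5 _] & A6 & A7).
  simpl in A1, A2, A3, A4, A5.
  assert (Hk : continuous (fun z => phi' (k z)) z).
  { apply (continuous_comp k phi'); auto. }
  (* [RtoC (k z)] has imaginary part 0, whose two partial derivatives vanish. This yields snd p = -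
     snd q and fst p = fst q, that is, q is the conjugate of p. *)
  assert (H2 : snd (p z) + snd (q z) = 0).
  { rewrite <- (is_derive_unique _ _ _ A2). apply Derive_const. }
  assert (H4 : fst (p z) - fst (q z) = 0).
  { rewrite <- (is_derive_unique _ _ _ A4). apply Derive_const. }
  destruct z as [x y]; cbn [fst snd] in *.
  split; [|split; [|split]].
  - split4; cbn [fst snd RtoC Cmult].
    + eapply is_derive_eq; [apply (is_derive_Rcomp phi (fun t => k (t, y))); [apply (Hd _ Hz)|apply A1]|simpl; ring].
    + eapply is_derive_eq; [apply (is_derive_const (V := R_NormedModule))|].
      unfold zero; simpl. replace (snd (p (x, y))) with (- snd (q (x, y))) by lra. ring.
    + eapply is_derive_eq; [apply (is_derive_Rcomp phi (fun t => k (x, t))); [apply (Hd _ Hz)|apply A3]|simpl; ring].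
    + eapply is_derive_eq; [apply (is_derive_const (V := R_NormedModule))|].
      unfold zero; simpl. replace (fst (p (x, y))) with (fst (q (x, y))) by lra. ring.
  - apply contC_RtoC. apply (continuous_comp k phi); auto.
    apply (ex_derive_continuous (V := R_NormedModule)). eexists; apply (Hd _ Hz).
  - apply contC_mult; auto. now apply contC_RtoC.
  - apply contC_mult; auto. now apply contC_RtoC.
Qed.

Lemma dC1_Rinv (k : C -> R) p q :
  dC1 rho (fun z => RtoC (k z)) p q -> (forall z, odisc rho z -> k z <> 0) ->
  dC1 rho (fun z => RtoC (/ k z)) (fun z => RtoC (- / (k z) ^ 2) * p z)%C (fun z => RtoC (- / (k z) ^ 2) * q z)%C.
Proof.
  intros HF H0. apply (dC1_Rcomp k Rinv (fun x => - / x ^ 2)); auto.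
  - intros z Hz. generalize (H0 z Hz). intros. auto_derive; auto. simpl; field; auto.
  - intros z Hz. generalize (H0 z Hz). intros. repeat cont1. now apply pow_nonzero.
Qed.

Lemma dC1_Rln (k : C -> R) p q :
  dC1 rho (fun z => RtoC (k z)) p q -> (forall z, odisc rho z -> 0 < k z) ->
  dC1 rho (fun z => RtoC (ln (k z))) (fun z => RtoC (/ k z) * p z)%C (fun z => RtoC (/ k z) * q z)%C.
Proof.
  intros HF H0. apply (dC1_Rcomp k ln Rinv); auto.
  - intros z Hz. now apply is_derive_ln, H0.
  - intros z Hz. generalize (H0 z Hz). intros. apply continuous_Rinv. lra.
Qed.

(** The x-derivative of Re B is Re (p + q) and the y-derivative of Im B is Re (p - q). Both
    integrate to 0, and Re p is half their sum. All integrations by parts in the proof pass through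
    this form. *)
Lemma dint_div (r : R) B p q :
  0 < r < rho -> dC1 rho B p q ->
  (forall z, fst z ^ 2 + snd z ^ 2 = r ^ 2 -> B z = RtoC 0) ->
  dint r (fun z => fst (p z)) = 0.
Proof.
  intros Hr HB H0.
  assert (Hc : forall k, (forall z, odisc rho z -> continuous k z) -> cont_cdisc r k).
  { intros k Hk z Hz. apply Hk. now apply cdisc_odisc with r. }
  assert (Hp : forall z, odisc rho z -> continuous (fun z => fst (p z)) z)
    by (intros z Hz; apply (proj1 (proj1 (proj2 (proj2 (HB z Hz)))))).
  assert (Hq : forall z, odisc rho z -> continuous (fun z => fst (q z)) z)
    by (intros z Hz; apply (proj1 (proj2 (proj2 (proj2 (HB z Hz)))))).
  assert (E1 : dint r (fun z => fst (p z) + fst (q z)) = 0).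
  { apply (dint_dx r rho (fun z => fst (B z))); auto.
    - intros z Hz. apply (HB z Hz).
    - intros z Hz. apply (proj1 (proj1 (proj2 (HB z Hz)))).
    - intros z Hz. apply continuous_Rplus; [exact (Hp z Hz)|exact (Hq z Hz)].
    - intros z Hz. now rewrite H0. }
  assert (E2 : dint r (fun z => fst (p z) - fst (q z)) = 0).
  { apply (dint_dy r rho (fun z => snd (B z))); auto.
    - intros z Hz. apply (HB z Hz).
    - intros z Hz. apply continuous_Rminus; [exact (Hp z Hz)|exact (Hq z Hz)].
    - intros z Hz. now rewrite H0. }
  rewrite (dint_plus r (proj1 Hr) (fun z => fst (p z)) (fun z => fst (q z)) (Hc _ Hp) (Hc _ Hq)) in E1.
  rewrite (dint_minus r (proj1 Hr) (fun z => fst (p z)) (fun z => fst (q z)) (Hc _ Hp) (Hc _ Hq)) in E2.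
  lra.
Qed.

End dC1_rules.

(** * Complex power series *)

(** Convergence by components gives direct access to real series. The price is the factor 2 in
    [cseries_bound]. *)
Definition cseries (a : nat -> C) (l : C) : Prop :=
  is_series (fun n => fst (a n)) (fst l) /\ is_series (fun n => snd (a n)) (snd l).

Definition cpseries (b : nat -> C) (z l : C) : Prop := cseries (fun n => b n * z ^ n)%C l.

Lemma pow_n_Cpow (z : C) (n : nat) : pow_n (K := C_AbsRing) z n = (z ^ n)%C.
Proof. induction n as [|n IH]; [reflexivity|]. simpl. now rewrite IH. Qed.

Lemma cpseries_of_is_pseries (b : nat -> C) (z l : C) :
  is_pseries (K := C_AbsRing) (V := C_NormedModule) b z l -> cpseries b z l.
Proof.
  intros H. unfold is_pseries in H.
  apply (is_series_ext _ (fun n => b n * z ^ n)%C) in H.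
  2:{ intros n. rewrite pow_n_Cpow. apply Cmult_comm. }
  unfold cpseries. revert H. generalize (fun n => b n * z ^ n)%C. intros a H.
  assert (Hs : forall n, sum_n (G := C_NormedModule) a n = (sum_n (fun n => fst (a n)) n, sum_n (fun n => snd (a n)) n)).
  { induction n as [|n IH].
    - rewrite !sum_O. now destruct (a 0%nat).
    - rewrite !sum_Sn, IH. now destruct (a (S n)). }
  split.
  - apply filterlim_ext with (fun n => fst (sum_n (G := C_NormedModule) a n)).
    + intros n. now rewrite Hs.
    + apply (filterlim_comp _ _ _ (sum_n (G := C_NormedModule) a) (fun z : C => fst z) eventually (locally l)); auto.
      apply continuous_fstC.
  - apply filterlim_ext with (fun n => snd (sum_n (G := C_NormedModule) a n)).
    + intros n. now rewrite Hs.
    + apply (filterlim_comp _ _ _ (sum_n (G := C_NormedModule) a) (fun z : C => snd z) eventually (locally l)); auto.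
      apply continuous_sndC.
Qed.

Lemma fst_le_Cmod (z : C) : Rabs (fst z) <= Cmod z.
Proof. eapply Rle_trans; [apply Rmax_l|apply Rmax_Cmod]. Qed.

Lemma snd_le_Cmod (z : C) : Rabs (snd z) <= Cmod z.
Proof. eapply Rle_trans; [apply Rmax_r|apply Rmax_Cmod]. Qed.

Lemma Cmod_le_sum (z : C) : Cmod z <= Rabs (fst z) + Rabs (snd z).
Proof.
  unfold Cmod. rewrite <- (sqrt_pow2 (Rabs (fst z) + Rabs (snd z))).
  - apply sqrt_le_1_alt. rewrite <- (pow2_abs (fst z)), <- (pow2_abs (snd z)).
    pose proof (Rabs_pos (fst z)). pose proof (Rabs_pos (snd z)). nra.
  - pose proof (Rabs_pos (fst z)). pose proof (Rabs_pos (snd z)). lra.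
Qed.

Lemma cseries_unique a l l' : cseries a l -> cseries a l' -> l = l'.
Proof.
  intros [H1 H2] [H3 H4]. destruct l as [x y], l' as [x' y']. simpl in *.
  apply is_series_unique in H1, H2, H3, H4. congruence.
Qed.

Lemma cseries_plus a b l l' : cseries a l -> cseries b l' -> cseries (fun n => a n + b n)%C (l + l')%C.
Proof. intros [H1 H2] [H3 H4]; split; now apply (is_series_plus (V := R_NormedModule)). Qed.

Lemma cseries_ext a b l : (forall n, a n = b n) -> cseries a l -> cseries b l.
Proof. intros E. now replace b with a by now apply functional_extensionality. Qed.

Lemma is_series_Rscal (c : R) (a : nat -> R) (l : R) : is_series a l -> is_series (fun n => c * a n) (c * l).
Proof. apply (is_series_scal (K := R_AbsRing) (V := R_NormedModule) c). Qed.

Lemma cseries_scal c a l : cseries a l -> cseries (fun n => c * a n)%C (c * l)%C.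
Proof.
  intros [H1 H2]; split; simpl.
  - apply (is_series_minus (V := R_NormedModule)); now apply is_series_Rscal.
  - apply (is_series_plus (V := R_NormedModule)); now apply is_series_Rscal.
Qed.

Lemma cseries_shift a l : cseries (fun n => a (S n)) l -> cseries a (a 0%nat + l)%C.
Proof.
  intros [H1 H2]; split; apply (is_series_decr_1 (V := R_NormedModule));
    [apply (eq_rect _ (fun t => is_series _ t) H1)|apply (eq_rect _ (fun t => is_series _ t) H2)];
    unfold plus, opp; simpl; ring.
Qed.

Lemma cseries_unshift a l : cseries a l -> cseries (fun n => a (S n)) (l - a 0%nat)%C.
Proof.
  intros [H1 H2]; split; [apply (is_series_incr_1 (V := R_NormedModule) (fun n => fst (a n)))
                         |apply (is_series_incr_1 (V := R_NormedModule) (fun n => snd (a n)))];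
    [apply (eq_rect _ (fun t => is_series _ t) H1)|apply (eq_rect _ (fun t => is_series _ t) H2)];
    unfold plus; simpl; ring.
Qed.

Lemma cseries_ex a (c : nat -> R) : (forall n, Cmod (a n) <= c n) -> ex_series c -> exists l, cseries a l.
Proof.
  intros H Hc.
  destruct (ex_series_le (K := R_AbsRing) (V := R_CompleteNormedModule) (fun n => fst (a n)) c) as [x Hx]; auto.
  { intros n. eapply Rle_trans; [apply fst_le_Cmod|apply H]. }
  destruct (ex_series_le (K := R_AbsRing) (V := R_CompleteNormedModule) (fun n => snd (a n)) c) as [y Hy]; auto.
  { intros n. eapply Rle_trans; [apply snd_le_Cmod|apply H]. }
  now exists (x, y).
Qed.

Lemma is_series_bound (a c : nat -> R) (l : R) :
  (forall n, Rabs (a n) <= c n) -> ex_series c -> is_series a l -> Rabs l <= Series c.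
Proof.
  intros H Hc Ha. rewrite <- (is_series_unique _ _ Ha).
  assert (He : ex_series (fun n => Rabs (a n))).
  { apply (ex_series_le (K := R_AbsRing) (V := R_CompleteNormedModule) _ c); auto.
    intros n. unfold norm; simpl. unfold abs; simpl. rewrite Rabs_Rabsolu. apply H. }
  eapply Rle_trans; [now apply Series_Rabs|].
  apply Series_le; auto. intros n. split; [apply Rabs_pos|apply H].
Qed.

Lemma cseries_bound a (c : nat -> R) l :
  (forall n, Cmod (a n) <= c n) -> ex_series c -> cseries a l -> Cmod l <= 2 * Series c.
Proof.
  intros H Hc [H1 H2]. eapply Rle_trans; [apply Cmod_le_sum|].
  assert (Rabs (fst l) <= Series c).
  { apply is_series_bound with (fun n => fst (a n)); auto.
    intros n. eapply Rle_trans; [apply fst_le_Cmod|apply H]. }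
  assert (Rabs (snd l) <= Series c).
  { apply is_series_bound with (fun n => snd (a n)); auto.
    intros n. eapply Rle_trans; [apply snd_le_Cmod|apply H]. }
  lra.
Qed.

Section PowerSeries.
Variables (b : nat -> C) (rho : R) (f : C -> C).
Hypothesis Hrho : 0 < rho.
Hypothesis Hf : forall z, Cmod z < rho -> cpseries b z (f z).

(** Convergence at a single real point t1 between t and rho bounds the terms |b_n| t1^n, and this
    already bounds the radius of convergence of the series of moduli from below. *)
Lemma cpseries_radius (t : R) : 0 <= t < rho -> Rbar_lt t (CV_radius (fun n => Cmod (b n))).
Proof.
  intros Ht. pose (t1 := (t + rho) / 2).
  assert (Ht1 : 0 < t1 < rho) by (unfold t1; lra).
  apply Rbar_lt_le_trans with t1; [simpl; unfold t1; lra|].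
  apply (proj1 (CV_radius_bounded _)).
  destruct (Hf (RtoC t1)) as [H1 H2].
  { rewrite Cmod_R, Rabs_pos_eq; lra. }
  assert (Hb : forall a : nat -> R, ex_series a -> exists M, forall n, Rabs (a n) <= M).
  { intros a Ha. apply ex_series_lim_0 in Ha. apply is_lim_seq_Reals in Ha.
    destruct (maj_by_pos a) as [M [_ HM]]; [now exists 0|]. now exists M. }
  destruct (Hb _ (ex_intro _ _ H1)) as [M1 HM1]. destruct (Hb _ (ex_intro _ _ H2)) as [M2 HM2].
  exists (M1 + M2). intros n.
  rewrite Rabs_pos_eq by (apply Rmult_le_pos; [apply Cmod_ge_0|apply pow_le; lra]).
  replace (t1 ^ n) with (Cmod (RtoC t1 ^ n)%C) by (rewrite Cmod_pow, Cmod_R, Rabs_pos_eq; lra).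
  rewrite <- Cmod_mult. eapply Rle_trans; [apply Cmod_le_sum|].
  generalize (HM1 n) (HM2 n). simpl. lra.
Qed.

Lemma cpseries_ex_deriv (t : R) : 0 <= t < rho ->
  ex_series (fun n => INR (S n) * Cmod (b (S n)) * t ^ n).
Proof.
  intros Ht. pose proof (cpseries_radius t Ht) as H. rewrite <- CV_radius_derive in H.
  rewrite <- (Rabs_pos_eq t) in H by lra. apply CV_disk_inside in H.
  revert H. apply ex_series_ext. intros n. unfold PS_derive.
  apply Rabs_pos_eq. repeat apply Rmult_le_pos; [apply pos_INR|apply Cmod_ge_0|apply pow_le; lra].
Qed.

(** Applying t d/dt twice multiplies the n-th coefficient by n^2 and preserves the radius of
    convergence. The factor n^2 is the one produced by [Cpow_taylor2]. *)
Lemma cpseries_ex_sq (t : R) : 0 <= t < rho ->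
  ex_series (fun n => INR n ^ 2 * Cmod (b n) * t ^ n).
Proof.
  intros Ht. pose proof (cpseries_radius t Ht) as H.
  pose (u := PS_incr_1 (V := R_NormedModule) (PS_derive (PS_incr_1 (V := R_NormedModule) (PS_derive (fun n => Cmod (b n)))))).
  assert (Hu : CV_radius u = CV_radius (fun n => Cmod (b n))).
  { unfold u. now rewrite CV_radius_incr_1, CV_radius_derive, CV_radius_incr_1, CV_radius_derive. }
  rewrite <- Hu in H.
  rewrite <- (Rabs_pos_eq t) in H by lra. apply CV_disk_inside in H.
  revert H. apply ex_series_ext. intros n.
  replace (u n) with (INR n ^ 2 * Cmod (b n)).
  - apply Rabs_pos_eq. apply Rmult_le_pos; [apply Rmult_le_pos; [apply pow_le, pos_INR|apply Cmod_ge_0]|apply pow_le; lra].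
  - destruct n as [|n]; unfold u, PS_incr_1, PS_derive.
    + simpl. unfold zero; simpl; ring.
    + ring.
Qed.

Lemma cpseries_deriv_ex : exists f', forall z, Cmod z < rho ->
  cpseries (fun n => RtoC (INR (S n)) * b (S n))%C z (f' z).
Proof.
  assert (H : forall z, exists l, Cmod z < rho -> cpseries (fun n => RtoC (INR (S n)) * b (S n))%C z l).
  { intros z. destruct (Rlt_or_le (Cmod z) rho) as [Hz|Hz].
    - destruct (cseries_ex (fun n => RtoC (INR (S n)) * b (S n) * z ^ n)%C
                 (fun n => INR (S n) * Cmod (b (S n)) * Cmod z ^ n)) as [l Hl].
      + intros n. rewrite !Cmod_mult, Cmod_pow, Cmod_R, Rabs_pos_eq by apply pos_INR. lra.
      + apply cpseries_ex_deriv. split; auto. apply Cmod_ge_0.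
      + exists l. intros _. exact Hl.
    - exists (RtoC 0). intros; lra. }
  exists (fun z => proj1_sig (constructive_indefinite_description _ (H z))).
  intros z. exact (proj2_sig (constructive_indefinite_description _ (H z))).
Qed.

(** If R_n is the remainder inside the modulus on the left, then R_(n+1) = (z + h) R_n + n h^2
    z^(n-1), and n^2 + n <= (n + 1)^2 closes the induction. *)
Lemma Cpow_taylor2 (z h : C) (t : R) (n : nat) : 0 < t -> Cmod z <= t -> Cmod (z + h) <= t ->
  Cmod ((z + h) ^ n - z ^ n - h * (RtoC (INR n) * z ^ (n - 1))) <= Cmod h ^ 2 / t ^ 2 * (INR n ^ 2 * t ^ n).
Proof.
  intros Ht Hz Hzh. induction n as [|n IH].
  - replace ((z + h) ^ 0 - z ^ 0 - h * (RtoC (INR 0) * z ^ (0 - 1)))%C with (RtoC 0) by (simpl; ring).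
    rewrite Cmod_0. simpl. lra.
  - set (D := ((z + h) ^ n - z ^ n - h * (RtoC (INR n) * z ^ (n - 1)))%C) in *.
    replace ((z + h) ^ S n - z ^ S n - h * (RtoC (INR (S n)) * z ^ (S n - 1)))%C
      with ((z + h) * D + RtoC (INR n) * (h * h * z ^ (n - 1)))%C.
    2:{ unfold D. replace (S n - 1)%nat with n by lia. rewrite S_INR, RtoC_plus.
        destruct n as [|n]; [cbn [Cpow Nat.sub INR]; ring|]. replace (S n - 1)%nat with n by lia. rewrite !Cpow_S. ring. }
    eapply Rle_trans; [apply Cmod_triangle|]. rewrite !Cmod_mult, Cmod_pow, Cmod_R, Rabs_pos_eq by apply pos_INR.
    assert (H1 : Cmod (z + h) * Cmod D <= t * (Cmod h ^ 2 / t ^ 2 * (INR n ^ 2 * t ^ n))).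
    { apply Rmult_le_compat; auto; apply Cmod_ge_0. }
    assert (H2 : INR n * (Cmod h * Cmod h * Cmod z ^ (n - 1)) <= Cmod h ^ 2 / t ^ 2 * (INR n * t ^ S n)).
    { destruct n as [|n]; [simpl; lra|].
      replace (S n - 1)%nat with n by lia.
      replace (Cmod h ^ 2 / t ^ 2 * (INR (S n) * t ^ S (S n))) with (INR (S n) * (Cmod h * Cmod h * t ^ n))
        by (change (t ^ S (S n)) with (t * (t * t ^ n)); field; lra).
      apply Rmult_le_compat_l; [apply pos_INR|].
      apply Rmult_le_compat_l; [apply Rmult_le_pos; apply Cmod_ge_0|].
      apply pow_incr. split; auto. apply Cmod_ge_0. }
    assert (H3 : 0 <= Cmod h ^ 2 / t ^ 2 * t ^ S n).
    { apply Rmult_le_pos; [|apply pow_le; lra]. apply Rmult_le_pos; [nra|].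
      left. apply Rinv_0_lt_compat. nra. }
    rewrite S_INR. pose proof (pos_INR n).
    replace (t * (Cmod h ^ 2 / t ^ 2 * (INR n ^ 2 * t ^ n))) with (INR n ^ 2 * (Cmod h ^ 2 / t ^ 2 * t ^ S n)) in H1
      by (change (t ^ S n) with (t * t ^ n); ring).
    nra.
Qed.

Lemma cpseries_taylor2 (f' : C -> C) :
  (forall z, Cmod z < rho -> cpseries (fun n => RtoC (INR (S n)) * b (S n))%C z (f' z)) ->
  forall t, 0 < t < rho -> exists M, 0 <= M /\ forall z h, Cmod z <= t -> Cmod (z + h) <= t ->
  Cmod (f (z + h)%C - f z - h * f' z) <= M * Cmod h ^ 2.
Proof.
  (* The factor 2 comes from [cseries_bound]; the absolute value makes the constant visibly
     nonnegative. *)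
  intros Hf' t Ht. exists (2 * Rabs (Series (fun n => / t ^ 2 * (INR n ^ 2 * Cmod (b n) * t ^ n)))).
  assert (Ht2 : 0 < / t ^ 2) by (apply Rinv_0_lt_compat; nra).
  assert (He : ex_series (fun n => / t ^ 2 * (INR n ^ 2 * Cmod (b n) * t ^ n))).
  { destruct (cpseries_ex_sq t) as [l Hl]; [lra|]. exists (/ t ^ 2 * l). now apply is_series_Rscal. }
  split; [pose proof (Rabs_pos (Series (fun n => / t ^ 2 * (INR n ^ 2 * Cmod (b n) * t ^ n)))); lra|].
  intros z h Hz Hzh.
    assert (Hs : cseries (fun n => b n * ((z + h) ^ n - z ^ n - h * (RtoC (INR n) * z ^ (n - 1))))%C
                   (f (z + h)%C - f z - h * f' z)%C).
    { generalize (Hf (z + h)%C ltac:(lra)) (Hf z ltac:(lra)) (Hf' z ltac:(lra)). intros H1 H2 H3.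
      assert (H4 : cseries (fun n => RtoC (INR n) * b n * z ^ (n - 1))%C (f' z)).
      { replace (f' z) with (RtoC (INR 0) * b 0%nat * z ^ (0 - 1) + f' z)%C by (simpl; ring).
        apply (cseries_shift (fun n => RtoC (INR n) * b n * z ^ (n - 1))%C).
        revert H3. apply cseries_ext. intros n. now replace (S n - 1)%nat with n by lia. }
      apply (cseries_scal (- RtoC 1)%C) in H2. apply (cseries_scal (- h)%C) in H4.
      generalize (cseries_plus _ _ _ _ H1 (cseries_plus _ _ _ _ H2 H4)).
      replace (f (z + h)%C + (- RtoC 1 * f z + - h * f' z))%C with (f (z + h)%C - f z - h * f' z)%C.
      - apply cseries_ext. intros n. ring.
      - ring. }
    apply Rle_trans with (2 * Series (fun n => / t ^ 2 * (INR n ^ 2 * Cmod (b n) * t ^ n)) * Cmod h ^ 2).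
    2:{ apply Rmult_le_compat_r; [apply pow2_ge_0|]. apply Rmult_le_compat_l; [lra|apply Rle_abs]. }
    replace (2 * Series (fun n => / t ^ 2 * (INR n ^ 2 * Cmod (b n) * t ^ n)) * Cmod h ^ 2)
      with (2 * Series (fun n => Cmod h ^ 2 * (/ t ^ 2 * (INR n ^ 2 * Cmod (b n) * t ^ n))))
      by (rewrite Series_scal_l; ring).
    eapply cseries_bound; [| |exact Hs].
    + intros n. cbv beta. rewrite Cmod_mult.
      replace (Cmod h ^ 2 * (/ t ^ 2 * (INR n ^ 2 * Cmod (b n) * t ^ n)))
        with (Cmod (b n) * (Cmod h ^ 2 / t ^ 2 * (INR n ^ 2 * t ^ n))) by (unfold Rdiv; ring).
      apply Rmult_le_compat_l; [apply Cmod_ge_0|]. apply Cpow_taylor2; auto; lra.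
    + destruct He as [l Hl]. exists (Cmod h ^ 2 * l). now apply is_series_Rscal.
Qed.

End PowerSeries.

Lemma cpseries_deriv (b : nat -> C) (rho : R) (f : C -> C) :
  0 < rho -> (forall z, Cmod z < rho -> cpseries b z (f z)) ->
  exists f' b', (forall z, Cmod z < rho -> cpseries b' z (f' z)) /\
  forall z, Cmod z < rho -> exists M d, 0 <= M /\ 0 < d /\ forall h, Cmod h < d ->
     Cmod (f (z + h)%C - f z - h * f' z) <= M * Cmod h ^ 2.
Proof.
  intros Hrho Hf. destruct (cpseries_deriv_ex b rho f Hrho Hf) as [f' Hf'].
  exists f', (fun n => RtoC (INR (S n)) * b (S n))%C. split; auto.
  intros z Hz. pose proof (Cmod_ge_0 z).
  destruct (cpseries_taylor2 b rho f Hrho Hf f' Hf' ((Cmod z + rho) / 2)) as (M & HM & HMz); [lra|].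
  exists M, ((rho - Cmod z) / 2). split; auto. split; [lra|].
  intros h Hh. apply HMz; [lra|]. eapply Rle_trans; [apply Cmod_triangle|lra].
Qed.

(** A quadratic remainder is stronger than complex differentiability. It holds for power series, and
    restricting h to the two axes gives the four real partial derivatives at once. *)
Definition quad_diff (f : C -> C) (z l : C) : Prop :=
  exists M d, 0 <= M /\ 0 < d /\ forall h, Cmod h < d -> Cmod (f (z + h)%C - f z - h * l) <= M * Cmod h ^ 2.

Lemma quad_diff_real (k : R -> R) (x l M d : R) : 0 <= M -> 0 < d ->
  (forall e, Rabs e < d -> Rabs (k (x + e) - k x - e * l) <= M * e ^ 2) -> is_derive k x l.
Proof.
  intros HM Hd H. apply is_derive_Reals. intros eps Heps.
  assert (Hm : 0 < Rmin d (eps / (M + 1))) by (apply Rmin_pos; [auto|apply Rdiv_lt_0_compat; lra]).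
  exists (mkposreal _ Hm). intros e He Hed. simpl in Hed.
  assert (H1 : Rabs e < d) by (eapply Rlt_le_trans; [exact Hed|apply Rmin_l]).
  assert (H2 : Rabs e < eps / (M + 1)) by (eapply Rlt_le_trans; [exact Hed|apply Rmin_r]).
  replace ((k (x + e) - k x) / e - l) with ((k (x + e) - k x - e * l) / e) by (field; auto).
  unfold Rdiv. rewrite Rabs_mult, Rabs_inv.
  assert (He0 : 0 < Rabs e) by now apply Rabs_pos_lt.
  apply Rle_lt_trans with (M * Rabs e).
  - apply (Rmult_le_reg_r (Rabs e)); auto. rewrite Rmult_assoc, Rinv_l by lra. rewrite Rmult_1_r.
    eapply Rle_trans; [apply H; auto|]. rewrite <- (pow2_abs e). right; ring.
  - apply Rle_lt_trans with ((M + 1) * Rabs e); [lra|].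
    apply (Rmult_lt_compat_l (M + 1)) in H2; [|lra]. replace ((M + 1) * (eps / (M + 1))) with eps in H2 by (field; lra). auto.
Qed.

Lemma quad_diff_wirt f z l : quad_diff f z l -> wirt f z l (RtoC 0).
Proof.
  intros (M & d & HM & Hd & H). destruct z as [x y], l as [l1 l2].
  assert (Hr : forall e, Rabs e < d -> Cmod (f (x + e, y) - f (x, y) - RtoC e * (l1, l2)) <= M * e ^ 2).
  { intros e He. replace ((x + e, y) : C) with ((x, y) + RtoC e)%C
      by (apply injective_projections; simpl; ring).
    rewrite <- (pow2_abs e), <- Cmod_R. apply H. now rewrite Cmod_R. }
  assert (Hi : forall e, Rabs e < d -> Cmod (f (x, y + e) - f (x, y) - (0, e)%R * (l1, l2)) <= M * e ^ 2).
  { intros e He. replace ((x, y + e) : C) with ((x, y) + (0%R, e))%C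
      by (apply injective_projections; simpl; ring).
    assert (E : Cmod (0, e) = Rabs e).
    { unfold Cmod; simpl. rewrite <- sqrt_Rsqr_abs. f_equal. unfold Rsqr; ring. }
    rewrite <- (pow2_abs e), <- E. apply H. now rewrite E. }
  split4; cbn [fst snd RtoC].
  - apply quad_diff_real with M d; auto. intros e He.
    eapply Rle_trans; [|apply (Hr e He)]. eapply Rle_trans; [|apply fst_le_Cmod].
    right; f_equal; simpl; ring.
  - apply quad_diff_real with M d; auto. intros e He.
    eapply Rle_trans; [|apply (Hr e He)]. eapply Rle_trans; [|apply snd_le_Cmod].
    right; f_equal; simpl; ring.
  - apply quad_diff_real with M d; auto. intros e He.
    eapply Rle_trans; [|apply (Hi e He)]. eapply Rle_trans; [|apply fst_le_Cmod].
    right; f_equal; simpl; ring.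
  - apply quad_diff_real with M d; auto. intros e He.
    eapply Rle_trans; [|apply (Hi e He)]. eapply Rle_trans; [|apply snd_le_Cmod].
    right; f_equal; simpl; ring.
Qed.

Lemma quad_diff_contC f z l : quad_diff f z l -> contC f z.
Proof.
  intros (M & d & HM & Hd & H).
  assert (Hm : forall e, 0 < e -> locally z (fun w => Cmod (f w - f z) < e)).
  { intros e He. pose proof (Cmod_ge_0 l) as Hl.
    assert (Hmin : 0 < Rmin (Rmin d 1) (e / (M + Cmod l + 1))).
    { repeat apply Rmin_pos; auto; [lra|]. apply Rdiv_lt_0_compat; lra. }
    exists (mkposreal (Rmin (Rmin d 1) (e / (M + Cmod l + 1)) / 2) ltac:(lra)).
    intros w [H1 H2]. simpl in H1, H2.
    change (Rabs (fst w - fst z) < Rmin (Rmin d 1) (e / (M + Cmod l + 1)) / 2) in H1.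
    change (Rabs (snd w - snd z) < Rmin (Rmin d 1) (e / (M + Cmod l + 1)) / 2) in H2.
    set (h := (w - z)%C).
    assert (Ew : (z + h)%C = w) by (apply injective_projections; unfold h; simpl; ring).
    assert (Hh : Cmod h < Rmin (Rmin d 1) (e / (M + Cmod l + 1))).
    { eapply Rle_lt_trans; [apply Cmod_le_sum|]. unfold h, Cminus; simpl. unfold Rminus in *. lra. }
    assert (Hh1 : Cmod h < Rmin d 1) by (eapply Rlt_le_trans; [exact Hh|apply Rmin_l]).
    assert (Hh2 : Cmod h < e / (M + Cmod l + 1)) by (eapply Rlt_le_trans; [exact Hh|apply Rmin_r]).
    pose proof (Rmin_l d 1). pose proof (Rmin_r d 1). pose proof (Cmod_ge_0 h).
    replace (f w - f z)%C with ((f (z + h)%C - f z - h * l) + h * l)%C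
      by (rewrite Ew; ring).
    eapply Rle_lt_trans; [apply Cmod_triangle|]. rewrite Cmod_mult.
    generalize (H h ltac:(lra)). intros Hq.
    apply (Rmult_lt_compat_r (M + Cmod l + 1)) in Hh2; [|lra].
    replace (e / (M + Cmod l + 1) * (M + Cmod l + 1)) with e in Hh2 by (field; lra).
    assert (M * Cmod h ^ 2 <= M * Cmod h) by (apply Rmult_le_compat_l; nra).
    lra. }
  split; apply continuous_of_locally_lt; intros e He; generalize (Hm e He); apply filter_imp; intros w Hw;
    (eapply Rle_lt_trans; [|exact Hw]).
  - apply (fst_le_Cmod (f w - f z)%C).
  - apply (snd_le_Cmod (f w - f z)%C).
Qed.

Lemma odisc_Cmod (rho : R) (z : C) : 0 < rho -> odisc rho z <-> Cmod z < rho.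
Proof.
  intros Hr. unfold odisc, Cmod. split; intros H.
  - rewrite <- (sqrt_pow2 rho) by lra. apply sqrt_lt_1_alt. split; [nra|auto].
  - rewrite <- (pow2_sqrt (fst z ^ 2 + snd z ^ 2)) by nra.
    pose proof (sqrt_pos (fst z ^ 2 + snd z ^ 2)). nra.
Qed.

Definition holo (rho : R) (f f' : C -> C) : Prop := dC1 rho f f' (fun _ => RtoC 0).

(** Three derivatives are formed for two claims: [holo rho f' f''] includes the continuity of f'',
    which is read off from its own differentiability. *)
Lemma cpseries_holo (b : nat -> C) (rho : R) (f : C -> C) :
  0 < rho -> (forall z, Cmod z < rho -> cpseries b z (f z)) ->
  exists f' f'', holo rho f f' /\ holo rho f' f''.
Proof.
  intros Hrho Hf.
  destruct (cpseries_deriv b rho f Hrho Hf) as (f1 & b1 & Hf1 & Hq0).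
  destruct (cpseries_deriv b1 rho f1 Hrho Hf1) as (f2 & b2 & Hf2 & Hq1).
  destruct (cpseries_deriv b2 rho f2 Hrho Hf2) as (f3 & b3 & Hf3 & Hq2).
  exists f1, f2. split; intros z Hz; apply odisc_Cmod in Hz; auto.
  - split; [now apply quad_diff_wirt, Hq0|]. split; [now apply (quad_diff_contC f z (f1 z)), Hq0|].
    split; [now apply (quad_diff_contC f1 z (f2 z)), Hq1|apply contC_const].
  - split; [now apply quad_diff_wirt, Hq1|]. split; [now apply (quad_diff_contC f1 z (f2 z)), Hq1|].
    split; [now apply (quad_diff_contC f2 z (f3 z)), Hq2|apply contC_const].
Qed.

Lemma cpseries_at_0 (b : nat -> C) : cpseries b (RtoC 0) (b 0%nat).
Proof.
  assert (H0 : forall a : nat -> R, (forall n, a (S n) = 0) -> is_series a (a 0%nat)).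
  { intros a Ha. apply (is_series_decr_1 (V := R_NormedModule)).
    unfold plus, opp; simpl. rewrite Rplus_opp_r.
    apply filterlim_ext with (fun _ => 0); [|apply filterlim_const].
    intros n. induction n as [|n IH].
    - now rewrite sum_O.
    - rewrite sum_Sn, <- IH, Ha. unfold plus; simpl; ring. }
  assert (E : forall n, (b (S n) * RtoC 0 ^ S n)%C = RtoC 0) by (intros n; simpl; ring).
  assert (E0 : b 0%nat = (b 0%nat * RtoC 0 ^ 0)%C) by (simpl; ring).
  unfold cpseries. rewrite E0. split.
  - apply (H0 (fun n => fst (b n * RtoC 0 ^ n)%C)). intros n. now rewrite E.
  - apply (H0 (fun n => snd (b n * RtoC 0 ^ n)%C)). intros n. now rewrite E.
Qed.

Lemma cpseries_decr (b : nat -> C) (rho : R) (f : C -> C) :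
  0 < rho -> (forall z, Cmod z < rho -> cpseries b z (f z)) ->
  exists g, (forall z, Cmod z < rho -> cpseries (fun n => b (S n)) z (g z)) /\
            forall z, Cmod z < rho -> f z = (b 0%nat + z * g z)%C.
Proof.
  intros Hrho Hf.
  assert (H0 : f (RtoC 0) = b 0%nat).
  { eapply cseries_unique; [apply Hf; now rewrite Cmod_0|apply cpseries_at_0]. }
  (* The value b_1 at 0 removes the singularity of (f - b_0) / z. *)
  pose (g := fun z : C => if excluded_middle_informative (z = RtoC 0) then b 1%nat else ((f z - b 0%nat) / z)%C).
  exists g. split; intros z Hz; unfold g; destruct (excluded_middle_informative (z = RtoC 0)) as [E|E].
  - subst z. apply (cpseries_at_0 (fun n => b (S n))).
  - generalize (cseries_unshift _ _ (Hf z Hz)). intros H. apply (cseries_scal (/ z)%C) in H.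
    replace ((f z - b 0%nat) / z)%C with (/ z * (f z - b 0%nat * z ^ 0))%C by (simpl; field; auto).
    revert H. apply cseries_ext. intros n. rewrite Cpow_S. field; auto.
  - subst z. rewrite H0. ring.
  - field; auto.
Qed.

Lemma cpseries_factor (n : nat) (b : nat -> C) (rho : R) (f : C -> C) :
  0 < rho -> (forall z, Cmod z < rho -> cpseries b z (f z)) -> (forall j, (j < n)%nat -> b j = RtoC 0) ->
  exists g, (forall z, Cmod z < rho -> cpseries (fun j => b (n + j)%nat) z (g z)) /\
            forall z, Cmod z < rho -> f z = (z ^ n * g z)%C.
Proof.
  intros Hrho. revert b f. induction n as [|n IH]; intros b f Hf Hb.
  - exists f. split; auto. intros; simpl; ring.
  - destruct (cpseries_decr b rho f Hrho Hf) as (g1 & Hg1 & E1).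
    destruct (IH (fun j => b (S j)) g1 Hg1) as (g & Hg & E).
    + intros j Hj. apply Hb. lia.
    + exists g. split; auto. intros z Hz. rewrite E1, E, Hb by (auto; lia). simpl; ring.
Qed.

(** * Closure properties of smooth functions *)

(** [smooth2] speaks of all iterated partial derivatives, so proving it for a product or a logarithm
    directly would call for formulas of every order. This class is closed under [Dx] and [Dy], hence
    under every [pder w], and regularity of its members suffices. *)
Inductive smooth_expr : (R -> R -> R) -> Prop :=
| se_smooth u : smooth2 u -> smooth_expr u
| se_const c : smooth_expr (fun _ _ => c)
| se_x : smooth_expr (fun x _ => x)
| se_y : smooth_expr (fun _ y => y)
| se_plus u v : smooth_expr u -> smooth_expr v -> smooth_expr (fun x y => u x y + v x y)
| se_mult u v : smooth_expr u -> smooth_expr v -> smooth_expr (fun x y => u x y * v x y)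
| se_inv u : smooth_expr u -> (forall x y, 0 < u x y) -> smooth_expr (fun x y => / u x y)
| se_ln u : smooth_expr u -> (forall x y, 0 < u x y) -> smooth_expr (fun x y => ln (u x y)).

Definition regular2 (u : R -> R -> R) : Prop := forall x y,
  ex_derive (fun t => u t y) x /\ ex_derive (fun t => u x t) y /\
  continuous (fun p : R * R => u (fst p) (snd p)) (x, y).

Lemma pder_app (w w' : list bool) (u : R -> R -> R) : pder (w ++ w') u = pder w (pder w' u).
Proof. induction w as [|b w IH]; [reflexivity|]. simpl. now rewrite IH. Qed.

Lemma smooth2_Dx u : smooth2 u -> smooth2 (Dx u).
Proof. intros H w. change (Dx u) with (pder (true :: nil) u). rewrite <- pder_app. apply H. Qed.

Lemma smooth2_Dy u : smooth2 u -> smooth2 (Dy u).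
Proof. intros H w. change (Dy u) with (pder (false :: nil) u). rewrite <- pder_app. apply H. Qed.

Ltac funext2 := apply functional_extensionality; intros x; apply functional_extensionality; intros y.

Lemma ex_derive_inv_pos (k : R -> R) (x : R) : 0 < k x -> ex_derive k x -> ex_derive (fun t => / k t) x.
Proof. intros H1 H2. apply ex_derive_inv; auto; lra. Qed.

Lemma is_derive_inv_pos (k : R -> R) (x d : R) : 0 < k x -> is_derive k x d -> is_derive (fun t => / k t) x (- (d * (/ k x * / k x))).
Proof.
  intros H1 H2. eapply is_derive_eq; [apply (is_derive_inv k x d H2); lra|]. field. lra.
Qed.

Lemma is_derive_ln_pos (k : R -> R) (x d : R) : 0 < k x -> is_derive k x d -> is_derive (fun t => ln (k t)) x (d * / k x).
Proof.
  intros H1 H2. apply (is_derive_Rcomp ln k); auto. now apply is_derive_ln.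
Qed.

Lemma smooth_expr_regular u : smooth_expr u -> regular2 u.
Proof.
  induction 1 as [u H|c| | |u v _ IHu _ IHv|u v _ IHu _ IHv|u _ IHu Hu|u _ IHu Hu]; intros x y.
  - exact (H nil x y).
  - split; [|split]; [apply ex_derive_const|apply ex_derive_const|cont1].
  - split; [|split]; [apply (ex_derive_id (K := R_AbsRing))|apply ex_derive_const|cont1].
  - split; [|split]; [apply ex_derive_const|apply (ex_derive_id (K := R_AbsRing))|cont1].
  - destruct (IHu x y) as (A & B & D), (IHv x y) as (A' & B' & D'). split; [|split].
    + now apply (ex_derive_plus (V := R_NormedModule) (fun t => u t y) (fun t => v t y)).
    + now apply (ex_derive_plus (V := R_NormedModule) (fun t => u x t) (fun t => v x t)).
    + now apply continuous_Rplus.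
  - destruct (IHu x y) as (A & B & D), (IHv x y) as (A' & B' & D'). split; [|split].
    + now apply (ex_derive_mult (fun t => u t y) (fun t => v t y)).
    + now apply (ex_derive_mult (fun t => u x t) (fun t => v x t)).
    + now apply continuous_Rmult.
  - destruct (IHu x y) as (A & B & D). split; [|split].
    + now apply (ex_derive_inv_pos (fun t => u t y)).
    + now apply (ex_derive_inv_pos (fun t => u x t)).
    + apply continuous_Rinv'; auto. simpl. generalize (Hu x y); lra.
  - destruct (IHu x y) as (A & B & D). split; [|split].
    + eexists. apply (is_derive_ln_pos (fun t => u t y)); [apply Hu|apply Derive_correct; exact A].
    + eexists. apply (is_derive_ln_pos (fun t => u x t)); [apply Hu|apply Derive_correct; exact B].
    + apply continuous_Rln; [exact D|apply (Hu x y)].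
Qed.

Lemma smooth_expr_opp u : smooth_expr u -> smooth_expr (fun x y => - u x y).
Proof.
  intros H. replace (fun x y => - u x y) with (fun x y => (-1) * u x y) by (funext2; ring).
  apply se_mult; auto. apply se_const.
Qed.

Lemma smooth_expr_minus u v : smooth_expr u -> smooth_expr v -> smooth_expr (fun x y => u x y - v x y).
Proof. intros. apply se_plus; auto. now apply smooth_expr_opp. Qed.

Lemma smooth_expr_pow u n : smooth_expr u -> smooth_expr (fun x y => u x y ^ n).
Proof. intros H. induction n as [|n IH]; simpl; [apply se_const|now apply se_mult]. Qed.

Lemma smooth_expr_Dx u : smooth_expr u -> smooth_expr (Dx u).
Proof.
  induction 1 as [u H|c| | |u v Hu' IHu Hv' IHv|u v Hu' IHu Hv' IHv|u Hu' IHu Hu|u Hu' IHu Hu]; unfold Dx.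
  - apply se_smooth. now apply smooth2_Dx.
  - replace (fun x y => _) with (fun _ _ : R => 0) by (funext2; now rewrite Derive_const). apply se_const.
  - replace (fun x y => _) with (fun _ _ : R => 1) by (funext2; now rewrite Derive_id). apply se_const.
  - replace (fun x y => _) with (fun _ _ : R => 0) by (funext2; now rewrite Derive_const). apply se_const.
  - replace (fun x y => _) with (fun x y => Dx u x y + Dx v x y).
    + now apply se_plus.
    + funext2. symmetry. apply (Derive_plus (fun t => u t y) (fun t => v t y));
        [exact (proj1 (smooth_expr_regular u Hu' x y))|exact (proj1 (smooth_expr_regular v Hv' x y))].
  - replace (fun x y => _) with (fun x y => Dx u x y * v x y + u x y * Dx v x y).
    + apply se_plus; now apply se_mult.
    + funext2. symmetry. apply (Derive_mult (fun t => u t y) (fun t => v t y));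
        [exact (proj1 (smooth_expr_regular u Hu' x y))|exact (proj1 (smooth_expr_regular v Hv' x y))].
  - replace (fun x y => _) with (fun x y => - (Dx u x y * (/ u x y * / u x y))).
    + apply smooth_expr_opp. apply se_mult; auto. apply se_mult; now apply se_inv.
    + funext2. symmetry. apply is_derive_unique. apply (is_derive_inv_pos (fun t => u t y)); auto.
      apply Derive_correct. exact (proj1 (smooth_expr_regular u Hu' x y)).
  - replace (fun x y => _) with (fun x y => Dx u x y * / u x y).
    + apply se_mult; auto. now apply se_inv.
    + funext2. symmetry. apply is_derive_unique. apply (is_derive_ln_pos (fun t => u t y)); auto.
      apply Derive_correct. exact (proj1 (smooth_expr_regular u Hu' x y)).
Qed.

Lemma smooth_expr_Dy u : smooth_expr u -> smooth_expr (Dy u).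
Proof.
  induction 1 as [u H|c| | |u v Hu' IHu Hv' IHv|u v Hu' IHu Hv' IHv|u Hu' IHu Hu|u Hu' IHu Hu]; unfold Dy.
  - apply se_smooth. now apply smooth2_Dy.
  - replace (fun x y => _) with (fun _ _ : R => 0) by (funext2; now rewrite Derive_const). apply se_const.
  - replace (fun x y => _) with (fun _ _ : R => 0) by (funext2; now rewrite Derive_const). apply se_const.
  - replace (fun x y => _) with (fun _ _ : R => 1) by (funext2; now rewrite Derive_id). apply se_const.
  - replace (fun x y => _) with (fun x y => Dy u x y + Dy v x y).
    + now apply se_plus.
    + funext2. symmetry. apply (Derive_plus (u x) (v x));
        [exact (proj1 (proj2 (smooth_expr_regular u Hu' x y)))|exact (proj1 (proj2 (smooth_expr_regular v Hv' x y)))].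
  - replace (fun x y => _) with (fun x y => Dy u x y * v x y + u x y * Dy v x y).
    + apply se_plus; now apply se_mult.
    + funext2. symmetry. apply (Derive_mult (u x) (v x));
        [exact (proj1 (proj2 (smooth_expr_regular u Hu' x y)))|exact (proj1 (proj2 (smooth_expr_regular v Hv' x y)))].
  - replace (fun x y => _) with (fun x y => - (Dy u x y * (/ u x y * / u x y))).
    + apply smooth_expr_opp. apply se_mult; auto. apply se_mult; now apply se_inv.
    + funext2. symmetry. apply is_derive_unique. apply (is_derive_inv_pos (u x)); auto.
      apply Derive_correct. exact (proj1 (proj2 (smooth_expr_regular u Hu' x y))).
  - replace (fun x y => _) with (fun x y => Dy u x y * / u x y).
    + apply se_mult; auto. now apply se_inv.
    + funext2. symmetry. apply is_derive_unique. apply (is_derive_ln_pos (u x)); auto.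
      apply Derive_correct. exact (proj1 (proj2 (smooth_expr_regular u Hu' x y))).
Qed.

Lemma smooth_expr_smooth2 u : smooth_expr u -> smooth2 u.
Proof.
  intros H w. assert (Hw : smooth_expr (pder w u)).
  { induction w as [|[|] w IH]; simpl; auto; [now apply smooth_expr_Dx|now apply smooth_expr_Dy]. }
  now apply smooth_expr_regular.
Qed.

Lemma smooth_expr_Cpow (n : nat) :
  smooth_expr (fun x y => fst (((x, y) : C) ^ n)%C) /\ smooth_expr (fun x y => snd (((x, y) : C) ^ n)%C).
Proof.
  induction n as [|n [IH1 IH2]]; simpl.
  - split; apply se_const.
  - split.
    + apply smooth_expr_minus; apply se_mult; auto; [apply se_x|apply se_y].
    + apply se_plus; apply se_mult; auto; [apply se_x|apply se_y].
Qed.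

(** * The index form of the test field *)

Section AlgebraicIdentities.
Local Open Scope C_scope.

(** Conjugates are separate variables here ([wb] for conj(w), and so on), which turns the claim into
    an identity of rational functions. The left side becomes [index_form], the right side
    [radial_form] plus the real part of the divergence [Bz] of [field_k], with [Bzb] as its
    conjugate. *)
Lemma index_form_identity (m K Kz Kb c cb w wb w1 w1b G Gb Gd Gdb a0 a0b : C) :
  let g := a0 + w * G in let gb := a0b + wb * Gb in
  let g' := m * w1 * G + w * Gd in let gb' := m * w1b * Gb + wb * Gdb in
  let A := 1 + a0b * g in let Ab := 1 + a0 * gb in
  let p := 1 + g * gb in let p0 := 1 + a0 * a0b in
  let u := (c * G * Ab + cb * Gb * A) / (2 * p) in
  let J := - u * (c * gb' * m * w1 * (G * G) + cb * g' * m * w1b * (Gb * Gb)) / (2 * (p * p)) in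
  let kz := Kz * w * wb + K * m * w1 * wb in let kb := Kb * w * wb + K * m * w1b * w in
  let X1 := Kz * c * wb in let X1b := Kb * cb * w in
  let X2 := Kz * cb * w + K * cb * m * w1 in let X2b := Kb * c * wb + K * c * m * w1b in
  let B := w * G in let Bb := wb * Gb in
  let N := cb * cb * (A * A) * (Gb * Gb) - c * cb * w * wb * (G * G) * (Gb * Gb) in
  let Nz := cb * cb * (2 * A * a0b * g') * (Gb * Gb) - c * cb * wb * (Gb * Gb) * (m * w1 * (G * G) + w * (2 * G * Gd)) in
  let Nb := c * c * (Ab * Ab) * (G * G) - c * cb * w * wb * (G * G) * (Gb * Gb) in
  let Nzb := c * c * (2 * Ab * a0 * gb') * (G * G) - c * cb * w * (G * G) * (m * w1b * (Gb * Gb) + wb * (2 * Gb * Gdb)) in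
  let Bz := - m * wb * w1b * ((2 * K * Kz * (w * w) + K * K * (2 * w * m * w1)) * N / (4 * (p * p))
               + K * K * (w * w) * (Nz / (4 * (p * p)) - N * (g' * gb) / (2 * (p * p * p))))
            - m * (p0 * p0) * c * cb * w1b * (2 * K * Kz * w + K * K * m * w1) / 8 in
  let Bzb := - m * w * w1 * ((2 * K * Kb * (wb * wb) + K * K * (2 * wb * m * w1b)) * Nb / (4 * (p * p))
               + K * K * (wb * wb) * (Nzb / (4 * (p * p)) - Nb * (gb' * g) / (2 * (p * p * p))))
            - m * (p0 * p0) * c * cb * w1 * (2 * K * Kb * wb + K * K * m * w1b) / 8 in
  p <> 0 ->
  p0 * p0 / 8 * (X1 * X1b + X2 * X2b) - (A * A * X2 - B * B * X1) * (Ab * Ab * X2b - Bb * Bb * X1b) / (4 * (p * p))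
  = u * u * (kz * kb) + K * w * wb * (K * w * wb) * J + (Bz + Bzb) / 2.
Proof.
  intros. subst Bz Bzb Nzb Nb Nz N Bb B X2b X2 X1b X1 kb kz J u p0 Ab A gb' g' .
  subst p gb g.
  field. auto.
Qed.

(** Same encoding with kappa = tau. The factors z of w and z of G - a are made explicit because the
    divergence involves quotients by conj(z), such as (conj(G)^2 - conj(a)^2) / conj(z) =
    [G1b * (Gb + ab)]. *)
Lemma base_form_identity (m z zb w1 w1b G1 G1b Gd Gdb a ab a0 a0b iR : C) :
  let w := z * w1 in let wb := zb * w1b in
  let G := a + z * G1 in let Gb := ab + zb * G1b in
  let c := ab in let cb := a in
  let g := a0 + w * G in let gb := a0b + wb * Gb in
  let g' := m * w1 * G + w * Gd in let gb' := m * w1b * Gb + wb * Gdb in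
  let A := 1 + a0b * g in let Ab := 1 + a0 * gb in
  let p := 1 + g * gb in let p0 := 1 + a0 * a0b in
  let u := (c * G * Ab + cb * Gb * A) / (2 * p) in
  let J := - u * (c * gb' * m * w1 * (G * G) + cb * g' * m * w1b * (Gb * Gb)) / (2 * (p * p)) in
  let tau := 1 - w * wb * iR in
  let tz := - (m * w1 * wb * iR) in let tb := - (m * w1b * w * iR) in
  let th := c * (G * G) - cb * iR * (A * A) in let thb := cb * (Gb * Gb) - c * iR * (Ab * Ab) in
  let E := g * w1b * Gb * (p + A) + A * A * w * w1b * iR in
  let Eb := gb * w1 * G * (p + Ab) + Ab * Ab * wb * w1 * iR in
  let Ez := g' * w1b * Gb * (p + A) + g * w1b * Gb * (g' * gb + a0b * g') + w1b * iR * (2 * A * a0b * g' * w + A * A * m * w1) in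
  let Ezb := gb' * w1 * G * (p + Ab) + gb * w1 * G * (gb' * g + a0 * gb') + w1 * iR * (2 * Ab * a0 * gb' * wb + Ab * Ab * m * w1b) in
  let B3z := m / 4 * (- (cb * cb) * tz * G1b * (Gb + ab)
       + cb * cb * (Gb * Gb) * ((tz * E + tau * Ez) / (p * p) - 2 * tau * E * (g' * gb) / (p * p * p))
       + c * cb * w1b * (Gb * Gb) * ((2 * tau * tz * w * (G * G) + tau * tau * (m * w1 * (G * G) + w * (2 * G * Gd))) / (p * p)
           - 2 * (tau * tau) * w * (G * G) * (g' * gb) / (p * p * p))) in
  let B3b := m / 4 * (- (c * c) * tb * G1 * (G + a)
       + c * c * (G * G) * ((tb * Eb + tau * Ezb) / (p * p) - 2 * tau * Eb * (gb' * g) / (p * p * p))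
       + c * cb * w1 * (G * G) * ((2 * tau * tb * wb * (Gb * Gb) + tau * tau * (m * w1b * (Gb * Gb) + wb * (2 * Gb * Gdb))) / (p * p)
           - 2 * (tau * tau) * wb * (Gb * Gb) * (gb' * g) / (p * p * p))) in
  p <> 0 ->
  u * u * (tz * tb) + tau * tau * J
  = m * w1 * m * w1b / 4 * (p0 * p0 * (a * ab) * (iR * iR) - th * thb / (p * p) - a * ab * (a * ab) * iR) - (B3z + B3b) / 2.
Proof.
  intros. subst B3z B3b Ezb Ez Eb E thb th tb tz tau J u p0 Ab A gb' g' .
  subst p gb g cb c Gb G wb w.
  field. auto.
Qed.

End AlgebraicIdentities.

Definition nrm2 (z : C) : R := fst z ^ 2 + snd z ^ 2.

Lemma nrm2_conj (z : C) : RtoC (nrm2 z) = (z * Cconj z)%C.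
Proof. apply injective_projections; unfold nrm2; simpl; ring. Qed.

Lemma nrm2_pos (z : C) : 0 <= nrm2 z.
Proof. unfold nrm2; nra. Qed.

Lemma nrm2_mult (x y : C) : nrm2 (x * y) = nrm2 x * nrm2 y.
Proof. unfold nrm2; simpl; ring. Qed.

Lemma nrm2_pow (x : C) (n : nat) : nrm2 (x ^ n) = nrm2 x ^ n.
Proof. induction n as [|n IH]; [unfold nrm2; simpl; ring|]. now rewrite Cpow_S, nrm2_mult, IH. Qed.

Lemma nrm2_Cmod (x : C) : nrm2 x = Cmod x ^ 2.
Proof. unfold Cmod, nrm2. rewrite pow2_sqrt; nra. Qed.

Lemma continuous_nrm2 (F : C -> C) z : contC F z -> continuous (fun z => nrm2 (F z)) z.
Proof. intros [H1 H2]. unfold nrm2. now repeat cont1. Qed.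

Lemma Cconj_RtoC (x : R) : Cconj (RtoC x) = RtoC x.
Proof. apply injective_projections; simpl; ring. Qed.

Lemma RtoC_fst_real (x : C) : Cconj x = x -> x = RtoC (fst x).
Proof.
  intros H. assert (E : snd (Cconj x) = snd x) by now rewrite H.
  simpl in E. apply injective_projections; simpl; lra.
Qed.

Lemma RtoC_re (x : C) : RtoC (fst x) = ((x + Cconj x) / 2)%C.
Proof. apply injective_projections; simpl; field. Qed.

Lemma dC1_real_conj rho (k : C -> R) p q z :
  dC1 rho (fun z => RtoC (k z)) p q -> odisc rho z -> q z = Cconj (p z).
Proof.
  intros H Hz. destruct (H z Hz) as ((_ & A2 & _ & A4) & _). cbn [RtoC fst snd] in A2, A4.
  assert (H2 : snd (p z) + snd (q z) = 0).
  { rewrite <- (is_derive_unique _ _ _ A2). apply Derive_const. }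
  assert (H4 : fst (p z) - fst (q z) = 0).
  { rewrite <- (is_derive_unique _ _ _ A4). apply Derive_const. }
  apply injective_projections; simpl; lra.
Qed.

Lemma holo_conj rho f f' : holo rho f f' -> dC1 rho (fun z => Cconj (f z)) (fun _ => RtoC 0) (fun z => Cconj (f' z)).
Proof.
  intros H. apply (dC1_eq _ _ _ _ _ _ _ (dC1_conj _ _ _ _ H)); auto.
  intros; apply Cconj_RtoC.
Qed.

Lemma holo_mult rho f f' g g' : holo rho f f' -> holo rho g g' ->
  holo rho (fun z => f z * g z)%C (fun z => f' z * g z + f z * g' z)%C.
Proof.
  intros Hf Hg. apply (dC1_eq _ _ _ _ _ _ _ (dC1_mult _ _ _ _ _ _ _ Hf Hg)); auto. intros; ring.
Qed.

Lemma holo_plus rho f f' g g' : holo rho f f' -> holo rho g g' ->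
  holo rho (fun z => f z + g z)%C (fun z => f' z + g' z)%C.
Proof.
  intros Hf Hg. apply (dC1_eq _ _ _ _ _ _ _ (dC1_plus _ _ _ _ _ _ _ Hf Hg)); auto. intros; ring.
Qed.

Lemma holo_const rho c : holo rho (fun _ => c) (fun _ => RtoC 0).
Proof. apply dC1_const. Qed.

Lemma holo_pow rho n : holo rho (fun z => z ^ n)%C (fun z => RtoC (INR n) * z ^ (n - 1))%C.
Proof.
  apply (dC1_eq _ _ _ _ _ _ _ (dC1_pow rho _ _ _ n (dC1_id rho))); auto; intros; ring.
Qed.

Lemma dC1_eq_deriv rho F p q p' q' : dC1 rho F p q ->
  (forall z, odisc rho z -> p z = p' z) -> (forall z, odisc rho z -> q z = q' z) -> dC1 rho F p' q'.
Proof. intros H. now apply (dC1_eq _ _ _ _ _ _ _ H). Qed.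

Ltac dC1_step :=
  lazymatch goal with
  | |- dC1 _ (fun z => z) _ _ => apply dC1_id
  | |- dC1 _ (fun _ => ?c) _ _ => apply dC1_const
  | |- dC1 _ (fun z => (_ + _)%C) _ _ => eapply dC1_plus
  | |- dC1 _ (fun z => (_ - _)%C) _ _ => eapply dC1_minus
  | |- dC1 _ (fun z => (_ * _)%C) _ _ => eapply dC1_mult
  | |- dC1 _ (fun z => (- _)%C) _ _ => eapply dC1_opp
  | |- dC1 _ _ _ _ => eassumption
  end.

(** * Weierstrass data near 0 and the quadratic forms built from them *)

Section WeightData.
Variables (rho r : R) (m : nat) (a0 a : C) (G1 G1d : C -> C).
Hypothesis Hr : 0 < r < rho.
Hypothesis Hm : (0 < m)%nat.
Hypothesis HG1 : holo rho G1 G1d.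

Let M : C := RtoC (INR m).
Let iR : C := RtoC (/ r ^ (2 * m)).

Definition wt_w (z : C) : C := (z ^ m)%C.
Definition wt_w1 (z : C) : C := (z ^ (m - 1))%C.
Definition wt_G (z : C) : C := (a + z * G1 z)%C.
Definition wt_Gd (z : C) : C := (G1 z + z * G1d z)%C.
Definition wt_g (z : C) : C := (a0 + wt_w z * wt_G z)%C.
Definition wt_gd (z : C) : C := (M * wt_w1 z * wt_G z + wt_w z * wt_Gd z)%C.
(** (g - a_0) / A is g after the rotation of the sphere that takes a_0 to 0; correspondingly |A|^2 +
    |g - a_0|^2 = p_0 p. *)
Definition wt_A (z : C) : C := (1 + Cconj a0 * wt_g z)%C.
Definition wt_p (z : C) : C := (1 + wt_g z * Cconj (wt_g z))%C.
Definition wt_p0 : C := (1 + a0 * Cconj a0)%C.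
(** Since e'.N = (g - a_0) conj(A) / p, the normal component of (c / w) e' is c G conj(A) / p. This
    is its real part, kept complex so that the algebraic identities apply. *)
Definition wt_uC (z : C) : C :=
  ((Cconj a * wt_G z * Cconj (wt_A z) + a * Cconj (wt_G z) * wt_A z) / (2 * wt_p z))%C.
(** Equal to - u (Lap u + |grad N|^2 u) / 4. As e'.N is a Jacobi function with conj(z)-derivative -
    (g - a_0)^2 conj(g') / p^2, the bracket is 4 Re (c conj(g') w' G^2) / p^2. *)
Definition wt_JC (z : C) : C :=
  (- wt_uC z * (Cconj a * Cconj (wt_gd z) * M * wt_w1 z * (wt_G z * wt_G z)
                + a * wt_gd z * M * Cconj (wt_w1 z) * (Cconj (wt_G z) * Cconj (wt_G z))) / (2 * (wt_p z * wt_p z)))%C.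
Definition wt_u (z : C) : R := fst (wt_uC z).
Definition wt_J (z : C) : R := fst (wt_JC z).
Definition wt_tau (z : C) : R := 1 - nrm2 z ^ m / r ^ (2 * m).
Definition wt_tz (z : C) : C := (- (M * wt_w1 z * Cconj (wt_w z) * iR))%C.

Lemma wt_w_w1 z : wt_w z = (z * wt_w1 z)%C.
Proof. unfold wt_w, wt_w1. replace m with (S (m - 1)) at 1 by lia. apply Cpow_S. Qed.

Lemma wt_p_real z : wt_p z = RtoC (1 + nrm2 (wt_g z)).
Proof. unfold wt_p. now rewrite RtoC_plus, nrm2_conj. Qed.

Lemma wt_p_neq0 z : wt_p z <> RtoC 0.
Proof.
  rewrite wt_p_real. intros H. apply RtoC_inj in H. pose proof (nrm2_pos (wt_g z)). lra.
Qed.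

Lemma wt_p_conj z : Cconj (wt_p z) = wt_p z.
Proof. rewrite wt_p_real. apply Cconj_RtoC. Qed.

Lemma two_neq0 : RtoC 2 <> RtoC 0.
Proof. intros H. apply RtoC_inj in H. lra. Qed.

Ltac push_conj := repeat first [rewrite Cplus_conj | rewrite Cminus_conj | rewrite Copp_conj
  | rewrite Cmult_conj | rewrite Cconj_conj | rewrite Cconj_RtoC].

Lemma wt_uC_conj z : Cconj (wt_uC z) = wt_uC z.
Proof.
  unfold wt_uC. rewrite Cdiv_conj by (apply Cmult_neq_0; [apply two_neq0|apply wt_p_neq0]).
  push_conj. rewrite wt_p_conj. f_equal. ring.
Qed.

Lemma wt_u_C z : wt_uC z = RtoC (wt_u z).
Proof. apply RtoC_fst_real, wt_uC_conj. Qed.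

Lemma wt_J_C z : wt_JC z = RtoC (wt_J z).
Proof.
  apply RtoC_fst_real. unfold wt_JC. pose proof (wt_p_neq0 z).
  rewrite Cdiv_conj by (repeat apply Cmult_neq_0; auto; apply two_neq0).
  push_conj. rewrite wt_p_conj, wt_uC_conj. f_equal. unfold M. push_conj. ring.
Qed.

Lemma wt_tau_C z : RtoC (wt_tau z) = (1 - wt_w z * Cconj (wt_w z) * iR)%C.
Proof.
  unfold wt_tau, Rdiv. rewrite RtoC_minus, RtoC_mult. rewrite <- nrm2_conj. unfold wt_w. now rewrite nrm2_pow.
Qed.

Lemma holo_w : holo rho wt_w (fun z => M * wt_w1 z)%C.
Proof. apply holo_pow. Qed.

Lemma holo_w1 : holo rho wt_w1 (fun z => RtoC (INR (m - 1)) * z ^ (m - 1 - 1))%C.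
Proof. apply holo_pow. Qed.

Lemma holo_G : holo rho wt_G wt_Gd.
Proof.
  apply (dC1_eq _ _ _ _ _ _ _ (holo_plus _ _ _ _ _ (holo_const rho a) (holo_mult _ _ _ _ _ (dC1_id rho) HG1))); auto.
  intros; unfold wt_Gd; ring.
Qed.

Lemma holo_g : holo rho wt_g wt_gd.
Proof.
  apply (dC1_eq _ _ _ _ _ _ _ (holo_plus _ _ _ _ _ (holo_const rho a0) (holo_mult _ _ _ _ _ holo_w holo_G))); auto.
  intros; unfold wt_gd; ring.
Qed.

Lemma holo_A : holo rho wt_A (fun z => Cconj a0 * wt_gd z)%C.
Proof.
  apply (dC1_eq _ _ _ _ _ _ _ (holo_plus _ _ _ _ _ (holo_const rho (RtoC 1)) (holo_mult _ _ _ _ _ (holo_const rho (Cconj a0)) holo_g))); auto.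
  intros; ring.
Qed.

Lemma dC1_p : dC1 rho wt_p (fun z => wt_gd z * Cconj (wt_g z))%C (fun z => wt_g z * Cconj (wt_gd z))%C.
Proof.
  pose proof holo_g as H. pose proof (holo_conj _ _ _ H) as H'. unfold holo in H.
  unfold wt_p. eapply dC1_eq_deriv; [repeat dC1_step|intros; cbv beta; ring..].
Qed.

(** All divisions by p in vector fields go through this function: it is real, so its derivatives
    come from [dC1_Rinv]. *)
Definition wt_ip (z : C) : C := (/ wt_p z)%C.

Lemma wt_ip_real z : wt_ip z = RtoC (/ (1 + nrm2 (wt_g z))).
Proof.
  unfold wt_ip. rewrite wt_p_real, RtoC_inv; auto. pose proof (nrm2_pos (wt_g z)). lra.
Qed.

Lemma dC1_ip : dC1 rho wt_ip (fun z => - (wt_gd z * Cconj (wt_g z)) / (wt_p z * wt_p z))%C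
                             (fun z => - (wt_g z * Cconj (wt_gd z)) / (wt_p z * wt_p z))%C.
Proof.
  assert (H : dC1 rho (fun z => RtoC (1 + nrm2 (wt_g z))) (fun z => wt_gd z * Cconj (wt_g z))%C (fun z => wt_g z * Cconj (wt_gd z))%C).
  { apply (dC1_eq _ _ _ _ _ _ _ dC1_p); auto. apply wt_p_real. }
  apply dC1_Rinv in H.
  2:{ intros z _. pose proof (nrm2_pos (wt_g z)). lra. }
  assert (E : forall z, RtoC (- / (1 + nrm2 (wt_g z)) ^ 2) = (- / (wt_p z * wt_p z))%C).
  { intros z. pose proof (nrm2_pos (wt_g z)). rewrite wt_p_real, RtoC_opp, RtoC_inv, RtoC_pow.
    - f_equal. f_equal. simpl. ring.
    - apply pow_nonzero. lra. }
  apply (dC1_eq _ _ _ _ _ _ _ H).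
  - intros z. now rewrite wt_ip_real.
  - intros z _. rewrite E. pose proof (wt_p_neq0 z). field. auto.
  - intros z _. rewrite E. pose proof (wt_p_neq0 z). field. auto.
Qed.

Lemma dC1_tau : dC1 rho (fun z => RtoC (wt_tau z)) wt_tz (fun z => Cconj (wt_tz z)).
Proof.
  pose proof holo_w as H. pose proof (holo_conj _ _ _ H) as H'. unfold holo in H.
  assert (Ht : (fun z => RtoC (wt_tau z)) = (fun z => 1 - wt_w z * Cconj (wt_w z) * iR)%C)
    by (apply functional_extensionality, wt_tau_C).
  rewrite Ht. eapply dC1_eq_deriv; [repeat dC1_step| |].
  - intros; unfold wt_tz; ring.
  - intros; unfold wt_tz. unfold iR, M. push_conj. ring.
Qed.

Lemma wt_tau_circle z : nrm2 z = r ^ 2 -> wt_tau z = 0.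
Proof.
  intros H. unfold wt_tau. rewrite H, pow_mult. field. apply pow_nonzero, pow_nonzero; lra.
Qed.

(* A quarter of the second variation density of the area at W = Re (k c conj(w) e'), where [kz] is the z-derivative of [k].
   [X1] and [X2] are the z-derivatives of k c conj(w) and of its conjugate. *)
Definition index_form (k : C -> R) (kz : C -> C) (z : C) : R :=
  let X1 := (kz z * Cconj a * Cconj (wt_w z))%C in
  let X2 := (kz z * a * wt_w z + RtoC (k z) * a * (M * wt_w1 z))%C in
  nrm2 wt_p0 / 8 * (nrm2 X1 + nrm2 X2)
  - nrm2 (wt_A z * wt_A z * X2 - (wt_w z * wt_G z) * (wt_w z * wt_G z) * X1)%C / (4 * (1 + nrm2 (wt_g z)) ^ 2).

Definition kappa_z (k : C -> R) (kz : C -> C) (z : C) : C :=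
  (kz z * wt_w z * Cconj (wt_w z) + RtoC (k z) * M * wt_w1 z * Cconj (wt_w z))%C.

Definition radial_form (kap : C -> R) (kapz : C -> C) (z : C) : R :=
  wt_u z ^ 2 * nrm2 (kapz z) + kap z ^ 2 * wt_J z.

Definition field_N (z : C) : C :=
  (a * a * (wt_A z * wt_A z) * (Cconj (wt_G z) * Cconj (wt_G z))
   - Cconj a * a * wt_w z * Cconj (wt_w z) * (wt_G z * wt_G z) * (Cconj (wt_G z) * Cconj (wt_G z)))%C.

(* This is kappa^2 Xi, with kappa = k |w|^2, c = conj a and
   Xi = - (m / conj z) ((conj(c)^2 A^2 conj(G)^2 - |c|^2 |w|^2 |G|^4) / (4 p^2) + p0^2 |c|^2 / (8 |w|^2)),
   written so that no division by z or w is left. *)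
Definition field_k (k : C -> R) (z : C) : C :=
  (- M * Cconj (wt_w z) * Cconj (wt_w1 z)
     * (RtoC (k z) * RtoC (k z) * (wt_w z * wt_w z) * field_N z * (wt_ip z * wt_ip z) * / 4)
   - M * (wt_p0 * wt_p0) * Cconj a * a * Cconj (wt_w1 z) * (RtoC (k z) * RtoC (k z) * wt_w z) * / 8)%C.

Definition field_k_z (k : C -> R) (kz : C -> C) (z : C) : C :=
  let p := wt_p z in let N := field_N z in let K := RtoC (k z) in let Kz := kz z in
  let w := wt_w z in let w1 := wt_w1 z in let wb := Cconj w in let w1b := Cconj w1 in
  let G := wt_G z in let Gb := Cconj G in let Gd := wt_Gd z in let A := wt_A z in
  let g' := wt_gd z in let gb := Cconj (wt_g z) in let c := Cconj a in let cb := a in let m := M in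
  let p0 := wt_p0 in let a0b := Cconj a0 in
  let Nz := (cb * cb * (2 * A * a0b * g') * (Gb * Gb) - c * cb * wb * (Gb * Gb) * (m * w1 * (G * G) + w * (2 * G * Gd)))%C in
  (- m * wb * w1b * ((2 * K * Kz * (w * w) + K * K * (2 * w * m * w1)) * N / (4 * (p * p))
               + K * K * (w * w) * (Nz / (4 * (p * p)) - N * (g' * gb) / (2 * (p * p * p))))
            - m * (p0 * p0) * c * cb * w1b * (2 * K * Kz * w + K * K * m * w1) / 8)%C.

(** [dint_div] reads off the z-derivative, so this one is given in the closed form that occurs in
    [index_form_identity]. *)
Lemma dC1_field_k (k : C -> R) (kz kb : C -> C) :
  dC1 rho (fun z => RtoC (k z)) kz kb -> exists q, dC1 rho (field_k k) (field_k_z k kz) q.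
Proof.
  intros Hk. pose proof holo_w as Hw. pose proof (holo_conj _ _ _ Hw) as Hw'.
  pose proof (holo_conj _ _ _ holo_w1) as Hw1.
  pose proof holo_G as HG. pose proof (holo_conj _ _ _ HG) as HG'.
  pose proof holo_A as HA. pose proof dC1_ip as Hip. unfold holo in *.
  eexists. unfold field_k, field_N. eapply dC1_eq_deriv; [repeat dC1_step| |reflexivity].
  intros z _. cbv beta. unfold field_k_z, field_N, wt_ip. pose proof (wt_p_neq0 z) as Hp.
  field. exact Hp.
Qed.

Lemma index_form_radial (k : C -> R) (kz kb : C -> C) z :
  dC1 rho (fun z => RtoC (k z)) kz kb -> odisc rho z ->
  index_form k kz z = radial_form (fun z => k z * nrm2 (wt_w z)) (kappa_z k kz) z + fst (field_k_z k kz z).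
Proof.
  intros Hk Hz.
  generalize (index_form_identity M (RtoC (k z)) (kz z) (Cconj (kz z)) (Cconj a) a (wt_w z) (Cconj (wt_w z))
    (wt_w1 z) (Cconj (wt_w1 z)) (wt_G z) (Cconj (wt_G z)) (wt_Gd z) (Cconj (wt_Gd z)) a0 (Cconj a0)).
  cbv zeta.
  assert (Eg : (a0 + wt_w z * wt_G z)%C = wt_g z) by reflexivity.
  assert (Egb : (Cconj a0 + Cconj (wt_w z) * Cconj (wt_G z))%C = Cconj (wt_g z)) by (unfold wt_g; now push_conj).
  assert (Egd : (M * wt_w1 z * wt_G z + wt_w z * wt_Gd z)%C = wt_gd z) by reflexivity.
  assert (Egdb : (M * Cconj (wt_w1 z) * Cconj (wt_G z) + Cconj (wt_w z) * Cconj (wt_Gd z))%C = Cconj (wt_gd z))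
    by (unfold wt_gd, M; now push_conj).
  rewrite Eg, Egb, Egd, Egdb.
  assert (EA : (1 + Cconj a0 * wt_g z)%C = wt_A z) by reflexivity.
  assert (EAb : (1 + a0 * Cconj (wt_g z))%C = Cconj (wt_A z)) by (unfold wt_A; now push_conj).
  rewrite EA, EAb.
  change (1 + wt_g z * Cconj (wt_g z))%C with (wt_p z). change (1 + a0 * Cconj a0)%C with wt_p0.
  intros H. specialize (H (wt_p_neq0 z)).
  pose proof (wt_p_neq0 z) as Hp. pose proof two_neq0 as H2.
  assert (H4 : RtoC 4 <> RtoC 0) by (intros E; apply RtoC_inj in E; lra).
  assert (H8 : RtoC 8 <> RtoC 0) by (intros E; apply RtoC_inj in E; lra).
  assert (Hp2 : (wt_p z * wt_p z)%C <> RtoC 0) by now apply Cmult_neq_0.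
  assert (Hp3 : (wt_p z * wt_p z * wt_p z)%C <> RtoC 0) by now apply Cmult_neq_0.
  assert (Hp0 : Cconj wt_p0 = wt_p0) by (unfold wt_p0; push_conj; ring).
  assert (Hn : RtoC (1 + nrm2 (wt_g z)) = wt_p z) by (symmetry; apply wt_p_real).
  apply RtoC_inj. rewrite RtoC_plus, RtoC_re.
  match type of H with ?l = _ => assert (E1 : RtoC (index_form k kz z) = l) end.
  { pose proof (nrm2_pos (wt_g z)) as Hnn.
    assert (Hd : RtoC (4 * (1 + nrm2 (wt_g z)) ^ 2) = (4 * (wt_p z * wt_p z))%C).
    { rewrite RtoC_mult, RtoC_pow, Hn. simpl. ring. }
    unfold index_form. cbv zeta. rewrite RtoC_minus, RtoC_mult.
    rewrite (RtoC_div (nrm2 wt_p0)) by lra. rewrite RtoC_div by nra.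
    rewrite RtoC_plus, Hd, !nrm2_conj, Hp0.
    unfold M. push_conj. field. exact Hp. }
  rewrite E1, H. clear E1 H. f_equal; [|f_equal; f_equal].
  - unfold radial_form, kappa_z. rewrite RtoC_plus, !RtoC_mult, !RtoC_pow, RtoC_mult.
    rewrite !nrm2_conj, <- wt_u_C, <- wt_J_C. unfold wt_JC, wt_uC, M. push_conj. field. exact Hp.
  - assert (Hdiv : forall x y, y <> RtoC 0 -> Cconj y = y -> Cconj (x / y) = (Cconj x / y)%C)
    by (intros x y Hy0 Hy; rewrite Cdiv_conj, Hy; auto).
    unfold field_k_z, field_N. push_conj.
    rewrite (Hdiv _ (RtoC 8)) by (auto; apply Cconj_RtoC).
    rewrite !(Hdiv _ (4 * (wt_p z * wt_p z))%C) by (first [now apply Cmult_neq_0|push_conj; now rewrite wt_p_conj]).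
    rewrite !(Hdiv _ (2 * (wt_p z * wt_p z * wt_p z))%C) by (first [now apply Cmult_neq_0|push_conj; now rewrite wt_p_conj]).
    push_conj. rewrite Hp0. unfold M. push_conj. field. exact Hp.
Qed.

Lemma wt_contC z : odisc rho z ->
  contC wt_w z /\ contC wt_w1 z /\ contC wt_G z /\ contC wt_Gd z /\ contC wt_g z /\ contC wt_gd z /\
  contC wt_A z /\ contC wt_ip z /\ contC (fun z => RtoC (wt_tau z)) z /\ contC wt_tz z.
Proof.
  intros Hz. destruct (holo_w z Hz) as (_ & H1 & _). destruct (holo_w1 z Hz) as (_ & H2 & _).
  destruct (holo_G z Hz) as (_ & H3 & H4 & _). destruct (holo_g z Hz) as (_ & H5 & H6 & _).
  destruct (holo_A z Hz) as (_ & H7 & _). destruct (dC1_ip z Hz) as (_ & H8 & _).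
  destruct (dC1_tau z Hz) as (_ & H9 & H10 & _).
  exact (conj H1 (conj H2 (conj H3 (conj H4 (conj H5 (conj H6 (conj H7 (conj H8 (conj H9 H10))))))))).
Qed.

Lemma wt_uJ_contC z : odisc rho z -> contC wt_uC z /\ contC wt_JC z.
Proof.
  intros Hz. destruct (wt_contC z Hz) as (H1 & H2 & H3 & H4 & H5 & H6 & H7 & H8 & _).
  assert (Hu : contC wt_uC z).
  { replace wt_uC with (fun z => (Cconj a * wt_G z * Cconj (wt_A z) + a * Cconj (wt_G z) * wt_A z) * / 2 * wt_ip z)%C.
    - repeat contC1; assumption.
    - apply functional_extensionality. intros y. unfold wt_uC, wt_ip. field. apply wt_p_neq0. }
  split; auto.
  replace wt_JC with (fun z => - wt_uC z * (Cconj a * Cconj (wt_gd z) * M * wt_w1 z * (wt_G z * wt_G z)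
                + a * wt_gd z * M * Cconj (wt_w1 z) * (Cconj (wt_G z) * Cconj (wt_G z))) * / 2 * (wt_ip z * wt_ip z))%C.
  - repeat contC1; assumption.
  - apply functional_extensionality. intros y. unfold wt_JC, wt_ip. field. apply wt_p_neq0.
Qed.

Lemma continuous_wt_u z : odisc rho z -> continuous wt_u z.
Proof. intros Hz. apply (proj1 (proj1 (wt_uJ_contC z Hz))). Qed.

Lemma continuous_wt_J z : odisc rho z -> continuous wt_J z.
Proof. intros Hz. apply (proj1 (proj2 (wt_uJ_contC z Hz))). Qed.

Lemma continuous_radial_form (kap : C -> R) (kapz : C -> C) z :
  odisc rho z -> continuous kap z -> contC kapz z -> continuous (radial_form kap kapz) z.
Proof.
  intros Hz H1 H2. unfold radial_form.
  apply continuous_Rplus; apply continuous_Rmult.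
  - apply continuous_Rpow. now apply continuous_wt_u.
  - now apply continuous_nrm2.
  - now apply continuous_Rpow.
  - now apply continuous_wt_J.
Qed.

Lemma continuous_index_form (k : C -> R) (kz : C -> C) z :
  odisc rho z -> continuous k z -> contC kz z -> continuous (index_form k kz) z.
Proof.
  intros Hz H1 H2. destruct (wt_contC z Hz) as (K1 & K2 & K3 & _ & K5 & _ & K7 & _).
  pose (X1 := fun z => (kz z * Cconj a * Cconj (wt_w z))%C).
  pose (X2 := fun z => (kz z * a * wt_w z + RtoC (k z) * a * (M * wt_w1 z))%C).
  assert (HX1 : contC X1 z) by (unfold X1; repeat contC1; assumption).
  assert (HX2 : contC X2 z) by (unfold X2; repeat contC1; assumption).
  assert (HX : contC (fun z => wt_A z * wt_A z * X2 z - (wt_w z * wt_G z) * (wt_w z * wt_G z) * X1 z)%C z)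
    by (repeat contC1; assumption).
  unfold index_form. cbv zeta. fold (X1 z) (X2 z).
  apply continuous_Rminus; [apply continuous_Rmult; [apply continuous_const|]|apply continuous_Rdiv].
  - exact (continuous_Rplus _ _ _ (continuous_nrm2 _ _ HX1) (continuous_nrm2 _ _ HX2)).
  - exact (continuous_nrm2 _ _ HX).
  - apply continuous_Rmult; [apply continuous_const|]. apply continuous_Rpow.
    apply continuous_Rplus; [apply continuous_const|exact (continuous_nrm2 _ _ K5)].
  - pose proof (nrm2_pos (wt_g z)). nra.
Qed.

Lemma cont_cdisc_of_odisc (F : C -> R) : (forall z, odisc rho z -> continuous F z) -> cont_cdisc r F.
Proof. intros H z Hz. apply H. now apply cdisc_odisc with r. Qed.

(** [field_k] carries the factor k^2, which vanishes on the circle, so its divergence integrates to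
    0. The regularity demanded of k is only C^1, since the identity contains no second derivative of
    k. *)
Lemma dint_index_form (k : C -> R) (kz kb : C -> C) :
  dC1 rho (fun z => RtoC (k z)) kz kb -> (forall z, nrm2 z = r ^ 2 -> k z = 0) ->
  dint r (index_form k kz) = dint r (radial_form (fun z => k z * nrm2 (wt_w z)) (kappa_z k kz)).
Proof.
  intros Hk H0. destruct (dC1_field_k k kz kb Hk) as [q Hq].
  assert (Hdiv : dint r (fun z => fst (field_k_z k kz z)) = 0).
  { apply (dint_div rho r _ _ _ Hr Hq). intros z Hz. unfold field_k. rewrite H0 by exact Hz.
    replace (RtoC 0 * RtoC 0)%C with (RtoC 0) by ring. ring. }
  rewrite (dint_ext r _ (fun z => radial_form (fun z => k z * nrm2 (wt_w z)) (kappa_z k kz) z + fst (field_k_z k kz z))).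
  - rewrite (dint_plus r (proj1 Hr) (radial_form (fun z => k z * nrm2 (wt_w z)) (kappa_z k kz))), Hdiv; [ring| |].
    + apply cont_cdisc_of_odisc. intros z Hz.
      destruct (wt_contC z Hz) as (H1 & H2 & _). destruct (Hk z Hz) as (_ & [Hk1 _] & Hk2 & _).
      apply continuous_radial_form; auto.
      * apply continuous_Rmult; auto. now apply continuous_nrm2.
      * unfold kappa_z. repeat contC1; assumption.
    + apply cont_cdisc_of_odisc. intros z Hz. apply (proj1 (proj1 (proj2 (proj2 (Hq z Hz))))).
  - lra.
  - intros z Hz. apply (index_form_radial k kz kb); auto. apply cdisc_odisc with r; auto. unfold cdisc; lra.
Qed.

(** |th|^2 / p^2 is the square split off from the base form. It vanishes identically in the
    borderline case g = a w with |a|^2 r^(2m) = 1, the hemisphere, so discarding it loses nothing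
    there. *)
Definition wt_th (z : C) : C := (Cconj a * (wt_G z * wt_G z) - a * iR * (wt_A z * wt_A z))%C.

(** This is (p^2 - tau A^2) / conj(z) with the division carried out, using p - A = g conj(w G) and 1
    - tau = |w|^2 / r^(2m). *)
Definition field_E (z : C) : C :=
  (wt_g z * Cconj (wt_w1 z) * Cconj (wt_G z) * (wt_p z + wt_A z)
   + wt_A z * wt_A z * wt_w z * Cconj (wt_w1 z) * iR)%C.

(* This is tau^2 Xi plus (m / 4) |a|^4 tau / conj z, which removes the pole of Xi at 0; the [p0] term of Xi is
   dropped because it only serves the null Lagrangian. *)
Definition field_3 (z : C) : C :=
  (M * / 4 * (- (a * a) * RtoC (wt_tau z) * Cconj (G1 z) * (Cconj (wt_G z) + Cconj a)
    + a * a * (Cconj (wt_G z) * Cconj (wt_G z)) * RtoC (wt_tau z) * field_E z * (wt_ip z * wt_ip z)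
    + Cconj a * a * Cconj (wt_w1 z) * (Cconj (wt_G z) * Cconj (wt_G z))
      * (RtoC (wt_tau z) * RtoC (wt_tau z) * wt_w z * (wt_G z * wt_G z)) * (wt_ip z * wt_ip z)))%C.

Definition field_3_z (z : C) : C :=
  let p := wt_p z in let w := wt_w z in let w1 := wt_w1 z in let wb := Cconj w in let w1b := Cconj w1 in
  let G := wt_G z in let Gb := Cconj G in let Gd := wt_Gd z in let A := wt_A z in
  let g := wt_g z in let g' := wt_gd z in let gb := Cconj (wt_g z) in let c := Cconj a in let cb := a in let m := M in
  let p0 := wt_p0 in let a0b := Cconj a0 in let tau := RtoC (wt_tau z) in let tz := wt_tz z in
  let E := field_E z in
  let Ez := (g' * w1b * Gb * (p + A) + g * w1b * Gb * (g' * gb + a0b * g') + w1b * iR * (2 * A * a0b * g' * w + A * A * m * w1))%C in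
  (m / 4 * (- (cb * cb) * tz * Cconj (G1 z) * (Gb + c)
       + cb * cb * (Gb * Gb) * ((tz * E + tau * Ez) / (p * p) - 2 * tau * E * (g' * gb) / (p * p * p))
       + c * cb * w1b * (Gb * Gb) * ((2 * tau * tz * w * (G * G) + tau * tau * (m * w1 * (G * G) + w * (2 * G * Gd))) / (p * p)
           - 2 * (tau * tau) * w * (G * G) * (g' * gb) / (p * p * p))))%C.

Lemma dC1_field_3 : exists q, dC1 rho field_3 field_3_z q.
Proof.
  pose proof holo_w as Hw. pose proof (holo_conj _ _ _ holo_w1) as Hw1.
  pose proof holo_G as HG. pose proof (holo_conj _ _ _ HG) as HG'. pose proof (holo_conj _ _ _ HG1) as HG1'.
  pose proof holo_A as HA. pose proof dC1_ip as Hip. pose proof dC1_tau as Ht. pose proof dC1_p as Hp0.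
  pose proof holo_g as Hg. unfold holo in *.
  eexists. unfold field_3, field_E. eapply dC1_eq_deriv; [repeat dC1_step| |reflexivity].
  intros z _. cbv beta. unfold field_3_z, field_E, wt_ip. pose proof (wt_p_neq0 z) as Hp.
  field. exact Hp.
Qed.

Lemma base_form_radial z :
  radial_form wt_tau wt_tz z =
  INR m ^ 2 * nrm2 (wt_w1 z) / 4 * (nrm2 wt_p0 * nrm2 a * (/ r ^ (2 * m)) ^ 2
     - nrm2 (wt_th z) / (1 + nrm2 (wt_g z)) ^ 2 - nrm2 a ^ 2 * / r ^ (2 * m)) - fst (field_3_z z).
Proof.
  generalize (base_form_identity M z (Cconj z) (wt_w1 z) (Cconj (wt_w1 z)) (G1 z) (Cconj (G1 z)) (wt_Gd z) (Cconj (wt_Gd z))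
    a (Cconj a) a0 (Cconj a0) iR).
  cbv zeta.
  assert (EiR : Cconj iR = iR) by apply Cconj_RtoC.
  assert (Ew : (z * wt_w1 z)%C = wt_w z) by (symmetry; apply wt_w_w1).
  assert (Ewb : (Cconj z * Cconj (wt_w1 z))%C = Cconj (wt_w z)) by (rewrite <- Ew; now push_conj).
  assert (EG : (a + z * G1 z)%C = wt_G z) by reflexivity.
  assert (EGb : (Cconj a + Cconj z * Cconj (G1 z))%C = Cconj (wt_G z)) by (unfold wt_G; now push_conj).
  rewrite Ew, Ewb, EG, EGb.
  assert (Eg : (a0 + wt_w z * wt_G z)%C = wt_g z) by reflexivity.
  assert (Egb : (Cconj a0 + Cconj (wt_w z) * Cconj (wt_G z))%C = Cconj (wt_g z)) by (unfold wt_g; now push_conj).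
  assert (Egd : (M * wt_w1 z * wt_G z + wt_w z * wt_Gd z)%C = wt_gd z) by reflexivity.
  assert (Egdb : (M * Cconj (wt_w1 z) * Cconj (wt_G z) + Cconj (wt_w z) * Cconj (wt_Gd z))%C = Cconj (wt_gd z))
    by (unfold wt_gd, M; now push_conj).
  rewrite Eg, Egb, Egd, Egdb.
  assert (EA : (1 + Cconj a0 * wt_g z)%C = wt_A z) by reflexivity.
  assert (EAb : (1 + a0 * Cconj (wt_g z))%C = Cconj (wt_A z)) by (unfold wt_A; now push_conj).
  rewrite EA, EAb.
  change (1 + wt_g z * Cconj (wt_g z))%C with (wt_p z). change (1 + a0 * Cconj a0)%C with wt_p0.
  rewrite <- wt_tau_C.
  change (- (M * wt_w1 z * Cconj (wt_w z) * iR))%C with (wt_tz z).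
  assert (Etb : (- (M * Cconj (wt_w1 z) * wt_w z * iR))%C = Cconj (wt_tz z))
    by (unfold wt_tz; push_conj; rewrite EiR; unfold M; now push_conj).
  rewrite Etb.
  change (wt_g z * Cconj (wt_w1 z) * Cconj (wt_G z) * (wt_p z + wt_A z) +
       wt_A z * wt_A z * wt_w z * Cconj (wt_w1 z) * iR)%C with (field_E z).
  assert (EEb : (Cconj (wt_g z) * wt_w1 z * wt_G z * (wt_p z + Cconj (wt_A z)) +
       Cconj (wt_A z) * Cconj (wt_A z) * Cconj (wt_w z) * wt_w1 z * iR)%C = Cconj (field_E z))
    by (unfold field_E; push_conj; now rewrite wt_p_conj, EiR).
  rewrite EEb.
  intros H. specialize (H (wt_p_neq0 z)).
  pose proof (wt_p_neq0 z) as Hp. pose proof two_neq0 as H2.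
  assert (H4 : RtoC 4 <> RtoC 0) by (intros E; apply RtoC_inj in E; lra).
  assert (Hp2 : (wt_p z * wt_p z)%C <> RtoC 0) by now apply Cmult_neq_0.
  assert (Hp3 : (wt_p z * wt_p z * wt_p z)%C <> RtoC 0) by now apply Cmult_neq_0.
  assert (Hp0 : Cconj wt_p0 = wt_p0) by (unfold wt_p0; push_conj; ring).
  assert (Hn : RtoC (1 + nrm2 (wt_g z)) = wt_p z) by (symmetry; apply wt_p_real).
  pose proof (nrm2_pos (wt_g z)) as Hnn.
  assert (Hdiv : forall x y, y <> RtoC 0 -> Cconj y = y -> Cconj (x / y) = (Cconj x / y)%C)
    by (intros x y Hy0 Hy; rewrite Cdiv_conj, Hy; auto).
  apply RtoC_inj. rewrite RtoC_minus, RtoC_re.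
  assert (E2 : RtoC (radial_form wt_tau wt_tz z) =
     (wt_uC z * wt_uC z * (wt_tz z * Cconj (wt_tz z)) + RtoC (wt_tau z) * RtoC (wt_tau z) * wt_JC z)%C).
  { unfold radial_form. rewrite RtoC_plus, !RtoC_mult, !RtoC_pow.
    rewrite !nrm2_conj, <- wt_u_C, <- wt_J_C. ring. }
  rewrite E2. unfold wt_JC at 1. unfold wt_uC at 1 2 3. rewrite H. clear H E2. f_equal.
  - unfold wt_th. rewrite RtoC_mult, !RtoC_minus, (RtoC_div (INR m ^ 2 * nrm2 (wt_w1 z))), !RtoC_mult, !RtoC_pow by lra.
    rewrite (RtoC_div (nrm2 _)), RtoC_pow, Hn by (apply pow_nonzero; lra).
    rewrite !nrm2_conj, Hp0. push_conj. rewrite EiR. fold M iR. field. exact Hp.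
  - f_equal. f_equal. f_equal. unfold field_3_z. push_conj.
    rewrite (Hdiv _ (RtoC 4)) by (auto; apply Cconj_RtoC).
    push_conj.
    rewrite !(Hdiv _ (wt_p z * wt_p z)%C) by (first [assumption|push_conj; now rewrite wt_p_conj]).
    rewrite !(Hdiv _ (wt_p z * wt_p z * wt_p z)%C) by (first [assumption|push_conj; now rewrite wt_p_conj]).
    push_conj. rewrite wt_p_conj, EiR. unfold M. push_conj. field. exact Hp.
Qed.

Lemma continuous_nrm2_w1 z : odisc rho z -> continuous (fun z => nrm2 (wt_w1 z)) z.
Proof. intros Hz. apply continuous_nrm2. apply (wt_contC z Hz). Qed.

(** The z-derivative of z |z|^(2(m-1)) is m |z|^(2(m-1)). Subtracting the boundary constant makes
    the field vanish on the circle, so the divergence theorem shows that m times the integral is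
    [cst] times the area of the disc. *)
Lemma dint_w1_pos : 0 < dint r (fun z => nrm2 (wt_w1 z)).
Proof.
  pose (cst := r ^ (2 * (m - 1))).
  assert (Hc : 0 < cst) by (apply pow_lt; lra).
  assert (HB : exists q, dC1 rho (fun z => z * (wt_w1 z * Cconj (wt_w1 z) - RtoC cst))%C
                 (fun z => RtoC (INR m * nrm2 (wt_w1 z) + - cst)) q).
  { pose proof holo_w1 as Hw1. pose proof (holo_conj _ _ _ Hw1) as Hw1'. unfold holo in Hw1.
    eexists. eapply dC1_eq_deriv; [repeat dC1_step| |reflexivity].
    intros z _. cbv beta. rewrite RtoC_plus, RtoC_mult, nrm2_conj, RtoC_opp.
    unfold wt_w1. destruct m as [|[|n]]; [lia| |].
    - simpl. ring.
    - replace (S (S n) - 1)%nat with (S n) by lia. replace (S n - 1)%nat with n by lia.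
      rewrite (S_INR (S n)), RtoC_plus, !Cpow_S. ring. }
  destruct HB as [q HB].
  assert (H0 : dint r (fun z => fst (RtoC (INR m * nrm2 (wt_w1 z) + - cst))) = 0).
  { apply (dint_div rho r _ _ _ Hr HB). intros z Hz.
    rewrite <- nrm2_conj. unfold wt_w1. rewrite nrm2_pow.
    change (fst z ^ 2 + snd z ^ 2) with (nrm2 z) in Hz. rewrite Hz, <- pow_mult.
    unfold cst. ring. }
  cbn [fst RtoC] in H0.
  rewrite (dint_plus r (proj1 Hr) (fun z => INR m * nrm2 (wt_w1 z)) (fun _ => - cst)) in H0.
  - rewrite (dint_scal r (proj1 Hr)) in H0.
    + rewrite (dint_ext r (fun _ => - cst) (fun _ => - cst * 1)), (dint_scal r (proj1 Hr) (- cst) (fun _ => 1)) in H0;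
        [|intros z _; apply continuous_const|lra|intros; ring].
      pose proof (dint_one_pos r (proj1 Hr)) as H1.
      assert (Hm' : 0 < INR m) by now apply lt_0_INR.
      apply (Rmult_lt_reg_l (INR m)); auto. rewrite Rmult_0_r. nra.
    + apply cont_cdisc_of_odisc, continuous_nrm2_w1.
  - apply cont_cdisc_of_odisc. intros z Hz. apply continuous_Rmult; [apply continuous_const|now apply continuous_nrm2_w1].
  - intros z _. apply continuous_const.
Qed.

Lemma dint_base_form_neg : nrm2 wt_p0 < nrm2 a * r ^ (2 * m) -> dint r (radial_form wt_tau wt_tz) < 0.
Proof.
  intros Hlt. set (R2 := r ^ (2 * m)) in *.
  assert (HR : 0 < R2) by (apply pow_lt; lra).
  pose proof (nrm2_pos wt_p0) as Hp0. pose proof (nrm2_pos a) as Ha.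
  assert (Ha' : 0 < nrm2 a) by nra.
  destruct dC1_field_3 as [q Hq].
  assert (Hf0 : dint r (fun z => fst (field_3_z z)) = 0).
  { apply (dint_div rho r _ _ _ Hr Hq). intros z Hz. unfold field_3. rewrite wt_tau_circle by exact Hz. ring. }
  assert (Hfc : cont_cdisc r (fun z => fst (field_3_z z))).
  { apply cont_cdisc_of_odisc. intros z Hz. apply (proj1 (proj1 (proj2 (proj2 (Hq z Hz))))). }
  (* The bracket of [base_form_radial] without its square. As [nrm2 wt_p0] is (1 + |a_0|^2)^2, the
     hypothesis is exactly the negativity of the last factor. *)
  pose (k := INR m ^ 2 / 4 * (nrm2 a * / R2 * (nrm2 wt_p0 * / R2 - nrm2 a))).
  assert (Hk : k < 0).
  { assert (0 < INR m) by now apply lt_0_INR.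
    assert (nrm2 wt_p0 * / R2 < nrm2 a).
    { apply (Rmult_lt_reg_r R2); auto. rewrite Rmult_assoc, Rinv_l by lra. lra. }
    assert (0 < / R2) by now apply Rinv_0_lt_compat.
    assert (0 < INR m ^ 2 / 4) by (apply Rdiv_lt_0_compat; [now apply pow_lt|lra]).
    unfold k. assert (0 < nrm2 a * / R2) by now apply Rmult_lt_0_compat.
    assert (0 < INR m ^ 2 / 4 * (nrm2 a * / R2)) by now apply Rmult_lt_0_compat. nra. }
  apply Rle_lt_trans with (dint r (fun z => k * nrm2 (wt_w1 z) - fst (field_3_z z))).
  - apply dint_le; [lra| | |].
    + apply cont_cdisc_of_odisc. intros z Hz.
      destruct (wt_contC z Hz) as (_ & _ & _ & _ & _ & _ & _ & _ & [H1 _] & H2).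
      now apply continuous_radial_form.
    + apply cont_cdisc_of_odisc. intros z Hz. apply continuous_Rminus.
      * apply continuous_Rmult; [apply continuous_const|now apply continuous_nrm2_w1].
      * apply (proj1 (proj1 (proj2 (proj2 (Hq z Hz))))).
    + intros z Hz. rewrite base_form_radial. fold R2.
      assert (Hth : 0 <= nrm2 (wt_th z) / (1 + nrm2 (wt_g z)) ^ 2).
      { pose proof (nrm2_pos (wt_th z)). pose proof (nrm2_pos (wt_g z)).
        apply Rmult_le_pos; auto. left. apply Rinv_0_lt_compat. nra. }
      assert (Hc : 0 <= INR m ^ 2 * nrm2 (wt_w1 z) / 4).
      { pose proof (nrm2_pos (wt_w1 z)). pose proof (pow2_ge_0 (INR m)). nra. }
      unfold k. set (t := nrm2 (wt_th z) / (1 + nrm2 (wt_g z)) ^ 2) in *.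
      apply Rplus_le_compat_r.
      replace (INR m ^ 2 / 4 * (nrm2 a * / R2 * (nrm2 wt_p0 * / R2 - nrm2 a)) * nrm2 (wt_w1 z))
        with (INR m ^ 2 * nrm2 (wt_w1 z) / 4 * (nrm2 wt_p0 * nrm2 a * (/ R2) ^ 2 - nrm2 a ^ 2 * / R2)) by (field; lra).
      apply Rmult_le_compat_l; auto. lra.
  - rewrite (dint_minus r (proj1 Hr) (fun z => k * nrm2 (wt_w1 z)) (fun z => fst (field_3_z z))); auto.
    + rewrite (dint_scal r (proj1 Hr)) by (apply cont_cdisc_of_odisc, continuous_nrm2_w1).
      pose proof dint_w1_pos. nra.
    + apply cont_cdisc_of_odisc. intros z Hz. apply continuous_Rmult; [apply continuous_const|now apply continuous_nrm2_w1].
Qed.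

End WeightData.

(** * Logarithmic cutoff *)

(** Green's second identity, from the field zeta Y_zbar - Y zeta_zbar. Both functions are real, so
    the mixed products in its z-derivative are conjugate to each other and their difference has real
    part 0. Boundary terms vanish because zeta and its gradient do. *)
Lemma dint_green (rho r : R) (zeta Y : C -> R) (zz zb zbz zbb Yz Yb Ybz Ybb : C -> C) :
  0 < r < rho ->
  dC1 rho (fun z => RtoC (zeta z)) zz zb -> dC1 rho zb zbz zbb ->
  dC1 rho (fun z => RtoC (Y z)) Yz Yb -> dC1 rho Yb Ybz Ybb ->
  (forall z, nrm2 z = r ^ 2 -> zeta z = 0 /\ zb z = RtoC 0) ->
  dint r (fun z => zeta z * fst (Ybz z)) = dint r (fun z => Y z * fst (zbz z)).
Proof.
  intros Hr Hz Hzb HY HYb H0.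
  assert (HB : exists q, dC1 rho (fun z => RtoC (zeta z) * Yb z - RtoC (Y z) * zb z)%C
     (fun z => zz z * Yb z + RtoC (zeta z) * Ybz z - (Yz z * zb z + RtoC (Y z) * zbz z))%C q).
  { eexists. eapply dC1_eq_deriv; [repeat dC1_step|reflexivity|reflexivity]. }
  destruct HB as [q HB].
  assert (E : dint r (fun z => fst (zz z * Yb z + RtoC (zeta z) * Ybz z - (Yz z * zb z + RtoC (Y z) * zbz z))%C) = 0).
  { apply (dint_div rho r _ _ _ Hr HB). intros z Hzz. destruct (H0 z Hzz) as [-> ->]. ring. }
  rewrite (dint_ext r _ (fun z => zeta z * fst (Ybz z) - Y z * fst (zbz z))) in E.
  - rewrite (dint_minus r (proj1 Hr) (fun z => zeta z * fst (Ybz z)) (fun z => Y z * fst (zbz z))) in E; [lra| |].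
    + intros z Hzd. apply cdisc_odisc with (rho := rho) in Hzd; auto.
      apply continuous_Rmult; [apply (proj1 (proj1 (proj2 (Hz z Hzd))))|apply (proj1 (proj1 (proj2 (proj2 (HYb z Hzd)))))].
    + intros z Hzd. apply cdisc_odisc with (rho := rho) in Hzd; auto.
      apply continuous_Rmult; [apply (proj1 (proj1 (proj2 (HY z Hzd))))|apply (proj1 (proj1 (proj2 (proj2 (Hzb z Hzd)))))].
  - lra.
  - intros z Hzd. assert (Hod : odisc rho z) by (unfold odisc; nra).
    rewrite (dC1_real_conj _ _ _ _ _ Hz Hod), (dC1_real_conj _ _ _ _ _ HY Hod). simpl. ring.
Qed.

Section Cutoff.
Variables (rho r : R) (F Fd Fdd : C -> C) (N : nat) (cF q0 : R).
Hypothesis Hr : 0 < r < rho.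
Hypothesis HF : holo rho F Fd.
Hypothesis HFd : holo rho Fd Fdd.
Hypothesis HcF : 0 < cF.
Hypothesis Hq0 : 0 < q0.
Hypothesis HN : (0 < N)%nat.
Hypothesis Hlow : forall z, cdisc r z -> nrm2 z <= q0 -> cF * nrm2 z ^ N <= nrm2 (F z).

Definition ct_s (L : R) (z : C) : R := nrm2 (F z) + exp (- L).
Definition ct_v (L : R) (z : C) : R := ln (ct_s L z).
Definition ct_vz (L : R) (z : C) : C := (RtoC (/ ct_s L z) * (Fd z * Cconj (F z)))%C.
Definition ct_vb (L : R) (z : C) : C := (RtoC (/ ct_s L z) * (F z * Cconj (Fd z)))%C.
(** A quarter of the Laplacian of v. *)
Definition ct_lap (L : R) (z : C) : R := exp (- L) * nrm2 (Fd z) / ct_s L z ^ 2.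

Lemma ct_s_pos L z : 0 < ct_s L z.
Proof. unfold ct_s. pose proof (nrm2_pos (F z)). pose proof (exp_pos (- L)). lra. Qed.

Lemma dC1_s L : dC1 rho (fun z => RtoC (ct_s L z)) (fun z => Fd z * Cconj (F z))%C (fun z => F z * Cconj (Fd z))%C.
Proof.
  pose proof (holo_conj _ _ _ HF) as HF'. unfold holo in HF.
  apply dC1_eq with (F := fun z => (F z * Cconj (F z) + RtoC (exp (- L)))%C)
    (p := fun z => (Fd z * Cconj (F z))%C) (q := fun z => (F z * Cconj (Fd z))%C); auto.
  - eapply dC1_eq_deriv; [repeat dC1_step|intros; cbv beta; ring..].
  - intros z. unfold ct_s. now rewrite RtoC_plus, nrm2_conj.
Qed.

Lemma dC1_is L : dC1 rho (fun z => RtoC (/ ct_s L z))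
   (fun z => RtoC (- / (ct_s L z) ^ 2) * (Fd z * Cconj (F z)))%C (fun z => RtoC (- / (ct_s L z) ^ 2) * (F z * Cconj (Fd z)))%C.
Proof.
  apply (dC1_Rinv _ _ _ _ (dC1_s L)). intros z _. pose proof (ct_s_pos L z). lra.
Qed.

Lemma dC1_v L : dC1 rho (fun z => RtoC (ct_v L z)) (ct_vz L) (ct_vb L).
Proof. apply (dC1_Rln _ _ _ _ (dC1_s L)). intros z _. apply ct_s_pos. Qed.

Lemma dC1_vb L : exists q, dC1 rho (ct_vb L) (fun z => RtoC (ct_lap L z)) q.
Proof.
  pose proof (holo_conj _ _ _ HFd) as HFd'. pose proof (dC1_is L) as Hi. unfold holo in HF.
  eexists. unfold ct_vb. eapply dC1_eq_deriv; [repeat dC1_step| |reflexivity].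
  intros z _. cbv beta. pose proof (ct_s_pos L z) as Hs.
  assert (E : RtoC (ct_s L z) = (F z * Cconj (F z) + RtoC (exp (- L)))%C)
    by (unfold ct_s; now rewrite RtoC_plus, nrm2_conj).
  assert (Hs0 : RtoC (ct_s L z) <> RtoC 0) by (intros H; apply RtoC_inj in H; lra).
  unfold ct_lap. rewrite RtoC_div by (apply pow_nonzero; lra).
  rewrite RtoC_mult, nrm2_conj, RtoC_opp, !RtoC_inv, RtoC_pow by (try apply pow_nonzero; lra).
  replace (RtoC (exp (- L))) with (RtoC (ct_s L z) - F z * Cconj (F z))%C by (rewrite E; ring).
  field. auto.
Qed.

Lemma ct_contC L z : odisc rho z -> contC F z /\ contC Fd z /\ continuous (ct_s L) z /\ continuous (ct_v L) z /\
  contC (ct_vz L) z /\ continuous (fun z => / ct_s L z) z /\ continuous (ct_lap L) z.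
Proof.
  intros Hz. destruct (HF z Hz) as (_ & H1 & H2 & _). destruct (dC1_v L z Hz) as (_ & [H3 _] & H4 & _).
  destruct (dC1_s L z Hz) as (_ & [H5 _] & _). destruct (dC1_is L z Hz) as (_ & [H6 _] & _).
  destruct (dC1_vb L) as [q Hq]. destruct (Hq z Hz) as (_ & _ & [H7 _] & _).
  exact (conj H1 (conj H2 (conj H5 (conj H3 (conj H4 (conj H6 H7)))))).
Qed.

Lemma ct_v_lower L z : - L <= ct_v L z.
Proof.
  unfold ct_v. rewrite <- (ln_exp (- L)). pose proof (exp_pos (- L)).
  apply ln_le; auto. unfold ct_s. pose proof (nrm2_pos (F z)). lra.
Qed.

Lemma exp_neg_le_1 L : 0 <= L -> exp (- L) <= 1.
Proof. intros H. rewrite <- exp_0. destruct (Rle_lt_or_eq_dec _ _ H) as [H'| <-].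
  - left. apply exp_increasing. lra.
  - rewrite Ropp_0. lra.
Qed.

Lemma ct_v_upper : exists V0, 0 <= V0 /\ forall L z, 0 <= L -> cdisc r z -> ct_v L z <= V0.
Proof.
  destruct (cont_cdisc_bounded r (proj1 Hr) (fun z => nrm2 (F z))) as (B & HB & HBz).
  { intros z Hz. apply continuous_nrm2. exact (proj1 (ct_contC 0 z (cdisc_odisc r rho z Hr Hz))). }
  exists (ln (B + 1)). split.
  - rewrite <- ln_1. apply ln_le; lra.
  - intros L z HL Hz. unfold ct_v. apply ln_le; [apply ct_s_pos|].
    unfold ct_s. generalize (HBz z Hz). pose proof (Rle_abs (nrm2 (F z))).
    pose proof (exp_neg_le_1 L HL). lra.
Qed.

(** * A Jensen type inequality for v, uniform in L *)

Section Jensen.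
Variable delta : R.
Hypothesis Hdelta : 0 < delta.

(* Vanishes to second order on the circle, and for small [delta] its Laplacian [green_zeta_lap] is negative only near 0,
   where a lower bound of [ct_v] is available. *)
Definition green_zeta (z : C) : R := nrm2 z - r ^ 2 - (r ^ 2 + delta) * (ln (nrm2 z + delta) - ln (r ^ 2 + delta)).
Definition green_zeta_b (z : C) : C := (z * (1 - RtoC (r ^ 2 + delta) * RtoC (/ (nrm2 z + delta))))%C.
Definition green_zeta_lap (z : C) : R := 1 - (r ^ 2 + delta) * delta * / (nrm2 z + delta) ^ 2.

Lemma dC1_nrm2 d : dC1 rho (fun z => RtoC (nrm2 z + d)) (fun z => Cconj z) (fun z => z).
Proof.
  pose proof (dC1_id rho) as Hi. pose proof (holo_conj _ _ _ Hi) as Hi'.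
  apply dC1_eq with (F := fun z => (z * Cconj z + RtoC d)%C)
    (p := fun z => (Cconj z)%C) (q := fun z => z); auto.
  - eapply dC1_eq_deriv; [repeat dC1_step|intros; cbv beta; rewrite ?Cconj_RtoC; ring..].
  - intros z. now rewrite RtoC_plus, nrm2_conj.
Qed.

Lemma nrm2_shift_pos d z : 0 < d -> 0 < nrm2 z + d.
Proof. pose proof (nrm2_pos z). lra. Qed.

Lemma dC1_green_zeta : exists p, dC1 rho (fun z => RtoC (green_zeta z)) p green_zeta_b.
Proof.
  pose proof (dC1_nrm2 (- r ^ 2)) as H1.
  pose proof (dC1_Rln rho _ _ _ (dC1_nrm2 delta) (fun z _ => nrm2_shift_pos delta z Hdelta)) as H2.
  eexists. apply dC1_eq with
    (F := fun z => (RtoC (nrm2 z + - r ^ 2) - RtoC (r ^ 2 + delta) * (RtoC (ln (nrm2 z + delta)) - RtoC (ln (r ^ 2 + delta))))%C)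
    (q := green_zeta_b) (p := fun z => (Cconj z - RtoC (r ^ 2 + delta) * (RtoC (/ (nrm2 z + delta)) * Cconj z))%C); [| |reflexivity|reflexivity].
  - eapply dC1_eq_deriv; [repeat dC1_step| |].
    + intros z _. cbv beta. ring.
    + intros z _. unfold green_zeta_b. cbv beta. ring.
  - intros z. unfold green_zeta. rewrite <- !RtoC_minus, <- RtoC_mult, <- RtoC_minus. reflexivity.
Qed.

Lemma dC1_green_zeta_b : exists q, dC1 rho green_zeta_b (fun z => RtoC (green_zeta_lap z)) q.
Proof.
  pose proof (dC1_Rinv rho _ _ _ (dC1_nrm2 delta) (fun z _ => Rgt_not_eq _ _ (nrm2_shift_pos delta z Hdelta))) as H2.
  eexists. unfold green_zeta_b. eapply dC1_eq_deriv; [repeat dC1_step| |reflexivity].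
  intros z _. cbv beta. pose proof (nrm2_shift_pos delta z Hdelta) as Hp.
  assert (E : RtoC (nrm2 z + delta) = (z * Cconj z + RtoC delta)%C) by (rewrite RtoC_plus; now rewrite nrm2_conj).
  assert (Hs0 : RtoC (nrm2 z + delta) <> RtoC 0) by (intros H; apply RtoC_inj in H; lra).
  unfold green_zeta_lap. rewrite RtoC_minus, !RtoC_mult, RtoC_opp, !RtoC_inv, !RtoC_pow by (try apply pow_nonzero; lra).
  replace (RtoC delta) with (RtoC (nrm2 z + delta) - z * Cconj z)%C by (rewrite E; ring).
  field. auto.
Qed.

Lemma green_zeta_nonneg z : cdisc r z -> 0 <= green_zeta z.
Proof.
  intros Hz. change (nrm2 z <= r ^ 2) in Hz. unfold green_zeta.
  pose proof (nrm2_shift_pos delta z Hdelta). pose proof (pow2_ge_0 r).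
  assert (H1 : ln (nrm2 z + delta) - ln (r ^ 2 + delta) <= (nrm2 z + delta) / (r ^ 2 + delta) - 1).
  { rewrite <- ln_div by lra.
    set (x := (nrm2 z + delta) / (r ^ 2 + delta)).
    assert (Hx : 0 < x) by (apply Rdiv_lt_0_compat; lra).
    generalize (exp_ineq1_le (ln x)). rewrite exp_ln by auto. lra. }
  apply (Rmult_le_compat_l (r ^ 2 + delta)) in H1; [|lra].
  replace ((r ^ 2 + delta) * ((nrm2 z + delta) / (r ^ 2 + delta) - 1)) with (nrm2 z - r ^ 2) in H1 by (field; lra).
  lra.
Qed.

(** [dint_green] moves the Laplacian from v to zeta, and zeta and the Laplacian of v are both
    nonnegative. The mean value inequality at the centre would be useless, because F(0) = 0 makes
    v(0) equal to - L; the smoothing by delta spreads the pole of ln |z|^2 over a neighbourhood of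
    0. *)
Lemma jensen_nonneg L : 0 <= dint r (fun z => ct_v L z * green_zeta_lap z).
Proof.
  destruct dC1_green_zeta as [p Hjz]. destruct dC1_green_zeta_b as [q Hjb]. destruct (dC1_vb L) as [q' Hvb].
  pose proof (dint_green rho r green_zeta (ct_v L) _ _ _ _ _ _ _ _ Hr Hjz Hjb (dC1_v L) Hvb) as H.
  cbn [fst RtoC] in H. rewrite <- H.
  - replace 0 with (dint r (fun _ => 0 * 1)).
    + apply dint_le; [lra| | |].
      * intros z _. apply continuous_const.
      * intros z Hz. apply cdisc_odisc with (rho := rho) in Hz; auto.
        apply continuous_Rmult; [apply (Hjz z Hz)|apply (ct_contC L z Hz)].
      * intros z Hz. rewrite Rmult_0_l. apply Rmult_le_pos; [now apply green_zeta_nonneg|].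
        unfold ct_lap. pose proof (ct_s_pos L z). pose proof (exp_pos (- L)). pose proof (nrm2_pos (Fd z)).
        apply Rmult_le_pos; [nra|]. left. apply Rinv_0_lt_compat. nra.
    + rewrite (dint_scal r (proj1 Hr) 0 (fun _ => 1)); [ring|]. intros z _; apply continuous_const.
  - intros z Hz. unfold green_zeta, green_zeta_b. rewrite Hz. split; [ring|].
    pose proof (pow2_ge_0 r). rewrite <- RtoC_mult, Rinv_r by lra. ring.
Qed.

End Jensen.

(** The z-derivative of z (ln(|z|^2 + d) - ln(r^2 + d)) is the logarithm plus a remainder of at most
    1 - ln(r^2). The bound does not depend on d, which later is exp(- L / N). *)
Lemma dint_ln_lower (d : R) : 0 < d ->
  (ln (r ^ 2) - 1) * dint r (fun _ => 1) <= dint r (fun z => ln (nrm2 z + d)).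
Proof.
  intros Hd. assert (Hc1 : forall k : R, cont_cdisc r (fun _ => k)) by (intros k z _; apply continuous_const).
  pose proof (dC1_Rln rho _ _ _ (dC1_nrm2 d) (fun z _ => nrm2_shift_pos d z Hd)) as H2.
  pose (lr := ln (r ^ 2 + d)).
  pose (rest := fun z : C => - lr + nrm2 z * / (nrm2 z + d)).
  assert (HB : exists q, dC1 rho (fun z => z * (RtoC (ln (nrm2 z + d)) - RtoC lr))%C
     (fun z => RtoC (ln (nrm2 z + d) + rest z)) q).
  { eexists. eapply dC1_eq_deriv; [repeat dC1_step| |reflexivity].
    intros z _. cbv beta. unfold rest. rewrite !RtoC_plus, RtoC_mult, nrm2_conj, RtoC_opp. ring. }
  destruct HB as [q HB].
  assert (Hln : cont_cdisc r (fun z => ln (nrm2 z + d))).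
  { intros z Hz. apply cdisc_odisc with (rho := rho) in Hz; auto. apply (H2 z Hz). }
  assert (Hrest : cont_cdisc r rest).
  { intros z _. unfold rest. assert (continuous nrm2 z) by (apply (continuous_nrm2 (fun z => z)), contC_id).
    pose proof (nrm2_shift_pos d z Hd).
    repeat first [assumption | lra | cont1 | apply (continuous_Rplus nrm2 (fun _ => d)) | lra]. }
  assert (E : dint r (fun z => fst (RtoC (ln (nrm2 z + d) + rest z))) = 0).
  { apply (dint_div rho r _ _ _ Hr HB). intros z Hz. change (nrm2 z = r ^ 2) in Hz.
    rewrite Hz. fold lr. ring. }
  cbn [fst RtoC] in E. rewrite (dint_plus r (proj1 Hr) (fun z => ln (nrm2 z + d)) rest Hln Hrest) in E.
  assert (Hle : dint r rest <= dint r (fun _ => (1 - ln (r ^ 2)) * 1)).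
  { apply dint_le; auto; [lra|]. intros z _. unfold rest.
    pose proof (nrm2_pos z). assert (0 < r ^ 2) by nra.
    assert (ln (r ^ 2) <= lr) by (apply ln_le; lra).
    assert (nrm2 z * / (nrm2 z + d) <= 1).
    { apply (Rmult_le_reg_r (nrm2 z + d)); [lra|]. rewrite Rmult_assoc, Rinv_l by lra. lra. }
    lra. }
  rewrite (dint_scal r (proj1 Hr) _ (fun _ => 1)) in Hle by auto. lra.
Qed.

Lemma cutoff_pow_add (x y : R) (n : nat) : 0 <= x -> 0 <= y -> (x + y) ^ n <= 2 ^ n * (x ^ n + y ^ n).
Proof.
  intros Hx Hy. apply Rle_trans with ((2 * Rmax x y) ^ n).
  - apply pow_incr. pose proof (Rmax_l x y). pose proof (Rmax_r x y). lra.
  - rewrite Rpow_mult_distr. apply Rmult_le_compat_l; [apply pow_le; lra|].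
    pose proof (pow_le x n Hx). pose proof (pow_le y n Hy).
    unfold Rmax. destruct (Rle_dec x y); lra.
Qed.

(** With e1 = exp(- L / N) one has exp(- L) = e1^N, so s is at least a constant times |z|^(2N) +
    e1^N, hence times (|z|^2 + e1)^N; the 2^N in [c1] comes from this last step. The logarithm on
    the left has integral bounded uniformly in L. *)
Lemma ct_v_near_0 : exists C5, 0 <= C5 /\ forall L z, 1 <= L -> cdisc r z -> nrm2 z <= q0 ->
  - C5 + INR N * ln (nrm2 z + exp (- L / INR N)) <= ct_v L z.
Proof.
  pose (c1 := Rmin cF 1 * / 2 ^ N).
  assert (Hc1 : 0 < c1).
  { apply Rmult_lt_0_compat; [apply Rmin_pos; lra|]. apply Rinv_0_lt_compat, pow_lt; lra. }
  assert (HN' : 0 < INR N) by now apply lt_0_INR.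
  exists (Rabs (ln c1)). split; [apply Rabs_pos|]. intros L z HL Hz Hzq.
  set (e1 := exp (- L / INR N)). assert (He1 : 0 < e1) by apply exp_pos.
  assert (He : e1 ^ N = exp (- L)).
  { rewrite <- (exp_ln (e1 ^ N)) by now apply pow_lt.
    rewrite ln_pow by auto. unfold e1. rewrite ln_exp. f_equal. field. lra. }
  pose proof (nrm2_pos z) as Hn. pose proof (nrm2_shift_pos e1 z He1) as Hp.
  rewrite <- ln_pow by auto.
  apply Rle_trans with (ln c1 + ln ((nrm2 z + e1) ^ N)).
  - pose proof (Rle_abs (- ln c1)). rewrite Rabs_Ropp in H. lra.
  - rewrite <- ln_mult by (auto; now apply pow_lt).
    unfold ct_v. apply ln_le; [apply Rmult_lt_0_compat; auto; now apply pow_lt|].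
    unfold ct_s. rewrite <- He. generalize (Hlow z Hz Hzq). intros Hl.
    generalize (cutoff_pow_add (nrm2 z) e1 N Hn (Rlt_le _ _ He1)). intros Hc.
    apply Rle_trans with (Rmin cF 1 * (nrm2 z ^ N + e1 ^ N)).
    + unfold c1. rewrite Rmult_assoc. apply Rmult_le_compat_l; [left; apply Rmin_pos; lra|].
      apply (Rmult_le_reg_l (2 ^ N)); [apply pow_lt; lra|].
      rewrite <- Rmult_assoc, Rinv_r by (apply pow_nonzero; lra). lra.
    + pose proof (pow_le (nrm2 z) N Hn). pose proof (pow_lt e1 N He1).
      pose proof (Rmin_l cF 1). pose proof (Rmin_r cF 1). nra.
Qed.

Lemma continuous_nrm2_id z : continuous nrm2 z.
Proof. apply (continuous_nrm2 (fun z => z)), contC_id. Qed.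

(** |v| is estimated pointwise by - 2 v times the weight of [jensen_nonneg], whose integral is at
    most 0, plus a multiple of 1 + lmax - ln(|z|^2 + e1), whose integral [dint_ln_lower] controls
    independently of L. *)
Lemma dint_abs_v_bound : exists C0, 0 <= C0 /\ forall L, 1 <= L -> dint r (fun z => Rabs (ct_v L z)) <= C0.
Proof.
  destruct ct_v_upper as (V0 & HV0 & HV). destruct ct_v_near_0 as (C5 & HC5 & Hnear).
  (* Chosen so that the weight [green_zeta_lap] is at least 1/2 where |z|^2 > q0. *)
  pose (delta := Rmin 1 (q0 ^ 2 / (2 * (r ^ 2 + 1)))).
  assert (Hr2 : 0 < r ^ 2) by (apply pow_lt; lra).
  assert (Hq2 : 0 < q0 ^ 2) by (apply pow_lt; lra).
  assert (Hdelta : 0 < delta).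
  { apply Rmin_pos; [lra|]. apply Rdiv_lt_0_compat; lra. }
  assert (Hd1 : delta <= 1) by apply Rmin_l.
  assert (Hd2 : 2 * ((r ^ 2 + delta) * delta) <= q0 ^ 2).
  { assert (delta <= q0 ^ 2 / (2 * (r ^ 2 + 1))) by apply Rmin_r.
    apply (Rmult_le_compat_l (2 * (r ^ 2 + 1))) in H; [|lra].
    replace (2 * (r ^ 2 + 1) * (q0 ^ 2 / (2 * (r ^ 2 + 1)))) with (q0 ^ 2) in H by (field; lra). nra. }
  pose (Om := 1 + (r ^ 2 + delta) / delta).
  assert (HOm : 1 <= Om).
  { unfold Om. assert (0 < (r ^ 2 + delta) / delta) by (apply Rdiv_lt_0_compat; lra). lra. }
  assert (HN' : 0 < INR N) by now apply lt_0_INR.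
  pose (Cst := (3 + 2 * Om) * (V0 + C5 + INR N)).
  assert (HCst : 0 <= Cst) by (apply Rmult_le_pos; lra).
  pose (lmax := ln (r ^ 2 + 1)).
  assert (Hlmax : 0 <= lmax) by (unfold lmax; rewrite <- ln_1; apply ln_le; lra).
  pose (A1 := dint r (fun _ => 1)).
  assert (HA1 : 0 < A1) by (apply dint_one_pos; lra).
  exists (Rmax 0 (Cst * ((1 + lmax) * A1 - (ln (r ^ 2) - 1) * A1))). split; [apply Rmax_l|].
  intros L HL. eapply Rle_trans; [|apply Rmax_r].
  pose (e1 := exp (- L / INR N)). assert (He1 : 0 < e1) by apply exp_pos.
  assert (He1' : e1 <= 1).
  { unfold e1. replace (- L / INR N) with (- (L / INR N)) by (field; lra). apply exp_neg_le_1.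
    apply Rmult_le_pos; [lra|]. left. now apply Rinv_0_lt_compat. }
  assert (Hw : forall z, green_zeta_lap delta z <= 1 /\ Rabs (green_zeta_lap delta z) <= Om).
  { intros z. pose proof (nrm2_pos z). unfold green_zeta_lap.
    assert (H1 : 0 < (r ^ 2 + delta) * delta * / (nrm2 z + delta) ^ 2).
    { repeat apply Rmult_lt_0_compat; try lra. apply Rinv_0_lt_compat, pow_lt. lra. }
    assert (H2 : (r ^ 2 + delta) * delta * / (nrm2 z + delta) ^ 2 <= (r ^ 2 + delta) / delta).
    { apply (Rmult_le_reg_r ((nrm2 z + delta) ^ 2)); [apply pow_lt; lra|].
      rewrite Rmult_assoc, Rinv_l, Rmult_1_r by (apply pow_nonzero; lra).
      replace ((r ^ 2 + delta) * delta) with ((r ^ 2 + delta) / delta * delta ^ 2) by (field; lra).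
      apply Rmult_le_compat_l; [|nra]. apply Rmult_le_pos; [lra|]. left; now apply Rinv_0_lt_compat. }
    split; [lra|]. apply Rabs_le. unfold Om. lra. }
  (* Where |z|^2 > q0 the weight is between 1/2 and 1: - 2 v times the weight absorbs |v| if v < 0,
     and 3 V0 suffices if v >= 0. Where |z|^2 <= q0 the weight is only bounded by [Om], but |v| <=
     V0 + C5 + N ell, at the cost of the factor 1 + 2 Om. [Cst] covers both cases, and e1 <= 1 makes
     ell >= 0. *)
  assert (Hpt : forall z, cdisc r z -> Rabs (ct_v L z) <=
       -2 * (ct_v L z * green_zeta_lap delta z) + Cst * (1 + lmax + - 1 * ln (nrm2 z + e1))).
  { intros z Hz. destruct (Hw z) as [Hw1 Hw2]. pose proof (nrm2_pos z) as Hn.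
    generalize (HV L z ltac:(lra) Hz). set (v := ct_v L z). intros Hv.
    assert (Hell : 0 <= lmax - ln (nrm2 z + e1)).
    { assert (ln (nrm2 z + e1) <= lmax); [|lra]. apply ln_le; [lra|].
      change (nrm2 z <= r ^ 2) in Hz. lra. }
    set (ell := lmax - ln (nrm2 z + e1)) in *.
    replace (1 + lmax + - 1 * ln (nrm2 z + e1)) with (1 + ell) by (unfold ell; ring).
    destruct (Rle_or_lt (nrm2 z) q0) as [Hq|Hq].
    - generalize (Hnear L z HL Hz Hq). fold v e1. intros Hl.
      assert (Hl' : - (C5 + INR N * ell) <= v).
      { assert (0 <= INR N * lmax) by (apply Rmult_le_pos; lra). unfold ell. nra. }
      assert (0 <= INR N * ell) by (apply Rmult_le_pos; lra).
      assert (Hav : Rabs v <= V0 + C5 + INR N * ell) by (apply Rabs_le; lra).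
      assert (Hvw : v * green_zeta_lap delta z <= Rabs v * Om).
      { eapply Rle_trans; [apply Rle_abs|]. rewrite Rabs_mult. apply Rmult_le_compat_l; auto. apply Rabs_pos. }
      assert (H1 : (1 + 2 * Om) * Rabs v <= (1 + 2 * Om) * (V0 + C5 + INR N * ell)) by (apply Rmult_le_compat_l; lra).
      assert (H2 : (1 + 2 * Om) * (V0 + C5 + INR N * ell) <= Cst * (1 + ell)).
      { unfold Cst. rewrite Rmult_assoc. apply Rmult_le_compat; [lra|lra|lra|]. nra. }
      lra.
    - assert (Hw3 : / 2 <= green_zeta_lap delta z).
      { unfold green_zeta_lap. assert ((r ^ 2 + delta) * delta * / (nrm2 z + delta) ^ 2 <= / 2); [|lra].
        assert (q0 ^ 2 <= (nrm2 z + delta) ^ 2) by (apply pow_incr; lra).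
        apply (Rmult_le_reg_r ((nrm2 z + delta) ^ 2)); [lra|].
        rewrite Rmult_assoc, Rinv_l, Rmult_1_r by lra. lra. }
      assert (Hc3 : 3 * V0 <= Cst * (1 + ell)).
      { apply Rle_trans with (Cst * 1); [|apply Rmult_le_compat_l; lra]. unfold Cst. nra. }
      unfold Rabs. destruct (Rcase_abs v).
      + assert (v * green_zeta_lap delta z <= v * / 2); [|nra]. nra.
      + assert (v * green_zeta_lap delta z <= V0 * 1); [|lra]. apply Rmult_le_compat; lra. }
  assert (Hcv : cont_cdisc r (ct_v L)) by (intros z Hz; exact (proj1 (proj2 (proj2 (proj2 (ct_contC L z (cdisc_odisc r rho z Hr Hz))))))).
  assert (Hcj : cont_cdisc r (green_zeta_lap delta)).
  { intros z Hz. destruct (dC1_green_zeta_b delta Hdelta) as [q Hq].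
    exact (proj1 (proj1 (proj2 (proj2 (Hq z (cdisc_odisc r rho z Hr Hz)))))). }
  assert (Hcl : cont_cdisc r (fun z => ln (nrm2 z + e1))).
  { intros z _. apply continuous_Rln; [|now apply nrm2_shift_pos].
    apply continuous_Rplus; [apply continuous_nrm2_id|apply continuous_const]. }
  assert (Hcc : forall k : R, cont_cdisc r (fun _ => k)) by (intros k z _; apply continuous_const).
  assert (Hcp : cont_cdisc r (fun z => ct_v L z * green_zeta_lap delta z)) by (intros z Hz; apply continuous_Rmult; auto).
  assert (Hscal : forall k (f : C -> R), cont_cdisc r f -> cont_cdisc r (fun z => k * f z))
    by (intros k f Hf z Hz; apply continuous_Rmult; [apply continuous_const|auto]).
  assert (Hplus : forall f g : C -> R, cont_cdisc r f -> cont_cdisc r g -> cont_cdisc r (fun z => f z + g z))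
    by (intros f g Hf Hg z Hz; apply continuous_Rplus; auto).
  eapply Rle_trans.
  - apply (dint_le r (proj1 Hr) _ (fun z => -2 * (ct_v L z * green_zeta_lap delta z) + Cst * (1 + lmax + - 1 * ln (nrm2 z + e1)))).
    + intros z Hz. apply continuous_Rabs'. now apply Hcv.
    + apply (Hplus (fun z => -2 * (ct_v L z * green_zeta_lap delta z)) (fun z => Cst * (1 + lmax + - 1 * ln (nrm2 z + e1)))).
      * now apply (Hscal (-2) (fun z => ct_v L z * green_zeta_lap delta z)).
      * apply (Hscal Cst (fun z => 1 + lmax + - 1 * ln (nrm2 z + e1))).
        apply (Hplus (fun _ => 1 + lmax) (fun z => - 1 * ln (nrm2 z + e1))); [apply Hcc|].
        now apply (Hscal (-1) (fun z => ln (nrm2 z + e1))).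
    + exact Hpt.
  - assert (Hc1 : cont_cdisc r (fun z => 1 + lmax + - 1 * ln (nrm2 z + e1)))
      by (apply (Hplus (fun _ => 1 + lmax) (fun z => - 1 * ln (nrm2 z + e1))); [apply Hcc|];
          now apply (Hscal (-1) (fun z => ln (nrm2 z + e1)))).
    assert (Hc2 : cont_cdisc r (fun z => - 1 * ln (nrm2 z + e1)))
      by now apply (Hscal (-1) (fun z => ln (nrm2 z + e1))).
    assert (Hc3 : cont_cdisc r (fun z => -2 * (ct_v L z * green_zeta_lap delta z)))
      by now apply (Hscal (-2) (fun z => ct_v L z * green_zeta_lap delta z)).
    assert (Hc4 : cont_cdisc r (fun z => Cst * (1 + lmax + - 1 * ln (nrm2 z + e1))))
      by now apply (Hscal Cst (fun z => 1 + lmax + - 1 * ln (nrm2 z + e1))).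
    rewrite (dint_plus r (proj1 Hr) (fun z => -2 * (ct_v L z * green_zeta_lap delta z))
              (fun z => Cst * (1 + lmax + - 1 * ln (nrm2 z + e1)))) by auto.
    rewrite (dint_scal r (proj1 Hr) (-2)), (dint_scal r (proj1 Hr) Cst) by auto.
    rewrite (dint_plus r (proj1 Hr) (fun _ => 1 + lmax) (fun z => - 1 * ln (nrm2 z + e1))) by auto.
    rewrite (dint_scal r (proj1 Hr) (-1)) by auto.
    rewrite (dint_ext r (fun _ => 1 + lmax) (fun _ => (1 + lmax) * 1)) by (try lra; intros; ring).
    rewrite (dint_scal r (proj1 Hr) (1 + lmax) (fun _ => 1)) by auto.
    pose proof (jensen_nonneg delta Hdelta L) as Hj. pose proof (dint_ln_lower e1 He1) as Hl. fold A1 in Hl |- *.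
    assert (Cst * ((1 + lmax) * A1 + -1 * dint r (fun z => ln (nrm2 z + e1)))
            <= Cst * ((1 + lmax) * A1 - (ln (r ^ 2) - 1) * A1)) by (apply Rmult_le_compat_l; lra).
    lra.
Qed.

Variables (tau : C -> R) (tz tb tbz tbb : C -> C).
Hypothesis Htau : dC1 rho (fun z => RtoC (tau z)) tz tb.
Hypothesis Htb : dC1 rho tb tbz tbb.
Hypothesis Htau0 : forall z, nrm2 z = r ^ 2 -> tau z = 0.

Lemma cdisc_contC_bounded (k : C -> R) : (forall z, odisc rho z -> continuous k z) ->
  exists M, 0 <= M /\ forall z, cdisc r z -> Rabs (k z) <= M.
Proof.
  intros H. apply (cont_cdisc_bounded r (proj1 Hr)). intros z Hz. apply H. now apply cdisc_odisc with r.
Qed.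

Lemma tau_contC z : odisc rho z -> continuous tau z /\ contC tz z /\ contC tb z /\ contC tbz z.
Proof.
  intros Hz. destruct (Htau z Hz) as (_ & [H1 _] & H2 & H3). destruct (Htb z Hz) as (_ & _ & H4 & _).
  exact (conj H1 (conj H2 (conj H3 H4))).
Qed.

Lemma ct_vz_conj L z : ct_vb L z = Cconj (ct_vz L z).
Proof. unfold ct_vb, ct_vz. rewrite !Cmult_conj, Cconj_conj, Cconj_RtoC. f_equal. ring. Qed.

(** For Y = v^2 / 2 + L v the mixed derivative is |v_z|^2 + (v + L) v_zzbar, at least |v_z|^2
    because v >= - L. Green's identity against tau^2, which vanishes on the circle together with its
    gradient, leaves the integral of Y (tau^2)_zzbar, and |Y| is at most (V0 + 1) L |v|. *)
Lemma dint_energy_v : exists C1, 0 <= C1 /\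
  forall L, 1 <= L -> dint r (fun z => tau z ^ 2 * nrm2 (ct_vz L z)) <= C1 * L.
Proof.
  destruct ct_v_upper as (V0 & HV0 & HV). destruct dint_abs_v_bound as (C0 & HC0 & Habs).
  pose (zbz := fun z => (2 * (tz z * tb z + RtoC (tau z) * tbz z))%C).
  assert (Hz : dC1 rho (fun z => RtoC (tau z ^ 2)) (fun z => 2 * (RtoC (tau z) * tz z))%C
                  (fun z => 2 * (RtoC (tau z) * tb z))%C).
  { apply dC1_eq with (F := fun z => (RtoC (tau z) * RtoC (tau z))%C)
      (p := fun z => (2 * (RtoC (tau z) * tz z))%C) (q := fun z => (2 * (RtoC (tau z) * tb z))%C); auto.
    - eapply dC1_eq_deriv; [repeat dC1_step|intros; cbv beta; ring..].
    - intros z. rewrite <- RtoC_mult. f_equal. ring. }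
  assert (Hzb : exists q, dC1 rho (fun z => 2 * (RtoC (tau z) * tb z))%C zbz q).
  { eexists. eapply dC1_eq_deriv; [repeat dC1_step| |reflexivity]. intros; unfold zbz; cbv beta; ring. }
  destruct Hzb as [q Hzb].
  destruct (cdisc_contC_bounded (fun z => fst (zbz z))) as (B & HB & HBz).
  { intros z Hzo. exact (proj1 (proj1 (proj2 (proj2 (Hzb z Hzo))))). }
  exists (B * (V0 + 1) * C0). split; [repeat apply Rmult_le_pos; lra|]. intros L HL.
  pose (Y := fun z => ct_v L z ^ 2 / 2 + L * ct_v L z).
  destruct (dC1_vb L) as [q' Hvb]. pose proof (dC1_v L) as Hv.
  assert (HY : dC1 rho (fun z => RtoC (Y z)) (fun z => (RtoC (ct_v L z) + RtoC L) * ct_vz L z)%C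
                  (fun z => (RtoC (ct_v L z) + RtoC L) * ct_vb L z)%C).
  { apply dC1_eq with (F := fun z => (RtoC (ct_v L z) * RtoC (ct_v L z) * / 2 + RtoC L * RtoC (ct_v L z))%C)
      (p := fun z => ((RtoC (ct_v L z) + RtoC L) * ct_vz L z)%C)
      (q := fun z => ((RtoC (ct_v L z) + RtoC L) * ct_vb L z)%C); auto.
    - eapply dC1_eq_deriv; [repeat dC1_step|intros; cbv beta; field..].
    - intros z. unfold Y. rewrite RtoC_plus, RtoC_div, RtoC_mult, RtoC_pow by lra. simpl. field. }
  assert (HYb : exists q, dC1 rho (fun z => (RtoC (ct_v L z) + RtoC L) * ct_vb L z)%C
      (fun z => RtoC (nrm2 (ct_vz L z) + (ct_v L z + L) * ct_lap L z)) q).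
  { eexists. eapply dC1_eq_deriv; [repeat dC1_step| |reflexivity].
    intros; cbv beta. rewrite RtoC_plus, nrm2_conj, RtoC_mult, RtoC_plus, ct_vz_conj. ring. }
  destruct HYb as [q'' HYb].
  pose proof (dint_green rho r (fun z => tau z ^ 2) Y _ _ _ _ _ _ _ _ Hr Hz Hzb HY HYb) as HG.
  cbn [fst RtoC] in HG.
  assert (Hc : forall k : C -> R, (forall z, odisc rho z -> continuous k z) -> cont_cdisc r k)
    by (intros k Hk z Hzd; apply Hk; now apply cdisc_odisc with r).
  assert (Hctau : forall z, odisc rho z -> continuous (fun z => tau z ^ 2) z)
    by (intros z Hzo; apply continuous_Rpow; exact (proj1 (tau_contC z Hzo))).
  assert (Hcvz : forall z, odisc rho z -> continuous (fun z => nrm2 (ct_vz L z)) z)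
    by (intros z Hzo; apply continuous_nrm2; exact (proj1 (proj2 (proj2 (proj2 (proj2 (ct_contC L z Hzo))))))).
  assert (Hcv : forall z, odisc rho z -> continuous (ct_v L) z)
    by (intros z Hzo; exact (proj1 (proj2 (proj2 (proj2 (ct_contC L z Hzo)))))).
  assert (Hclap : forall z, odisc rho z -> continuous (ct_lap L) z)
    by (intros z Hzo; exact (proj2 (proj2 (proj2 (proj2 (proj2 (proj2 (ct_contC L z Hzo)))))))).
  eapply Rle_trans; [|eapply Rle_trans; [right; apply HG|]].
  - apply dint_le; [lra| | |].
    + apply Hc. intros z Hzo. apply continuous_Rmult; auto.
    + apply Hc. intros z Hzo. apply continuous_Rmult; auto. apply continuous_Rplus; auto.
      apply continuous_Rmult; auto. apply continuous_Rplus; auto. apply continuous_const.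
    + intros z Hzd. apply Rmult_le_compat_l; [apply pow2_ge_0|].
      assert (0 <= (ct_v L z + L) * ct_lap L z); [|lra].
      pose proof (ct_v_lower L z). apply Rmult_le_pos; [lra|]. unfold ct_lap.
      pose proof (ct_s_pos L z). pose proof (exp_pos (- L)). pose proof (nrm2_pos (Fd z)).
      apply Rmult_le_pos; [nra|]. left. apply Rinv_0_lt_compat. nra.
  - intros z Hzr. rewrite Htau0 by auto. split; [ring|]. ring.
  - apply Rle_trans with (dint r (fun z => (B * (V0 + 1) * L) * Rabs (ct_v L z))).
    + apply dint_le; [lra| | |].
      * apply Hc. intros z Hzo. apply continuous_Rmult.
        -- unfold Y. apply continuous_Rplus; [apply continuous_Rdiv|apply continuous_Rmult]; auto;
             try apply continuous_const; try lra. apply continuous_Rpow; auto.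
        -- exact (proj1 (proj1 (proj2 (proj2 (Hzb z Hzo))))).
      * apply Hc. intros z Hzo. apply continuous_Rmult; [apply continuous_const|]. apply continuous_Rabs'; auto.
      * intros z Hzd. generalize (HBz z Hzd) (HV L z ltac:(lra) Hzd) (ct_v_lower L z). intros H1 H2 H3.
        eapply Rle_trans; [apply Rle_abs|]. rewrite Rabs_mult.
        unfold Y. replace (ct_v L z ^ 2 / 2 + L * ct_v L z) with (ct_v L z * (ct_v L z / 2 + L)) by field.
        rewrite Rabs_mult.
        assert (H4 : Rabs (ct_v L z / 2 + L) <= (V0 + 1) * L) by (apply Rabs_le; nra).
        replace (B * (V0 + 1) * L * Rabs (ct_v L z)) with (Rabs (ct_v L z) * ((V0 + 1) * L) * B) by ring.
        apply Rmult_le_compat; auto; [apply Rmult_le_pos; apply Rabs_pos|apply Rabs_pos|].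
        apply Rmult_le_compat_l; auto. apply Rabs_pos.
    + rewrite (dint_scal r (proj1 Hr)).
      * generalize (Habs L HL). intros H.
        replace (B * (V0 + 1) * C0 * L) with (B * (V0 + 1) * L * C0) by ring.
        apply Rmult_le_compat_l; auto. repeat apply Rmult_le_pos; lra.
      * apply Hc. intros z Hzo. apply continuous_Rabs'; auto.
Qed.

(** * The cutoff and the passage to the limit *)

Definition chi (L : R) (z : C) : R := nrm2 (F z) * / ct_s L z * (1 + ct_v L z / L).
Definition chi_z (L : R) (z : C) : C :=
  (RtoC ((exp (- L) * / ct_s L z * (L + ct_v L z) + nrm2 (F z) * / ct_s L z) / L) * ct_vz L z)%C.

Lemma exp_s_ratio L z : 0 < exp (- L) * / ct_s L z <= 1 /\
  exp (- L) * / ct_s L z = exp (- (L + ct_v L z)) /\ nrm2 (F z) * / ct_s L z = 1 - exp (- L) * / ct_s L z.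
Proof.
  pose proof (ct_s_pos L z) as Hs. pose proof (exp_pos (- L)). pose proof (nrm2_pos (F z)).
  assert (0 < / ct_s L z) by now apply Rinv_0_lt_compat.
  split; [split|split].
  - nra.
  - apply (Rmult_le_reg_r (ct_s L z)); auto. rewrite Rmult_assoc, Rinv_l by lra. unfold ct_s. lra.
  - replace (- (L + ct_v L z)) with (- L + - ct_v L z) by ring. rewrite exp_plus, (exp_Ropp (ct_v L z)).
    unfold ct_v. rewrite exp_ln; auto.
  - unfold ct_s in *. field. lra.
Qed.

(** With x = L + v >= 0 the ratio exp(- L) / s is exp(- x), and x exp(- x) <= 1. Both summands in
    the factor of [chi_z] are thus at most 1, whence (2 / L)^2. *)
Lemma chi_z_bound L z : 1 <= L -> nrm2 (chi_z L z) <= 4 / L ^ 2 * nrm2 (ct_vz L z).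
Proof.
  intros HL. unfold chi_z. rewrite nrm2_mult. apply Rmult_le_compat_r; [apply nrm2_pos|].
  destruct (exp_s_ratio L z) as ([H1 H2] & H3 & H4). rewrite H4.
  pose proof (ct_v_lower L z) as Hv.
  assert (H5 : exp (- L) * / ct_s L z * (L + ct_v L z) <= 1).
  { rewrite H3. generalize (exp_ineq1_le (L + ct_v L z)). intros H.
    rewrite exp_Ropp. pose proof (exp_pos (L + ct_v L z)).
    apply (Rmult_le_reg_l (exp (L + ct_v L z))); auto. rewrite <- Rmult_assoc, Rinv_r by lra. lra. }
  assert (H6 : 0 <= exp (- L) * / ct_s L z * (L + ct_v L z)) by (apply Rmult_le_pos; lra).
  set (x := exp (- L) * / ct_s L z * (L + ct_v L z)) in *. set (y := exp (- L) * / ct_s L z) in *.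
  unfold nrm2; cbn [fst snd RtoC].
  replace (((x + (1 - y)) / L) ^ 2 + 0 ^ 2) with ((x + (1 - y)) ^ 2 / L ^ 2) by (field; lra).
  unfold Rdiv. apply Rmult_le_compat_r; [left; apply Rinv_0_lt_compat; nra|]. nra.
Qed.

Lemma chi_bound V0 L z : 0 <= V0 -> 1 <= L -> ct_v L z <= V0 ->
  0 <= chi L z <= 1 + V0 /\ Rabs (1 - chi L z) <= (1 + 2 * Rabs (ct_v L z)) / L.
Proof.
  intros HV0 HL HV. unfold chi. destruct (exp_s_ratio L z) as ([H1 H2] & H3 & H4). rewrite H4.
  pose proof (ct_v_lower L z) as Hv.
  set (y := exp (- L) * / ct_s L z) in *. set (v := ct_v L z) in *.
  assert (HvL : 0 <= 1 + v / L <= 1 + V0).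
  { split.
    - apply (Rmult_le_reg_r L); [lra|]. replace ((1 + v / L) * L) with (L + v) by (field; lra). lra.
    - apply Rplus_le_compat_l. apply (Rmult_le_reg_r L); [lra|]. replace (v / L * L) with v by (field; lra). nra. }
  split; [nra|].
  (* exp(- x) <= 1 / (1 + x) with x = L + v, and L <= (1 + |v|) (1 + L + v). *)
  assert (Hy : y <= (1 + Rabs v) / L).
  { rewrite H3, exp_Ropp. generalize (exp_ineq1_le (L + v)). intros H.
    apply Rle_trans with (/ (1 + (L + v))); [apply Rinv_le_contravar; lra|].
    apply (Rmult_le_reg_r (1 + (L + v))); [lra|]. rewrite Rinv_l by lra.
    apply (Rmult_le_reg_r L); [lra|].
    replace ((1 + Rabs v) / L * (1 + (L + v)) * L) with ((1 + Rabs v) * (1 + (L + v))) by (field; lra).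
    unfold Rabs. destruct (Rcase_abs v); nra. }
  replace (1 - (1 - y) * (1 + v / L)) with (y + - ((1 - y) * (v / L))) by ring.
  eapply Rle_trans; [apply Rabs_triang|].
  rewrite Rabs_Ropp, (Rabs_pos_eq y), Rabs_mult, (Rabs_pos_eq (1 - y)) by lra.
  assert (Rabs (v / L) = Rabs v / L) by (unfold Rdiv; rewrite Rabs_mult, (Rabs_pos_eq (/ L)); auto; left; apply Rinv_0_lt_compat; lra).
  rewrite H. pose proof (Rabs_pos v). assert (0 <= Rabs v / L) by (rewrite <- H; apply Rabs_pos).
  replace ((1 + 2 * Rabs v) / L) with ((1 + Rabs v) / L + Rabs v / L) by (field; lra). nra.
Qed.

Lemma dC1_chi L : 1 <= L -> exists q, dC1 rho (fun z => RtoC (chi L z)) (chi_z L) q.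
Proof.
  intros HL. pose proof (holo_conj _ _ _ HF) as HF'. pose proof (dC1_is L) as Hi. pose proof (dC1_v L) as Hv.
  assert (HL0 : RtoC L <> RtoC 0) by (intros E; apply RtoC_inj in E; lra).
  assert (H : exists q, dC1 rho (fun z => F z * Cconj (F z) * RtoC (/ ct_s L z) * (1 + RtoC (ct_v L z) * / RtoC L))%C (chi_z L) q).
  { unfold holo in HF. eexists. eapply dC1_eq_deriv; [repeat dC1_step| |reflexivity].
    intros z _. cbv beta. unfold chi_z, ct_vz. pose proof (ct_s_pos L z) as Hs.
    assert (E : RtoC (ct_s L z) = (F z * Cconj (F z) + RtoC (exp (- L)))%C)
      by (unfold ct_s; rewrite RtoC_plus; now rewrite nrm2_conj).
    assert (Hs0 : RtoC (ct_s L z) <> RtoC 0) by (intros H; apply RtoC_inj in H; lra).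
    rewrite RtoC_div, RtoC_plus, !RtoC_mult, RtoC_plus, nrm2_conj, RtoC_opp, !RtoC_inv, RtoC_pow
      by (try apply pow_nonzero; lra).
    replace (RtoC (exp (- L))) with (RtoC (ct_s L z) - F z * Cconj (F z))%C by (rewrite E; ring).
    field. auto. }
  destruct H as [q H]. exists q. apply (dC1_eq _ _ _ _ _ _ _ H); auto.
  intros z. unfold chi. unfold Rdiv. rewrite !RtoC_mult, RtoC_plus, RtoC_mult, nrm2_conj, (RtoC_inv L) by lra. reflexivity.
Qed.

Lemma sum_sqr_weighted (x y : C) (t : R) : 0 < t -> nrm2 (x + y) <= (1 + t) * nrm2 y + (1 + / t) * nrm2 x.
Proof.
  intros Ht. assert (H : forall p q : R, 2 * p * q <= t * q ^ 2 + / t * p ^ 2).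
  { intros p q. apply (Rmult_le_reg_l t); auto.
    replace (t * (t * q ^ 2 + / t * p ^ 2)) with ((t * q) ^ 2 + p ^ 2) by (field; lra).
    pose proof (pow2_ge_0 (t * q - p)). lra. }
  unfold nrm2; simpl fst; simpl snd. generalize (H (fst x) (fst y)) (H (snd x) (snd y)). lra.
Qed.

(** In kappa_z = chi_z tau + chi tau_z the second summand gives chi^2 times the integrand for tau,
    up to a factor 1 + t; the first costs (1 + 1/t) times the energy of chi. The error 1 - chi^2 is
    controlled in L^1 by the bound on |v| divided by L. *)
Lemma cutoff_limit (U J : C -> R) :
  (forall z, odisc rho z -> continuous U z) -> (forall z, odisc rho z -> continuous J z) ->
  forall eta, 0 < eta -> exists L, 1 <= L /\
    dint r (fun z => U z ^ 2 * nrm2 (chi_z L z * RtoC (tau z) + RtoC (chi L z) * tz z)%C + (chi L z * tau z) ^ 2 * J z)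
    <= dint r (fun z => U z ^ 2 * nrm2 (tz z) + tau z ^ 2 * J z) + eta.
Proof.
  intros HU HJ eta Heta.
  destruct ct_v_upper as (V0 & HV0 & HV). destruct dint_abs_v_bound as (C0 & HC0 & Habs).
  destruct dint_energy_v as (C1 & HC1 & Hen).
  assert (HcUt : forall z, odisc rho z -> continuous (fun z => U z ^ 2 * nrm2 (tz z)) z).
  { intros z Hz. apply continuous_Rmult; [apply continuous_Rpow; auto|].
    apply continuous_nrm2. exact (proj1 (proj2 (tau_contC z Hz))). }
  assert (HctJ : forall z, odisc rho z -> continuous (fun z => tau z ^ 2 * J z) z).
  { intros z Hz. apply continuous_Rmult; auto. apply continuous_Rpow. exact (proj1 (tau_contC z Hz)). }
  assert (HcQ : forall z, odisc rho z -> continuous (fun z => U z ^ 2 * nrm2 (tz z) + tau z ^ 2 * J z) z)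
    by (intros z Hz; apply continuous_Rplus; auto).
  destruct (cdisc_contC_bounded _ HcQ) as (B0 & HB0 & HBQ).
  destruct (cdisc_contC_bounded _ HcUt) as (B1 & HB1 & HBUt).
  destruct (cdisc_contC_bounded (fun z => U z ^ 2)) as (B2 & HB2 & HBU).
  { intros z Hz. apply continuous_Rpow; auto. }
  pose (A1 := dint r (fun _ => 1)).
  assert (HA1 : 0 < A1) by (apply dint_one_pos; lra).
  pose (X := 1 + V0).
  pose (K1 := X ^ 2 * B1 * A1).
  assert (HK1 : 0 <= K1) by (unfold K1, X; repeat apply Rmult_le_pos; try apply pow2_ge_0; lra).
  (* t is fixed first and spends eta / 2. [K2] depends on t through 1 + 1/t, and L is then taken so
     large that K2 / L spends the other half. *)
  pose (t := eta / (2 * (K1 + 1))).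
  assert (Ht : 0 < t) by (apply Rdiv_lt_0_compat; lra).
  assert (Hit : 0 < / t) by now apply Rinv_0_lt_compat.
  assert (HtK : t * K1 <= eta / 2).
  { unfold t. apply (Rmult_le_reg_r (2 * (K1 + 1))); [lra|].
    replace (eta / (2 * (K1 + 1)) * K1 * (2 * (K1 + 1))) with (eta * K1) by (field; lra). nra. }
  pose (K2 := (X + 1) * B0 * (A1 + 2 * C0) + (1 + / t) * B2 * 4 * C1).
  assert (HK2 : 0 <= K2).
  { unfold K2, X. apply Rplus_le_le_0_compat; repeat apply Rmult_le_pos; lra. }
  exists (1 + 2 * K2 / eta).
  assert (HKe : 0 <= 2 * K2 / eta) by (apply Rmult_le_pos; [lra|left; now apply Rinv_0_lt_compat]).
  set (L := 1 + 2 * K2 / eta). assert (HL : 1 <= L) by (unfold L; lra).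
  split; auto.
  assert (HK2L : K2 / L <= eta / 2).
  { apply (Rmult_le_reg_r L); [lra|]. replace (K2 / L * L) with K2 by (field; lra).
    unfold L. replace (eta / 2 * (1 + 2 * K2 / eta)) with (eta / 2 + K2) by (field; lra). lra. }
  destruct (dC1_chi L HL) as [qc Hchi].
  assert (Hc : forall k : C -> R, (forall z, odisc rho z -> continuous k z) -> cont_cdisc r k)
    by (intros k Hk z Hzd; apply Hk; now apply cdisc_odisc with r).
  assert (Hcvz : forall z, odisc rho z -> continuous (fun z => nrm2 (ct_vz L z)) z)
    by (intros z Hzo; apply continuous_nrm2; exact (proj1 (proj2 (proj2 (proj2 (proj2 (ct_contC L z Hzo))))))).
  assert (Hcv : forall z, odisc rho z -> continuous (fun z => Rabs (ct_v L z)) z)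
    by (intros z Hzo; apply continuous_Rabs'; exact (proj1 (proj2 (proj2 (proj2 (ct_contC L z Hzo)))))).
  assert (Hctv : forall z, odisc rho z -> continuous (fun z => tau z ^ 2 * nrm2 (ct_vz L z)) z)
    by (intros z Hz; apply continuous_Rmult; auto; apply continuous_Rpow; exact (proj1 (tau_contC z Hz))).
  (* [k3] multiplies an energy of order L but is itself of order 1 / L^2, so that all errors except
     the t-term of [k1] are O(1 / L). *)
  pose (k1 := t * X ^ 2 * B1 + (X + 1) * B0 / L).
  pose (k2 := (X + 1) * B0 * 2 / L). pose (k3 := (1 + / t) * B2 * (4 / L ^ 2)).
  assert (Hpt : forall z, cdisc r z ->
    U z ^ 2 * nrm2 (chi_z L z * RtoC (tau z) + RtoC (chi L z) * tz z)%C + (chi L z * tau z) ^ 2 * J z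
    <= (U z ^ 2 * nrm2 (tz z) + tau z ^ 2 * J z) + (k1 * 1 + (k2 * Rabs (ct_v L z) + k3 * (tau z ^ 2 * nrm2 (ct_vz L z))))).
  { intros z Hz. destruct (chi_bound V0 L z HV0 HL (HV L z ltac:(lra) Hz)) as [[Hx0 Hx1] Hx2].
    fold X in Hx1.
    generalize (sum_sqr_weighted (chi_z L z * RtoC (tau z))%C (RtoC (chi L z) * tz z)%C t Ht).
    rewrite !nrm2_mult. assert (Hreal : forall x, nrm2 (RtoC x) = x ^ 2) by (intros x; unfold nrm2; simpl; ring).
    rewrite !Hreal. intros Hs. generalize (chi_z_bound L z HL). intros Hcz.
    pose proof (nrm2_pos (tz z)) as Hn1. pose proof (nrm2_pos (ct_vz L z)) as Hn2.
    pose proof (nrm2_pos (chi_z L z)) as Hn3.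
    pose proof (pow2_ge_0 (U z)) as HU2. pose proof (pow2_ge_0 (tau z)) as Ht2.
    generalize (HBQ z Hz) (HBUt z Hz) (HBU z Hz). cbv beta. intros HQ HUt HUU.
    apply Rabs_le_between in HUt, HUU.
    set (Q := U z ^ 2 * nrm2 (tz z) + tau z ^ 2 * J z) in *.
    set (x := chi L z) in *.
    assert (Hx2' : x ^ 2 <= X ^ 2) by (apply pow_incr; lra).
    assert (E1 : U z ^ 2 * nrm2 (chi_z L z * RtoC (tau z) + RtoC x * tz z)%C
       <= U z ^ 2 * ((1 + t) * (x ^ 2 * nrm2 (tz z)) + (1 + / t) * (nrm2 (chi_z L z) * tau z ^ 2))).
    { apply Rmult_le_compat_l; auto. }
    assert (E2 : x ^ 2 * Q - Q <= (X + 1) * B0 * ((1 + 2 * Rabs (ct_v L z)) / L)).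
    { replace (x ^ 2 * Q - Q) with (- ((1 - x) * ((1 + x) * Q))) by ring.
      eapply Rle_trans; [apply Rle_abs|]. rewrite Rabs_Ropp, !Rabs_mult, (Rabs_pos_eq (1 + x)) by lra.
      rewrite Rmult_comm. apply Rmult_le_compat; auto; [|apply Rabs_pos|].
      - apply Rmult_le_pos; [lra|apply Rabs_pos].
      - apply Rmult_le_compat; auto; [lra|apply Rabs_pos|lra]. }
    assert (E3 : t * (x ^ 2 * (U z ^ 2 * nrm2 (tz z))) <= t * (X ^ 2 * B1)).
    { apply Rmult_le_compat_l; [lra|]. apply Rmult_le_compat; auto; [apply pow2_ge_0| |lra].
      apply Rmult_le_pos; auto. }
    assert (E4 : (1 + / t) * (U z ^ 2 * (nrm2 (chi_z L z) * tau z ^ 2)) <= (1 + / t) * (B2 * (4 / L ^ 2 * nrm2 (ct_vz L z) * tau z ^ 2))).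
    { apply Rmult_le_compat_l; [lra|]. apply Rmult_le_compat; auto; [apply Rmult_le_pos; auto|lra|].
      apply Rmult_le_compat_r; auto. }
    unfold k1, k2, k3.
    replace ((X + 1) * B0 * ((1 + 2 * Rabs (ct_v L z)) / L)) with ((X + 1) * B0 / L + (X + 1) * B0 * 2 / L * Rabs (ct_v L z)) in E2 by (field; lra).
    assert (E5 : x ^ 2 * Q = x ^ 2 * (U z ^ 2 * nrm2 (tz z)) + x ^ 2 * (tau z ^ 2 * J z)) by (unfold Q; ring).
    replace ((x * tau z) ^ 2 * J z) with (x ^ 2 * (tau z ^ 2 * J z)) by ring.
    lra. }
  assert (Hcs : forall k (f : C -> R), (forall z, odisc rho z -> continuous f z) -> cont_cdisc r (fun z => k * f z)).
  { intros k f Hf. apply Hc. intros z Hz. apply continuous_Rmult; [apply continuous_const|auto]. }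
  assert (Hcp : forall f g : C -> R, cont_cdisc r f -> cont_cdisc r g -> cont_cdisc r (fun z => f z + g z))
    by (intros f g Hf Hg z Hz; apply continuous_Rplus; auto).
  assert (Hone : forall z, odisc rho z -> continuous (fun _ : C => 1) z) by (intros; apply continuous_const).
  assert (P1 := Hcs k1 _ Hone). assert (P2 := Hcs k2 _ Hcv). assert (P3 := Hcs k3 _ Hctv).
  assert (P4 := Hcp _ _ P2 P3). assert (P5 := Hcp _ _ P1 P4). assert (P6 := Hc _ HcQ).
  assert (Hlhs : forall z, odisc rho z -> continuous (fun z =>
     U z ^ 2 * nrm2 (chi_z L z * RtoC (tau z) + RtoC (chi L z) * tz z)%C + (chi L z * tau z) ^ 2 * J z) z).
  {intros z Hz. destruct (Hchi z Hz) as (_ & [Hk1 _] & Hk2 & _).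
    destruct (tau_contC z Hz) as (Hk3 & Hk4 & _).
    apply continuous_Rplus; apply continuous_Rmult; auto.
    - apply continuous_Rpow; auto.
    - apply (continuous_nrm2 (fun z => chi_z L z * RtoC (tau z) + RtoC (chi L z) * tz z)%C).
      apply contC_plus; apply contC_mult; auto; now apply contC_RtoC.
    - apply continuous_Rpow. now apply continuous_Rmult. }
  eapply Rle_trans; [apply (dint_le r (proj1 Hr) _ _ (Hc _ Hlhs) (Hcp _ _ P6 P5) Hpt)|].
  rewrite (dint_plus r (proj1 Hr) _ _ P6 P5), (dint_plus r (proj1 Hr) _ _ P1 P4), (dint_plus r (proj1 Hr) _ _ P2 P3).
  rewrite (dint_scal r (proj1 Hr) k1 (fun _ => 1) (Hc _ Hone)), (dint_scal r (proj1 Hr) k2 _ (Hc _ Hcv)),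
    (dint_scal r (proj1 Hr) k3 _ (Hc _ Hctv)). fold A1.
  - assert (F1 : k2 * dint r (fun z => Rabs (ct_v L z)) <= k2 * C0).
    { apply Rmult_le_compat_l; [|now apply Habs]. unfold k2, X. apply Rmult_le_pos; [repeat apply Rmult_le_pos; lra|].
      left; apply Rinv_0_lt_compat; lra. }
    assert (F2 : k3 * dint r (fun z => tau z ^ 2 * nrm2 (ct_vz L z)) <= k3 * (C1 * L)).
    { apply Rmult_le_compat_l; [|now apply Hen]. unfold k3. apply Rmult_le_pos; [repeat apply Rmult_le_pos; lra|].
      apply Rmult_le_pos; [lra|]. left; apply Rinv_0_lt_compat, pow_lt; lra. }
    assert (F3 : k1 * A1 + k2 * C0 + k3 * (C1 * L) = t * K1 + K2 / L).
    { unfold k1, k2, k3, K1, K2. field. lra. }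
    change (dint r (fun z : C => U z ^ 2 * nrm2 (tz z) + tau z ^ 2 * J z)
      + (k1 * A1 + (k2 * dint r (fun z : C => Rabs (ct_v L z))
                    + k3 * dint r (fun z : C => tau z ^ 2 * nrm2 (ct_vz L z))))
      <= dint r (fun z : C => U z ^ 2 * nrm2 (tz z) + tau z ^ 2 * J z) + eta).
    lra.
Qed.

End Cutoff.

(** * Differentiating the area *)

Lemma taylor2_of_bound (k k1 k2 : R -> R) (eps B : R) :
  (forall t, Rabs t < eps -> is_derive k t (k1 t)) ->
  (forall t, Rabs t < eps -> is_derive k1 t (k2 t)) ->
  (forall t, Rabs t < eps -> Rabs (k2 t) <= B) ->
  forall t t0, Rabs t < eps -> Rabs t0 < eps -> Rabs (k t - k t0 - (t - t0) * k1 t0) <= B * (t - t0) ^ 2.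
Proof.
  intros H1 H2 H3 t t0 Ht Ht0.
  apply Rabs_lt_between in Ht, Ht0.
  assert (HB : 0 <= B).
  { eapply Rle_trans; [apply Rabs_pos|apply (H3 t)]. apply Rabs_lt_between; lra. }
  assert (Hint : forall a b x, - eps < a < eps -> - eps < b < eps -> Rmin a b <= x <= Rmax a b -> Rabs x < eps).
  { intros a b x Ha Hb Hx. apply Rabs_lt_between.
    unfold Rmin, Rmax in Hx. destruct (Rle_dec a b); lra. }
  assert (Hcont : forall (g g' : R -> R) x, is_derive g x (g' x) -> continuity_pt g x).
  { intros g g' x Hg. apply continuity_pt_filterlim. apply (ex_derive_continuous (V := R_NormedModule)). now exists (g' x). }
  destruct (MVT_gen k t0 t k1) as (c & Hc & E).
  - intros x Hx. apply H1. apply (Hint t0 t); auto; lra.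
  - intros x Hx. apply (Hcont k k1), H1. now apply (Hint t0 t).
  - assert (Hce : Rabs c < eps) by now apply (Hint t0 t).
    destruct (MVT_gen k1 t0 c k2) as (c' & Hc' & E').
    + intros x Hx. apply H2. apply Rabs_lt_between in Hce. apply (Hint t0 c); auto; lra.
    + intros x Hx. apply Rabs_lt_between in Hce. apply (Hcont k1 k2), H2. now apply (Hint t0 c).
    + replace (k t - k t0 - (t - t0) * k1 t0) with ((t - t0) * (k1 c - k1 t0)) by (rewrite E; ring).
      rewrite E', !Rabs_mult.
      assert (Rabs (k2 c') <= B).
      { apply H3. apply Rabs_lt_between in Hce. now apply (Hint t0 c). }
      assert (Rabs (c - t0) <= Rabs (t - t0)).
      { unfold Rmin, Rmax in Hc. destruct (Rle_dec t0 t).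
        - rewrite !Rabs_pos_eq by lra. lra.
        - rewrite !Rabs_left1 by lra. lra. }
      rewrite <- (pow2_abs (t - t0)).
      replace (B * Rabs (t - t0) ^ 2) with (Rabs (t - t0) * (B * Rabs (t - t0))) by ring.
      apply Rmult_le_compat_l; [apply Rabs_pos|]. apply Rmult_le_compat; auto; apply Rabs_pos.
Qed.

(** A quadratic remainder uniform in z plays the part of dominated convergence: it is integrated
    over the disc and fed to [quad_diff_real]. *)
Lemma dint_derive (r eps B : R) (Phi Phi1 : R -> C -> R) (t0 : R) :
  0 < r -> Rabs t0 < eps ->
  (forall t, Rabs t < eps -> cont_cdisc r (Phi t)) -> cont_cdisc r (Phi1 t0) ->
  (forall t z, Rabs t < eps -> cdisc r z -> Rabs (Phi t z - Phi t0 z - (t - t0) * Phi1 t0 z) <= B * (t - t0) ^ 2) ->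
  is_derive (fun t => dint r (Phi t)) t0 (dint r (Phi1 t0)).
Proof.
  intros Hr Ht0 Hc Hc1 H.
  assert (HA : 0 < dint r (fun _ => 1)) by now apply dint_one_pos.
  apply quad_diff_real with (Rabs B * dint r (fun _ => 1)) (eps - Rabs t0).
  - apply Rmult_le_pos; [apply Rabs_pos|lra].
  - lra.
  - intros e He.
    assert (Hte : Rabs (t0 + e) < eps) by (eapply Rle_lt_trans; [apply Rabs_triang|lra]).
    assert (Hce : cont_cdisc r (fun z => e * Phi1 t0 z)) by (intros z Hz; apply continuous_Rmult; [apply continuous_const|auto]).
    assert (Hcd : cont_cdisc r (fun z => Phi (t0 + e) z - Phi t0 z))
      by (intros z Hz; apply continuous_Rminus; apply Hc; auto).
    rewrite <- (dint_scal r Hr e _ Hc1).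
    rewrite <- (dint_minus r Hr _ _ (Hc _ Hte) (Hc _ Ht0)).
    rewrite <- (dint_minus r Hr _ _ Hcd Hce).
    assert (Hb : forall z, cdisc r z -> Rabs (Phi (t0 + e) z - Phi t0 z - e * Phi1 t0 z) <= Rabs B * e ^ 2).
    { intros z Hz. generalize (H (t0 + e) z Hte Hz). replace (t0 + e - t0) with e by ring.
      intros Hq. eapply Rle_trans; [exact Hq|]. apply Rmult_le_compat_r; [apply pow2_ge_0|apply Rle_abs]. }
    assert (Hcs : cont_cdisc r (fun z => Phi (t0 + e) z - Phi t0 z - e * Phi1 t0 z))
      by (intros z Hz; apply continuous_Rminus; auto).
    assert (Hk : forall k : R, dint r (fun _ => k * 1) = k * dint r (fun _ => 1))
      by (intros k; apply (dint_scal r Hr k (fun _ => 1)); intros z _; apply continuous_const).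
    apply Rabs_le. split.
    + replace (- (Rabs B * dint r (fun _ => 1) * e ^ 2)) with (- (Rabs B * e ^ 2) * dint r (fun _ => 1)) by ring.
      rewrite <- Hk. apply dint_le; auto; [intros z _; apply continuous_const|].
      intros z Hz. generalize (Hb z Hz). intros Hq. apply Rabs_le_between in Hq. lra.
    + replace (Rabs B * dint r (fun _ => 1) * e ^ 2) with ((Rabs B * e ^ 2) * dint r (fun _ => 1)) by ring.
      rewrite <- Hk. apply dint_le; auto; [intros z _; apply continuous_const|].
      intros z Hz. generalize (Hb z Hz). intros Hq. apply Rabs_le_between in Hq. lra.
Qed.

Section SqrtQuartic.
Variables (r : R) (wgt c0 c1 c2 c3 c4 : C -> R).
Hypothesis Hr : 0 < r.
Hypothesis Hw : cont_cdisc r wgt.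
Hypothesis Hc0 : cont_cdisc r c0.
Hypothesis Hc1 : cont_cdisc r c1.
Hypothesis Hc2 : cont_cdisc r c2.
Hypothesis Hc3 : cont_cdisc r c3.
Hypothesis Hc4 : cont_cdisc r c4.
Hypothesis Hpos : forall z, cdisc r z -> 1 / 16 <= c0 z.

Definition quartic (t : R) (z : C) : R := c0 z + c1 z * t + c2 z * t ^ 2 + c3 z * t ^ 3 + c4 z * t ^ 4.
Definition quartic1 (t : R) (z : C) : R := c1 z + 2 * c2 z * t + 3 * c3 z * t ^ 2 + 4 * c4 z * t ^ 3.
Definition quartic2 (t : R) (z : C) : R := 2 * c2 z + 6 * c3 z * t + 12 * c4 z * t ^ 2.
Definition quartic3 (t : R) (z : C) : R := 6 * c3 z + 24 * c4 z * t.
(** [root1], [root2] and [root3] are the successive t-derivatives, obtained by differentiating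
    root0^2 = quartic. The third one bounds the remainder of [root1], hence gives the second
    derivative of the integral. *)
Definition root0 (t : R) (z : C) : R := sqrt (quartic t z).
Definition root1 (t : R) (z : C) : R := quartic1 t z / (2 * root0 t z).
Definition root2 (t : R) (z : C) : R := (quartic2 t z - 2 * root1 t z ^ 2) / (2 * root0 t z).
Definition root3 (t : R) (z : C) : R := (quartic3 t z - 6 * root1 t z * root2 t z) / (2 * root0 t z).

Lemma root_derivs (t : R) (z : C) : 0 < quartic t z ->
  is_derive (fun t => root0 t z) t (root1 t z) /\
  is_derive (fun t => root1 t z) t (root2 t z) /\
  is_derive (fun t => root2 t z) t (root3 t z).
Proof.
  intros Hp. assert (Hs : 0 < root0 t z) by now apply sqrt_lt_R0.
  assert (D0 : is_derive (fun t => quartic t z) t (quartic1 t z)).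
  { unfold quartic, quartic1. auto_derive; auto. ring. }
  assert (D1 : is_derive (fun t => quartic1 t z) t (quartic2 t z)).
  { unfold quartic1, quartic2. auto_derive; auto. ring. }
  assert (D2 : is_derive (fun t => quartic2 t z) t (quartic3 t z)).
  { unfold quartic2, quartic3. auto_derive; auto. ring. }
  assert (E0 : is_derive (fun t => root0 t z) t (root1 t z)).
  { unfold root0. eapply is_derive_eq.
    - apply (is_derive_sqrt (fun t => quartic t z) t (quartic1 t z)); auto.
    - unfold root1, root0. field. unfold root0 in Hs. lra. }
  assert (Hdiv : forall (a b : R -> R) da db, is_derive a t da -> is_derive b t db -> b t <> 0 ->
     is_derive (fun t => a t / (2 * b t)) t ((da - 2 * (a t / (2 * b t)) * db) / (2 * b t))).
  { intros a b da db Ha Hb Hb0.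
    assert (H2b : is_derive (fun t => 2 * b t) t (2 * db)) by apply (is_derive_scal b t 2 db Hb).
    assert (H2n : 2 * b t <> 0) by (intros E; apply Hb0; lra).
    apply is_derive_eq with ((da * (2 * b t) - a t * (2 * db)) / (2 * b t) ^ 2).
    - exact (is_derive_div a (fun t => 2 * b t) t da (2 * db) Ha H2b H2n).
    - field. exact Hb0. }
  assert (E1 : is_derive (fun t => root1 t z) t (root2 t z)).
  { unfold root1. eapply is_derive_eq.
    - apply (Hdiv (fun t => quartic1 t z) (fun t => root0 t z) _ _ D1 E0). lra.
    - unfold root2, root1. field. lra. }
  split; [auto|split; [auto|]].
  unfold root2. eapply is_derive_eq.
  - apply (Hdiv (fun t => quartic2 t z - 2 * root1 t z ^ 2) (fun t => root0 t z) (quartic3 t z - 4 * root1 t z * root2 t z) (root1 t z)); auto; [|lra].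
    apply is_derive_Rminus; auto. eapply is_derive_eq.
    + apply (is_derive_scal (fun t => root1 t z ^ 2) t 2). apply (is_derive_pow (fun t => root1 t z) 2 t _ E1).
    + simpl. ring.
  - unfold root3. unfold root2 at 1 2. field. lra.
Qed.

Lemma quartic_bounds : exists eps M, 0 < eps <= 1 /\ 1 <= M /\
  forall t z, Rabs t < eps -> cdisc r z ->
  1 / 64 <= quartic t z /\ Rabs (quartic1 t z) <= M /\ Rabs (quartic2 t z) <= M /\ Rabs (quartic3 t z) <= M.
Proof.
  destruct (cont_cdisc_bounded r Hr c1 Hc1) as (M1 & HM1 & B1).
  destruct (cont_cdisc_bounded r Hr c2 Hc2) as (M2 & HM2 & B2).
  destruct (cont_cdisc_bounded r Hr c3 Hc3) as (M3 & HM3 & B3).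
  destruct (cont_cdisc_bounded r Hr c4 Hc4) as (M4 & HM4 & B4).
  pose (Sm := M1 + M2 + M3 + M4).
  (* This eps keeps the four terms with t below 1/64 in total, and 1/16 - 1/64 >= 1/64. The largest
     coefficients occur in [quartic3], where 6 + 24 = 30. *)
  exists (/ (64 * (Sm + 1))), (1 + 30 * Sm).
  assert (HS : 0 <= Sm) by (unfold Sm; lra).
  assert (He : 0 < / (64 * (Sm + 1)) <= 1).
  { split; [apply Rinv_0_lt_compat; lra|]. rewrite <- Rinv_1. apply Rinv_le_contravar; lra. }
  split; [auto|split; [lra|]].
  intros t z Ht Hz. generalize (B1 z Hz) (B2 z Hz) (B3 z Hz) (B4 z Hz) (Hpos z Hz). intros G1 G2 G3 G4 G0.
  set (eps := / (64 * (Sm + 1))) in *.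
  assert (Ht1 : Rabs t <= 1) by lra. pose proof (Rabs_pos t) as Ht0.
  assert (Hpow : forall n, Rabs (t ^ n) <= 1 /\ Rabs (t ^ S n) <= Rabs t).
  { intros n. assert (Hn : Rabs (t ^ n) <= 1).
    { rewrite <- RPow_abs. rewrite <- (pow1 n). apply pow_incr. lra. }
    split; auto. simpl. rewrite Rabs_mult. pose proof (Rabs_pos (t ^ n)). nra. }
  assert (Hb : forall c M x y, Rabs c <= M -> Rabs x <= y -> Rabs (c * x) <= M * y).
  { intros c M x y Hc Hx. rewrite Rabs_mult. apply Rmult_le_compat; auto; apply Rabs_pos. }
  assert (HeS : Sm * eps <= 1 / 64).
  { unfold eps. apply (Rmult_le_reg_r (64 * (Sm + 1))); [lra|]. rewrite Rmult_assoc, Rinv_l by lra. lra. }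
  split; [|split; [|split]].
  - assert (K1 : Rabs (c1 z * t ^ 1) <= M1 * Rabs t) by (apply Hb; auto; apply (Hpow 0%nat)).
    assert (K2 : Rabs (c2 z * t ^ 2) <= M2 * Rabs t) by (apply Hb; auto; apply (Hpow 1%nat)).
    assert (K3 : Rabs (c3 z * t ^ 3) <= M3 * Rabs t) by (apply Hb; auto; apply (Hpow 2%nat)).
    assert (K4 : Rabs (c4 z * t ^ 4) <= M4 * Rabs t) by (apply Hb; auto; apply (Hpow 3%nat)).
    apply Rabs_le_between in K1, K2, K3, K4. rewrite pow_1 in K1.
    assert (Sm * Rabs t <= Sm * eps) by (apply Rmult_le_compat_l; lra).
    assert (M1 * Rabs t + M2 * Rabs t + M3 * Rabs t + M4 * Rabs t = Sm * Rabs t) by (unfold Sm; ring).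
    unfold quartic. lra.
  - assert (K2 : Rabs (c2 z * t ^ 1) <= M2 * 1) by (apply Hb; auto; apply (Hpow 1%nat)).
    assert (K3 : Rabs (c3 z * t ^ 2) <= M3 * 1) by (apply Hb; auto; apply (Hpow 2%nat)).
    assert (K4 : Rabs (c4 z * t ^ 3) <= M4 * 1) by (apply Hb; auto; apply (Hpow 3%nat)).
    rewrite pow_1 in K2. apply Rabs_le_between in G1, K2, K3, K4. apply Rabs_le. unfold quartic1, Sm. lra.
  - assert (K3 : Rabs (c3 z * t ^ 1) <= M3 * 1) by (apply Hb; auto; apply (Hpow 1%nat)).
    assert (K4 : Rabs (c4 z * t ^ 2) <= M4 * 1) by (apply Hb; auto; apply (Hpow 2%nat)).
    rewrite pow_1 in K3. apply Rabs_le_between in G2, K3, K4. apply Rabs_le. unfold quartic2, Sm. lra.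
  - assert (K4 : Rabs (c4 z * t ^ 1) <= M4 * 1) by (apply Hb; auto; apply (Hpow 1%nat)).
    rewrite pow_1 in K4. apply Rabs_le_between in G3, K4. apply Rabs_le. unfold quartic3, Sm. lra.
Qed.

Lemma dint_sqrt_quartic : exists (A' : R -> R) (eps : R), 0 < eps /\
  (forall t, Rabs t < eps -> is_derive (fun t => dint r (fun z => wgt z * root0 t z)) t (A' t)) /\
  is_derive A' 0 (dint r (fun z => wgt z * root2 0 z)).
Proof.
  destruct quartic_bounds as (eps & M & He & HM & Hb).
  destruct (cont_cdisc_bounded r Hr wgt Hw) as (Mw & HMw & Bw).
  exists (fun t => dint r (fun z => wgt z * root1 t z)), eps. split; [lra|].
  assert (Hy : forall t z, Rabs t < eps -> cdisc r z -> 1 / 8 <= root0 t z).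
  { intros t z Ht Hz. destruct (Hb t z Ht Hz) as [H _]. unfold root0.
    replace (1 / 8) with (sqrt (1 / 64)); [now apply sqrt_le_1_alt|].
    replace (1 / 64) with ((1 / 8) ^ 2) by field. apply sqrt_pow2. lra. }
  assert (Hdivb : forall x y B, Rabs x <= B -> 1 / 8 <= y -> Rabs (x / (2 * y)) <= 4 * B).
  { intros x y B Hx Hyy. unfold Rdiv. rewrite Rabs_mult, (Rabs_pos_eq (/ (2 * y))).
    - pose proof (Rabs_pos x). rewrite Rmult_comm. apply Rmult_le_compat; auto.
      + left; apply Rinv_0_lt_compat; lra.
      + replace 4 with (/ (1 / 4)) by field. apply Rinv_le_contravar; lra.
    - left; apply Rinv_0_lt_compat; lra. }
  assert (R1 : forall t z, Rabs t < eps -> cdisc r z -> Rabs (root1 t z) <= 4 * M).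
  { intros t z Ht Hz. apply Hdivb; [apply Hb; auto|now apply Hy]. }
  pose (M2 := 4 * (M + 2 * (4 * M) ^ 2)).
  assert (R2 : forall t z, Rabs t < eps -> cdisc r z -> Rabs (root2 t z) <= M2).
  { intros t z Ht Hz. apply Hdivb; [|now apply Hy].
    destruct (Hb t z Ht Hz) as (_ & _ & H2 & _). generalize (R1 t z Ht Hz). intros H1.
    assert (root1 t z ^ 2 <= (4 * M) ^ 2) by (rewrite <- (pow2_abs (root1 t z)); apply pow_incr; split; [apply Rabs_pos|auto]).
    pose proof (pow2_ge_0 (root1 t z)). apply Rabs_le_between in H2. apply Rabs_le. lra. }
  pose (M3 := 4 * (M + 6 * (4 * M) * M2)).
  assert (R3 : forall t z, Rabs t < eps -> cdisc r z -> Rabs (root3 t z) <= M3).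
  { intros t z Ht Hz. apply Hdivb; [|now apply Hy].
    destruct (Hb t z Ht Hz) as (_ & _ & _ & H3). generalize (R1 t z Ht Hz) (R2 t z Ht Hz). intros H1 H2.
    unfold Rminus. eapply Rle_trans; [apply Rabs_triang|]. rewrite Rabs_Ropp.
    apply Rplus_le_compat; auto. rewrite !Rabs_mult, (Rabs_pos_eq 6) by lra.
    repeat apply Rmult_le_compat; auto; try apply Rabs_pos; try lra.
    apply Rmult_le_pos; [lra|apply Rabs_pos]. }
  assert (Hq : forall t z, Rabs t < eps -> cdisc r z -> 0 < quartic t z).
  { intros t z Ht Hz. destruct (Hb t z Ht Hz) as [H _]. lra. }
  assert (Hcq : forall t, cont_cdisc r (quartic t)).
  { intros t z Hz. unfold quartic.
    repeat cont1; auto. }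
  assert (Hcq1 : forall t, cont_cdisc r (quartic1 t)).
  { intros t z Hz. unfold quartic1.
    repeat cont1; auto. }
  assert (Hcq2 : forall t, cont_cdisc r (quartic2 t)).
  { intros t z Hz. unfold quartic2.
    repeat cont1; auto. }
  assert (C0 : forall t, cont_cdisc r (root0 t)) by (intros t z Hz; apply continuous_Rsqrt; now apply Hcq).
  assert (H2y : forall t z, Rabs t < eps -> cdisc r z -> 2 * root0 t z <> 0).
  { intros t z Ht Hz. generalize (Hy t z Ht Hz). lra. }
  assert (Cd : forall t, cont_cdisc r (fun z => 2 * root0 t z))
    by (intros t z Hz; apply continuous_Rmult; [apply continuous_const|now apply C0]).
  assert (C1 : forall t, Rabs t < eps -> cont_cdisc r (root1 t)).
  { intros t Ht z Hz. apply continuous_Rdiv; [now apply Hcq1|now apply Cd|now apply H2y]. }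
  assert (C2 : forall t, Rabs t < eps -> cont_cdisc r (root2 t)).
  { intros t Ht z Hz. apply continuous_Rdiv; [|now apply Cd|now apply H2y].
    apply continuous_Rminus; [now apply Hcq2|]. apply continuous_Rmult; [apply continuous_const|].
    apply continuous_Rpow. now apply C1. }
  assert (Cw : forall k, cont_cdisc r k -> cont_cdisc r (fun z => wgt z * k z))
    by (intros k Hk z Hz; apply continuous_Rmult; auto).
  assert (Hz0 : Rabs 0 < eps) by (rewrite Rabs_R0; lra).
  assert (Hmul : forall z x B e, cdisc r z -> Rabs x <= B * e ^ 2 -> Rabs (wgt z * x) <= Mw * B * e ^ 2).
  { intros z x B e Hz Hx. rewrite Rabs_mult, Rmult_assoc. apply Rmult_le_compat; auto; apply Rabs_pos. }
  split.
  - intros t0 Ht0.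
    apply (dint_derive r eps (Mw * M2) (fun t z => wgt z * root0 t z) (fun t z => wgt z * root1 t z) t0); auto.
    intros t z Ht Hz.
    replace (wgt z * root0 t z - wgt z * root0 t0 z - (t - t0) * (wgt z * root1 t0 z))
      with (wgt z * (root0 t z - root0 t0 z - (t - t0) * root1 t0 z)) by ring.
    apply Hmul; auto.
    apply (taylor2_of_bound (fun t => root0 t z) (fun t => root1 t z) (fun t => root2 t z) eps); auto.
    + intros u Hu. apply root_derivs. now apply Hq.
    + intros u Hu. apply root_derivs. now apply Hq.
  - apply (dint_derive r eps (Mw * M3) (fun t z => wgt z * root1 t z) (fun t z => wgt z * root2 t z) 0); auto.
    intros t z Ht Hz.
    replace (wgt z * root1 t z - wgt z * root1 0 z - (t - 0) * (wgt z * root2 0 z))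
      with (wgt z * (root1 t z - root1 0 z - (t - 0) * root2 0 z)) by ring.
    apply Hmul; auto.
    apply (taylor2_of_bound (fun t => root1 t z) (fun t => root2 t z) (fun t => root3 t z) eps); auto.
    + intros u Hu. apply root_derivs. now apply Hq.
    + intros u Hu. apply root_derivs. now apply Hq.
Qed.

End SqrtQuartic.

(** * The area density of h + t W in terms of h_z and W_z *)

Section AreaExpansion.
Variables (h1 h2 h3 e1 e2 e3 : C).

Definition ar_A0 : R := nrm2 h1 + nrm2 h2 + nrm2 h3.
Definition ar_A1 : R := fst (h1 * Cconj e1 + h2 * Cconj e2 + h3 * Cconj e3)%C.
Definition ar_A2 : R := nrm2 e1 + nrm2 e2 + nrm2 e3.
Definition ar_B1 : C := (h1 * e1 + h2 * e2 + h3 * e3)%C.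
Definition ar_B2 : C := (e1 * e1 + e2 * e2 + e3 * e3)%C.

(** If X - i Y = 2 phi, Lagrange's identity reads |X x Y|^2 = 4 (|phi|^4 - |phi.phi|^2). For phi = f
    (H + t E) with H.H = 0 the product phi.phi starts at order t, so |f|^2 comes out of the root and
    the constant term under it is |H|^4. *)
Lemma cross_norm_quartic (f : C) (t : R) :
  (h1 * h1 + h2 * h2 + h3 * h3)%C = RtoC 0 ->
  let p e := 2 * fst (f * e)%C in let q e := - 2 * snd (f * e)%C in
  let X := v3 (p h1 + t * p e1) (p h2 + t * p e2) (p h3 + t * p e3) in
  let Y := v3 (q h1 + t * q e1) (q h2 + t * q e2) (q h3 + t * q e3) in
  norm3 (cross3 X Y) = 2 * nrm2 f * sqrt (ar_A0 ^ 2 + 4 * ar_A0 * ar_A1 * t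
     + (4 * ar_A1 ^ 2 + 2 * ar_A0 * ar_A2 - 4 * nrm2 ar_B1) * t ^ 2
     + (4 * ar_A1 * ar_A2 - 4 * fst (ar_B1 * Cconj ar_B2)%C) * t ^ 3 + (ar_A2 ^ 2 - nrm2 ar_B2) * t ^ 4).
Proof.
  intros H0. cbv beta zeta.
  assert (Hre : fst (h1 * h1 + h2 * h2 + h3 * h3)%C = 0) by now rewrite H0.
  assert (Him : snd (h1 * h1 + h2 * h2 + h3 * h3)%C = 0) by now rewrite H0.
  set (u := fun h e : C => (h + RtoC t * e)%C).
  assert (HX : forall h e : C, 2 * fst (f * h)%C + t * (2 * fst (f * e)%C) = 2 * fst (f * u h e)%C)
    by (intros; unfold u; simpl; ring).
  assert (HY : forall h e : C, - 2 * snd (f * h)%C + t * (- 2 * snd (f * e)%C) = - 2 * snd (f * u h e)%C)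
    by (intros; unfold u; simpl; ring).
  rewrite !HX, !HY.
  set (B := (u h1 e1 * u h1 e1 + u h2 e2 * u h2 e2 + u h3 e3 * u h3 e3)%C).
  set (A := nrm2 (u h1 e1) + nrm2 (u h2 e2) + nrm2 (u h3 e3)).
  assert (EA : A = ar_A0 + 2 * t * ar_A1 + t ^ 2 * ar_A2).
  { unfold A, u, ar_A0, ar_A1, ar_A2, nrm2. simpl. ring. }
  assert (EB : B = (RtoC (2 * t) * ar_B1 + RtoC (t ^ 2) * ar_B2)%C).
  { transitivity ((h1 * h1 + h2 * h2 + h3 * h3) + (RtoC (2 * t) * ar_B1 + RtoC (t ^ 2) * ar_B2))%C.
    - unfold B, u, ar_B1, ar_B2. rewrite RtoC_mult, RtoC_pow. ring.
    - rewrite H0. ring. }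
  assert (EP : ar_A0 ^ 2 + 4 * ar_A0 * ar_A1 * t
     + (4 * ar_A1 ^ 2 + 2 * ar_A0 * ar_A2 - 4 * nrm2 ar_B1) * t ^ 2
     + (4 * ar_A1 * ar_A2 - 4 * fst (ar_B1 * Cconj ar_B2)%C) * t ^ 3 + (ar_A2 ^ 2 - nrm2 ar_B2) * t ^ 4
     = A ^ 2 - nrm2 B).
  { rewrite EA, EB. generalize ar_A0 ar_A1 ar_A2 ar_B1 ar_B2. intros. unfold nrm2. simpl. ring. }
  rewrite EP. unfold norm3.
  replace (dot3 _ _) with ((2 * nrm2 f) ^ 2 * (A ^ 2 - nrm2 B)).
  - rewrite sqrt_mult_alt by apply pow2_ge_0. rewrite sqrt_pow2; auto. pose proof (nrm2_pos f). lra.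
  - unfold A, B. generalize (u h1 e1) (u h2 e2) (u h3 e3). intros [x1 y1] [x2 y2] [x3 y3].
    destruct f as [f1 f2]. unfold dot3, cross3, v3, c1, c2, c3, nrm2. simpl. ring.
Qed.

End AreaExpansion.

Definition dir_e1 (a0 : C) : C := (/ 2 * (1 - a0 * a0))%C.
Definition dir_e2 (a0 : C) : C := (Ci * / 2 * (1 + a0 * a0))%C.

Lemma half_C : (/ RtoC 2)%C = (/ 2, 0).
Proof. rewrite <- RtoC_inv by lra. reflexivity. Qed.

Lemma WE_isotropic (g : C) :
  (dir_e1 g * dir_e1 g + dir_e2 g * dir_e2 g + g * g)%C = RtoC 0.
Proof. unfold dir_e1, dir_e2. rewrite half_C. destruct g as [x y]. apply injective_projections; simpl; field. Qed.

Lemma WE_norm (g : C) : ar_A0 (dir_e1 g) (dir_e2 g) g = (1 + nrm2 g) ^ 2 / 2.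
Proof. unfold ar_A0, dir_e1, dir_e2. rewrite half_C. destruct g as [x y]. unfold nrm2; simpl; field. Qed.

(** e' is isotropic, so the mixed terms of X1 e' and X2 conj(e') cancel, and |e'|^2 = (1 +
    |a_0|^2)^2 / 2. *)
Lemma direction_norm (a0 X1 X2 : C) :
  let v e := (/ 2 * (X1 * e + X2 * Cconj e))%C in
  ar_A2 (v (dir_e1 a0)) (v (dir_e2 a0)) (v a0) = (1 + nrm2 a0) ^ 2 / 8 * (nrm2 X1 + nrm2 X2).
Proof.
  cbv beta zeta. unfold ar_A2, dir_e1, dir_e2. rewrite half_C. destruct a0 as [x y], X1 as [u1 u2], X2 as [v1 v2].
  unfold nrm2; simpl; field.
Qed.

(** If e(g) = h_z / f, then e(g).e' = - (g - a_0)^2 / 2 and e(g).conj(e') = (1 + conj(a_0) g)^2 /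
    2. *)
Lemma direction_dot (a0 g X1 X2 : C) :
  let v e := (/ 2 * (X1 * e + X2 * Cconj e))%C in
  ar_B1 (dir_e1 g) (dir_e2 g) g (v (dir_e1 a0)) (v (dir_e2 a0)) (v a0)
  = (/ 4 * ((1 + Cconj a0 * g) * (1 + Cconj a0 * g) * X2 - (g - a0) * (g - a0) * X1))%C.
Proof.
  cbv beta zeta. unfold ar_B1, dir_e1, dir_e2.
  replace (/ RtoC 4)%C with (/ 2 * / 2)%C by (field).
  rewrite half_C. destruct a0 as [x y], g as [g1 g2], X1 as [u1 u2], X2 as [v1 v2].
  apply injective_projections; simpl; field.
Qed.

Lemma dC1_dz (rho r : R) (u : R -> R -> R) (k : C -> R) (p q : C -> C) :
  0 < r < rho -> (forall x y, x ^ 2 + y ^ 2 < r ^ 2 -> u x y = k (x, y)) ->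
  dC1 rho (fun z => RtoC (k z)) p q ->
  forall x y, x ^ 2 + y ^ 2 < r ^ 2 -> dz u x y = p (x, y).
Proof.
  intros Hr Hu Hk x y Hxy.
  assert (Hod : odisc rho (x, y)) by (unfold odisc; cbn [fst snd]; nra).
  pose proof (dC1_real_conj _ _ _ _ _ Hk Hod) as Hq.
  destruct (Hk (x, y) Hod) as ((D1 & _ & D3 & _) & _). cbn [fst snd RtoC] in D1, D3.
  assert (Hopen : odisc r (x, y)) by exact Hxy.
  destruct (odisc_open _ _ Hopen) as [d Hd].
  assert (Ex : Dx u x y = fst (p (x, y)) + fst (q (x, y))).
  { unfold Dx. rewrite (Derive_ext_loc _ (fun t => k (t, y))); [now apply is_derive_unique|].
    exists d. intros t Ht. apply Hu. apply (Hd (t, y)). split; [exact Ht|apply ball_center]. }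
  assert (Ey : Dy u x y = snd (q (x, y)) - snd (p (x, y))).
  { unfold Dy. rewrite (Derive_ext_loc _ (fun t => k (x, t))); [now apply is_derive_unique|].
    exists d. intros t Ht. apply Hu. apply (Hd (x, t)). split; [apply ball_center|exact Ht]. }
  unfold dz. rewrite Ex, Ey, Hq. apply injective_projections; simpl; field.
Qed.

Lemma Dx_of_dz (u : R -> R -> R) (x y : R) : Dx u x y = 2 * fst (dz u x y).
Proof. unfold dz. simpl. field. Qed.

Lemma Dy_of_dz (u : R -> R -> R) (x y : R) : Dy u x y = - 2 * snd (dz u x y).
Proof. unfold dz. simpl. field. Qed.

Lemma D_add_smul (u v : R -> R -> R) (t x y : R) : smooth2 u -> smooth2 v ->
  Dx (fun x y => u x y + t * v x y) x y = Dx u x y + t * Dx v x y /\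
  Dy (fun x y => u x y + t * v x y) x y = Dy u x y + t * Dy v x y.
Proof.
  intros Hu Hv. destruct (Hu nil x y) as (A & B & _). destruct (Hv nil x y) as (A' & B' & _).
  simpl in A, B, A', B'. unfold Dx, Dy. split.
  - rewrite (Derive_plus (fun s => u s y) (fun s => t * v s y)); auto.
    + now rewrite Derive_scal.
    + apply (ex_derive_scal (fun s => v s y) t x A').
  - rewrite (Derive_plus (u x) (fun s => t * v x s)); auto.
    + now rewrite Derive_scal.
    + apply (ex_derive_scal (v x) t y B').
Qed.

(** h_z and W_z share the factor f. Once |f|^2 is taken out of the root, the rest stays bounded
    below also at branch points, where the area density of h itself vanishes. *)
Lemma area_second_derivative (rho r : R) (h W : map3) (f H1 H2 H3 E1 E2 E3 : C -> C) :
  0 < r < rho -> smooth3 h -> smooth3 W ->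
  (forall z, odisc rho z -> contC f z /\ contC H1 z /\ contC H2 z /\ contC H3 z /\ contC E1 z /\ contC E2 z /\ contC E3 z) ->
  (forall z, (H1 z * H1 z + H2 z * H2 z + H3 z * H3 z)%C = RtoC 0) ->
  (forall z, 1 / 4 <= ar_A0 (H1 z) (H2 z) (H3 z)) ->
  (forall x y, x ^ 2 + y ^ 2 < r ^ 2 ->
     dz (comp1 h) x y = (f (x, y) * H1 (x, y))%C /\ dz (comp2 h) x y = (f (x, y) * H2 (x, y))%C /\
     dz (comp3 h) x y = (f (x, y) * H3 (x, y))%C) ->
  (forall x y, x ^ 2 + y ^ 2 < r ^ 2 ->
     dz (comp1 W) x y = (f (x, y) * E1 (x, y))%C /\ dz (comp2 W) x y = (f (x, y) * E2 (x, y))%C /\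
     dz (comp3 W) x y = (f (x, y) * E3 (x, y))%C) ->
  exists (A' : R -> R) (eps : R), 0 < eps /\
    (forall t, Rabs t < eps -> is_derive (fun s => area r (add_smul h s W)) t (A' t)) /\
    is_derive A' 0 (dint r (fun z => 4 * (nrm2 (f z) * (ar_A2 (E1 z) (E2 z) (E3 z)
       - 2 * nrm2 (ar_B1 (H1 z) (H2 z) (H3 z) (E1 z) (E2 z) (E3 z)) / ar_A0 (H1 z) (H2 z) (H3 z))))).
Proof.
  intros Hr Hh HW Hc Hiso HA0 Hdh HdW.
  pose (A0 := fun z => ar_A0 (H1 z) (H2 z) (H3 z)).
  pose (A1 := fun z => ar_A1 (H1 z) (H2 z) (H3 z) (E1 z) (E2 z) (E3 z)).
  pose (A2 := fun z => ar_A2 (E1 z) (E2 z) (E3 z)).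
  pose (B1 := fun z => ar_B1 (H1 z) (H2 z) (H3 z) (E1 z) (E2 z) (E3 z)).
  pose (B2 := fun z => ar_B2 (E1 z) (E2 z) (E3 z)).
  pose (c0 := fun z => A0 z ^ 2).
  pose (c1 := fun z => 4 * A0 z * A1 z).
  pose (c2 := fun z => 4 * A1 z ^ 2 + 2 * A0 z * A2 z - 4 * nrm2 (B1 z)).
  pose (c3 := fun z => 4 * A1 z * A2 z - 4 * fst (B1 z * Cconj (B2 z))%C).
  pose (c4 := fun z => A2 z ^ 2 - nrm2 (B2 z)).
  pose (wgt := fun z => 2 * nrm2 (f z)).
  assert (Hcc : forall z, cdisc r z -> continuous A0 z /\ continuous A1 z /\ continuous A2 z /\ contC B1 z /\ contC B2 z /\
      continuous wgt z).
  { intros z Hz. destruct (Hc z (cdisc_odisc r rho z Hr Hz)) as (K0 & K1 & K2 & K3 & K4 & K5 & K6).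
    split; [|split; [|split; [|split; [|split]]]].
    - exact (continuous_Rplus _ _ _ (continuous_Rplus _ _ _ (continuous_nrm2 _ _ K1) (continuous_nrm2 _ _ K2)) (continuous_nrm2 _ _ K3)).
    - assert (K : contC (fun z => H1 z * Cconj (E1 z) + H2 z * Cconj (E2 z) + H3 z * Cconj (E3 z))%C z)
        by (repeat contC1; assumption).
      exact (proj1 K).
    - exact (continuous_Rplus _ _ _ (continuous_Rplus _ _ _ (continuous_nrm2 _ _ K4) (continuous_nrm2 _ _ K5)) (continuous_nrm2 _ _ K6)).
    - unfold B1, ar_B1. repeat contC1; assumption.
    - unfold B2, ar_B2. repeat contC1; assumption.
    - unfold wgt. apply continuous_Rmult; [apply continuous_const|now apply continuous_nrm2]. }
  assert (Q0 : cont_cdisc r c0).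
  { intros z Hz. apply continuous_Rpow. exact (proj1 (Hcc z Hz)). }
  assert (Q1 : cont_cdisc r c1).
  { intros z Hz. destruct (Hcc z Hz) as (K0 & K1 & K2 & K3 & K4 & K5). unfold c1.
    apply continuous_Rmult; auto. apply continuous_Rmult; auto. apply continuous_const. }
  assert (Q2 : cont_cdisc r c2).
  { intros z Hz. destruct (Hcc z Hz) as (K0 & K1 & K2 & K3 & K4 & K5). unfold c2.
    apply continuous_Rminus; [apply continuous_Rplus|]; apply continuous_Rmult; auto; try apply continuous_const.
    - now apply continuous_Rpow.
    - apply continuous_Rmult; auto. apply continuous_const.
    - now apply continuous_nrm2. }
  assert (Q3 : cont_cdisc r c3).
  { intros z Hz. destruct (Hcc z Hz) as (K0 & K1 & K2 & K3 & K4 & K5). unfold c3.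
    assert (K : contC (fun z => B1 z * Cconj (B2 z))%C z) by (repeat contC1; assumption).
    apply continuous_Rminus; apply continuous_Rmult; auto; try apply continuous_const.
    - apply continuous_Rmult; auto. apply continuous_const.
    - exact (proj1 K). }
  assert (Q4 : cont_cdisc r c4).
  { intros z Hz. destruct (Hcc z Hz) as (K0 & K1 & K2 & K3 & K4 & K5). unfold c4.
    apply continuous_Rminus; [now apply continuous_Rpow|now apply continuous_nrm2]. }
  assert (Q5 : cont_cdisc r wgt).
  { intros z Hz. exact (proj2 (proj2 (proj2 (proj2 (proj2 (Hcc z Hz)))))). }
  destruct (dint_sqrt_quartic r wgt c0 c1 c2 c3 c4 (proj1 Hr) Q5 Q0 Q1 Q2 Q3 Q4) as (A' & eps & Heps & HA' & HA'').
  { intros z _. unfold c0. generalize (HA0 z). fold (A0 z). intros. nra. }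
  exists A', eps. split; [auto|split].
  - intros t Ht. apply is_derive_ext with (f := fun s => dint r (fun z => wgt z * root0 c0 c1 c2 c3 c4 s z)); auto.
    intros s. change (area r (add_smul h s W)) with
      (dint r (fun z => norm3 (cross3 (Dx3 (add_smul h s W) (fst z) (snd z)) (Dy3 (add_smul h s W) (fst z) (snd z))))).
    apply dint_ext; [lra|]. intros [x y] Hz. cbn [fst snd] in Hz |- *.
    destruct (Hdh x y Hz) as (a1 & a2 & a3). destruct (HdW x y Hz) as (b1 & b2 & b3).
    destruct Hh as (s1 & s2 & s3). destruct HW as (t1 & t2 & t3).
    unfold Dx3, Dy3.
    change (comp1 (add_smul h s W)) with (fun x y => comp1 h x y + s * comp1 W x y).
    change (comp2 (add_smul h s W)) with (fun x y => comp2 h x y + s * comp2 W x y).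
    change (comp3 (add_smul h s W)) with (fun x y => comp3 h x y + s * comp3 W x y).
    rewrite !(proj1 (D_add_smul _ _ s x y s1 t1)), !(proj1 (D_add_smul _ _ s x y s2 t2)), !(proj1 (D_add_smul _ _ s x y s3 t3)).
    rewrite !(proj2 (D_add_smul _ _ s x y s1 t1)), !(proj2 (D_add_smul _ _ s x y s2 t2)), !(proj2 (D_add_smul _ _ s x y s3 t3)).
    rewrite !Dx_of_dz, !Dy_of_dz, a1, a2, a3, b1, b2, b3.
    symmetry. apply (cross_norm_quartic (H1 (x, y)) (H2 (x, y)) (H3 (x, y)) (E1 (x, y)) (E2 (x, y)) (E3 (x, y)) (f (x, y)) s (Hiso (x, y))).
  - rewrite (dint_ext r _ (fun z => wgt z * root2 c0 c1 c2 c3 c4 0 z)); [exact HA''|lra|].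
    intros z _. fold (A0 z) (A2 z) (B1 z). generalize (HA0 z). fold (A0 z). intros HA.
    (* At t = 0 [root1] is 2 A1, and its square cancels the A1^2 in [quartic2]; 2 A2 - 4 |B1|^2 / A0
       is left. *)
    unfold root2, root1, root0. replace (quartic c0 c1 c2 c3 c4 0 z) with (A0 z ^ 2) by (unfold quartic, c0; ring).
    rewrite sqrt_pow2 by lra. unfold quartic2, quartic1, c1, c2, wgt. field. lra.
Qed.

(** * The destabilizing variation *)

Lemma wirt_unique F z p q p' q' : wirt F z p q -> wirt F z p' q' -> p = p'.
Proof.
  intros (A1 & A2 & A3 & A4) (B1 & B2 & B3 & B4).
  apply is_derive_unique in A1, A2, A3, A4, B1, B2, B3, B4.
  apply injective_projections; lra.
Qed.

(** On the disc this is f. Expressed through h it is smooth on the whole plane, as [smooth3] demands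
    of the variation, whereas f is controlled only for |z| < rho. *)
Definition we_f (h : map3) (x y : R) : C := (dz (comp1 h) x y - Ci * dz (comp2 h) x y)%C.

Lemma smooth_expr_we_f (h : map3) : smooth3 h -> smooth_expr (fun x y => nrm2 (we_f h x y)).
Proof.
  intros (H1 & H2 & _).
  replace (fun x y => nrm2 (we_f h x y)) with (fun x y =>
     (Dx (comp1 h) x y * / 2 - Dy (comp2 h) x y * / 2) ^ 2 + (Dy (comp1 h) x y * / 2 + Dx (comp2 h) x y * / 2) ^ 2).
  - assert (K1 := se_smooth _ (smooth2_Dx _ H1)). assert (K2 := se_smooth _ (smooth2_Dy _ H1)).
    assert (K3 := se_smooth _ (smooth2_Dx _ H2)). assert (K4 := se_smooth _ (smooth2_Dy _ H2)).
    assert (Kh : forall u, smooth_expr u -> smooth_expr (fun x y => u x y * / 2))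
      by (intros u Hu; exact (se_mult _ _ Hu (se_const (/ 2)))).
    exact (se_plus _ _ (smooth_expr_pow _ 2 (smooth_expr_minus _ _ (Kh _ K1) (Kh _ K4)))
                       (smooth_expr_pow _ 2 (se_plus _ _ (Kh _ K2) (Kh _ K3)))).
  - apply functional_extensionality; intros x; apply functional_extensionality; intros y.
    unfold we_f, dz, nrm2. simpl. field.
Qed.

Section Destabilize.
Variables (rho r : R) (m k : nat) (a0 a : C) (f f1 f2 G1 G1d : C -> C) (h : map3) (cb q0 : R).
Hypothesis Hr : 0 < r < rho.
Hypothesis Hm : (0 < m)%nat.
Hypothesis Hsm : smooth3 h.
Hypothesis Hf : holo rho f f1.
Hypothesis Hf1 : holo rho f1 f2.
Hypothesis HG1 : holo rho G1 G1d.
Hypothesis Hcb : 0 < cb.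
Hypothesis Hq0 : 0 < q0.
Hypothesis Hlow : forall z, cdisc r z -> nrm2 z <= q0 -> cb * nrm2 z ^ k <= nrm2 (f z).
Hypothesis HWE : WE_rep r h f (wt_g m a0 a G1).
Hypothesis Hbig : nrm2 (wt_p0 a0) < nrm2 a * r ^ (2 * m).

Let M : C := RtoC (INR m).
Let w := wt_w m.
Let w1 := wt_w1 m.
Let g := wt_g m a0 a G1.
Let tau := wt_tau r m.
Let tz := wt_tz r m.

Definition ds_F (z : C) : C := (wt_w m z * (f z * f z))%C.
Definition ds_Fd (z : C) : C := (M * wt_w1 m z * (f z * f z) + wt_w m z * (f1 z * f z + f z * f1 z))%C.

Lemma holo_F : holo rho ds_F ds_Fd.
Proof. exact (holo_mult _ _ _ _ _ (holo_w rho m) (holo_mult _ _ _ _ _ Hf Hf)). Qed.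

Lemma holo_Fd : exists Fdd, holo rho ds_Fd Fdd.
Proof.
  eexists. unfold ds_Fd. apply holo_plus; apply holo_mult.
  - apply holo_mult; [apply holo_const|apply holo_w1].
  - apply holo_mult; exact Hf.
  - apply holo_w.
  - apply holo_plus; apply holo_mult; first [exact Hf|exact Hf1].
Qed.

Lemma dC1_tb : exists p q, dC1 rho (fun z => Cconj (wt_tz r m z)) p q.
Proof.
  pose proof (holo_w1 rho m) as H1. pose proof (holo_conj _ _ _ (holo_w rho m)) as H2.
  unfold holo in H1. do 2 eexists. apply dC1_conj. unfold wt_tz. repeat dC1_step.
Qed.

Lemma ds_cutoff : exists L, 1 <= L /\
  dint r (fun z => wt_u m a0 a G1 z ^ 2 * nrm2 (chi_z ds_F ds_Fd L z * RtoC (tau z) + RtoC (chi ds_F L z) * tz z)%C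
                   + (chi ds_F L z * tau z) ^ 2 * wt_J m a0 a G1 G1d z) < 0.
Proof.
  destruct holo_Fd as [Fdd HFd]. destruct dC1_tb as (p & q & Htb).
  pose proof (dint_base_form_neg rho r m a0 a G1 G1d Hr Hm HG1 Hbig) as Hneg.
  (* |F|^2 = |w|^2 |f|^4 is at least cb^2 |z|^(2(m + 2k)) near 0, which explains the exponent and
     the constant. [eta] is half the absolute value of the negative base integral. *)
  destruct (cutoff_limit rho r ds_F ds_Fd Fdd (m + 2 * k) (cb ^ 2) q0 Hr holo_F HFd) with
    (tau := wt_tau r m) (tz := wt_tz r m) (tb := fun z => Cconj (wt_tz r m z)) (tbz := p) (tbb := q)
    (U := wt_u m a0 a G1) (J := wt_J m a0 a G1 G1d)
    (eta := - dint r (radial_form m a0 a G1 G1d (wt_tau r m) (wt_tz r m)) / 2) as (L & HL & Hle).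
  - apply pow_lt; lra.
  - lra.
  - lia.
  - intros z Hz Hzq. unfold ds_F, wt_w. rewrite !nrm2_mult, nrm2_pow.
    replace (cb ^ 2 * nrm2 z ^ (m + 2 * k)) with (nrm2 z ^ m * (cb * nrm2 z ^ k * (cb * nrm2 z ^ k)))
      by (rewrite pow_add, Nat.mul_comm, pow_mult; ring).
    pose proof (pow_le (nrm2 z) k (nrm2_pos z)). pose proof (Hlow z Hz Hzq).
    apply Rmult_le_compat_l; [apply pow_le, nrm2_pos|].
    assert (0 <= cb * nrm2 z ^ k) by (apply Rmult_le_pos; lra). nra.
  - apply dC1_tau.
  - exact Htb.
  - intros z Hz. now apply (wt_tau_circle rho).
  - intros z Hz. now apply (continuous_wt_u rho r m a0 a G1 G1d HG1).
  - intros z Hz. now apply (continuous_wt_J rho r m a0 a G1 G1d HG1).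
  - lra.
  - exists L. split; auto. unfold radial_form in Hle, Hneg. unfold tau, tz. lra.
Qed.

Section WithL.
Variable L : R.
Hypothesis HL : 1 <= L.

(** [ds_k] is chi tau / |w|^2 with the division carried out, so k c conj(w) e' is the regularized
    form of chi tau (c / w) e'. *)
Definition ds_T (z : C) : R := / ct_s ds_F L z * (1 + ct_v ds_F L z / L) * tau z.
Definition ds_k (z : C) : R := nrm2 (f z) ^ 2 * ds_T z.

Lemma ds_k_chi z : ds_k z * nrm2 (w z) = chi ds_F L z * tau z.
Proof.
  unfold ds_k, ds_T, chi. replace (nrm2 (ds_F z)) with (nrm2 (w z) * nrm2 (f z) ^ 2); [ring|].
  unfold ds_F. rewrite !nrm2_mult. unfold w. ring.
Qed.

Lemma dC1_T : exists p q, dC1 rho (fun z => RtoC (ds_T z)) p q.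
Proof.
  pose proof (dC1_is rho ds_F ds_Fd holo_F L) as H1. pose proof (dC1_v rho ds_F ds_Fd holo_F L) as H2.
  pose proof (dC1_tau rho r m) as H3.
  assert (E : (fun z => RtoC (ds_T z)) =
    (fun z => RtoC (/ ct_s ds_F L z) * (1 + RtoC (ct_v ds_F L z) * RtoC (/ L)) * RtoC (wt_tau r m z))%C).
  { apply functional_extensionality. intros z. unfold ds_T, Rdiv. now rewrite !RtoC_mult, RtoC_plus, RtoC_mult. }
  rewrite E. do 2 eexists. repeat dC1_step.
Qed.

(** |f|^4 = f^2 conj(f)^2, and the z-derivative of f^2 is 2 f f': one factor f survives. Its
    cofactor is continuous, as [area_second_derivative] requires. *)
Lemma dC1_k : exists kq kb,
  dC1 rho (fun z => RtoC (ds_k z)) (fun z => f z * kq z)%C kb /\ forall z, odisc rho z -> contC kq z.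
Proof.
  destruct dC1_T as (Tz & Tb & HT). pose proof (holo_conj _ _ _ Hf) as Hf'.
  exists (fun z => 2 * f1 z * (Cconj (f z) * Cconj (f z)) * RtoC (ds_T z) + f z * (Cconj (f z) * Cconj (f z)) * Tz z)%C.
  assert (H : exists q, dC1 rho (fun z => f z * f z * (Cconj (f z) * Cconj (f z)) * RtoC (ds_T z))%C
     (fun z => f z * (2 * f1 z * (Cconj (f z) * Cconj (f z)) * RtoC (ds_T z) + f z * (Cconj (f z) * Cconj (f z)) * Tz z))%C q).
  { unfold holo in Hf. eexists. eapply dC1_eq_deriv; [repeat dC1_step| |reflexivity]. intros; cbv beta; ring. }
  destruct H as [q H]. exists q. split.
  - apply (dC1_eq _ _ _ _ _ _ _ H); auto. intros z. unfold ds_k. rewrite RtoC_mult, RtoC_pow, nrm2_conj. simpl. ring.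
  - intros z Hz. destruct (Hf z Hz) as (_ & K1 & K2 & _). destruct (HT z Hz) as (_ & K3 & K4 & _).
    repeat contC1; assumption || apply K3.
Qed.

(** [ds_k] with f replaced by [we_f h], hence smooth on the whole plane. *)
Definition ds_mult (x y : R) : R :=
  let ph := nrm2 (we_f h x y) in let s := nrm2 (x, y) ^ m * ph ^ 2 + exp (- L) in
  ph ^ 2 * (/ s * (1 + ln s * / L) * wt_tau r m (x, y)).

Lemma smooth_expr_nrm2 : smooth_expr (fun x y => nrm2 (x, y)).
Proof.
  change (smooth_expr (fun x y => x ^ 2 + y ^ 2)).
  apply se_plus; [apply (smooth_expr_pow (fun x _ => x)), se_x|apply (smooth_expr_pow (fun _ y => y)), se_y].
Qed.

Lemma smooth_expr_ds_mult : smooth_expr ds_mult.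
Proof.
  pose proof (smooth_expr_we_f h Hsm) as Hph. pose proof smooth_expr_nrm2 as Hn.
  assert (Hph2 : smooth_expr (fun x y => nrm2 (we_f h x y) ^ 2)) by now apply (smooth_expr_pow (fun x y => nrm2 (we_f h x y))).
  assert (Hs : smooth_expr (fun x y => nrm2 (x, y) ^ m * nrm2 (we_f h x y) ^ 2 + exp (- L))).
  { apply se_plus; [|apply se_const]. apply se_mult; auto. now apply (smooth_expr_pow (fun x y => nrm2 (x, y))). }
  assert (Hs0 : forall x y, 0 < nrm2 (x, y) ^ m * nrm2 (we_f h x y) ^ 2 + exp (- L)).
  { intros x y. pose proof (exp_pos (- L)).
    assert (0 <= nrm2 (x, y) ^ m * nrm2 (we_f h x y) ^ 2); [|lra].
    apply Rmult_le_pos; apply pow_le, nrm2_pos. }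
  unfold ds_mult. apply se_mult; auto. apply se_mult; [apply se_mult|].
  - now apply (se_inv (fun x y => nrm2 (x, y) ^ m * nrm2 (we_f h x y) ^ 2 + exp (- L))).
  - apply se_plus; [apply se_const|]. apply se_mult; [|apply se_const].
    now apply (se_ln (fun x y => nrm2 (x, y) ^ m * nrm2 (we_f h x y) ^ 2 + exp (- L))).
  - unfold wt_tau. apply smooth_expr_minus; [apply se_const|]. apply se_mult; [|apply se_const].
    now apply (smooth_expr_pow (fun x y => nrm2 (x, y))).
Qed.

Definition ds_coord (e : C) (z : C) : R := fst (Cconj a * Cconj (wt_w m z) * e)%C.

Definition ds_W : map3 := fun x y =>
  v3 (ds_mult x y * ds_coord (dir_e1 a0) (x, y)) (ds_mult x y * ds_coord (dir_e2 a0) (x, y))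
     (ds_mult x y * ds_coord a0 (x, y)).

Lemma smooth2_coord (e : C) : smooth2 (fun x y => ds_mult x y * ds_coord e (x, y)).
Proof.
  apply smooth_expr_smooth2, se_mult; [apply smooth_expr_ds_mult|].
  destruct (smooth_expr_Cpow m) as [Hx Hy].
  replace (fun x y => ds_coord e (x, y)) with
    (fun x y => fst (((x, y) : C) ^ m)%C * fst (Cconj a * e)%C + snd (((x, y) : C) ^ m)%C * snd (Cconj a * e)%C).
  - apply se_plus; apply se_mult; auto; apply se_const.
  - apply functional_extensionality; intros x; apply functional_extensionality; intros y.
    unfold ds_coord, wt_w. simpl. ring.
Qed.

Lemma we_f_eq x y : x ^ 2 + y ^ 2 < r ^ 2 -> we_f h x y = f (x, y).
Proof.
  intros Hxy. destruct (HWE x y (Rlt_le _ _ Hxy)) as (E1 & E2 & _). unfold we_f. rewrite E1, E2.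
  cbv zeta. generalize (f (x, y)) (wt_g m a0 a G1 (x, y)). intros [u1 u2] [v1 v2].
  apply injective_projections; simpl; field.
Qed.

Lemma ds_mult_eq x y : x ^ 2 + y ^ 2 < r ^ 2 -> ds_mult x y = ds_k (x, y).
Proof.
  intros Hxy. unfold ds_mult, ds_k, ds_T, ct_v, ct_s, Rdiv. cbv zeta. rewrite (we_f_eq x y Hxy).
  unfold ds_F. rewrite !nrm2_mult. unfold wt_w. rewrite nrm2_pow. unfold tau.
  replace (nrm2 (x, y) ^ m * nrm2 (f (x, y)) ^ 2) with (nrm2 (x, y) ^ m * (nrm2 (f (x, y)) * nrm2 (f (x, y)))) by ring.
  reflexivity.
Qed.

Definition ds_k0 (z : C) : C := (f z * (Cconj (f z) * Cconj (f z)) * RtoC (ds_T z))%C.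

Lemma ds_k_factor z : RtoC (ds_k z) = (f z * ds_k0 z)%C.
Proof. unfold ds_k, ds_k0. rewrite RtoC_mult, RtoC_pow, nrm2_conj. simpl. ring. Qed.

Lemma ds_W_dz (kq kb : C -> C) (e : C) :
  dC1 rho (fun z => RtoC (ds_k z)) (fun z => f z * kq z)%C kb ->
  forall x y, x ^ 2 + y ^ 2 < r ^ 2 ->
  dz (fun x y => ds_mult x y * ds_coord e (x, y)) x y =
  (f (x, y) * (/ 2 * ((kq (x, y) * Cconj a * Cconj (w (x, y))) * e
     + (kq (x, y) * a * w (x, y) + ds_k0 (x, y) * a * (M * w1 (x, y))) * Cconj e)))%C.
Proof.
  intros Hk. pose proof (holo_w rho m) as Hw. pose proof (holo_conj _ _ _ Hw) as Hw'.
  assert (H : exists q, dC1 rho (fun z => RtoC (ds_k z * ds_coord e z)) (fun z =>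
     f z * (/ 2 * ((kq z * Cconj a * Cconj (w z)) * e
     + (kq z * a * w z + ds_k0 z * a * (M * w1 z)) * Cconj e)))%C q).
  { assert (E : (fun z => RtoC (ds_k z * ds_coord e z)) = (fun z => RtoC (ds_k z) *
       (Cconj a * Cconj (wt_w m z) * e + a * wt_w m z * Cconj e) * / 2)%C).
    { apply functional_extensionality. intros z. unfold ds_coord. rewrite RtoC_mult, RtoC_re.
      rewrite !Cmult_conj, !Cconj_conj. field. }
    rewrite E. unfold holo in Hw. eexists. eapply dC1_eq_deriv; [repeat dC1_step| |reflexivity].
    intros z _. cbv beta. rewrite ds_k_factor. unfold w, w1, M. field. }
  destruct H as [q H].
  intros x y Hxy.
  refine (dC1_dz rho r (fun x y => ds_mult x y * ds_coord e (x, y)) (fun z => ds_k z * ds_coord e z) _ q Hr _ H x y Hxy).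
  intros x' y' Hxy'. now rewrite ds_mult_eq.
Qed.

Lemma ds_W_unstable :
  dint r (fun z => wt_u m a0 a G1 z ^ 2 * nrm2 (chi_z ds_F ds_Fd L z * RtoC (tau z) + RtoC (chi ds_F L z) * tz z)%C
                   + (chi ds_F L z * tau z) ^ 2 * wt_J m a0 a G1 G1d z) < 0 -> unstable r h.
Proof.
  intros Hneg. destruct dC1_k as (kq & kb & Hk & Hkq).
  pose (Y1 := fun z => (kq z * Cconj a * Cconj (w z))%C).
  pose (Y2 := fun z => (kq z * a * w z + ds_k0 z * a * (M * w1 z))%C).
  pose (V := fun e z => (/ 2 * (Y1 z * e + Y2 z * Cconj e))%C).
  assert (HWs : smooth3 ds_W) by (split; [|split]; apply smooth2_coord).
  destruct (area_second_derivative rho r h ds_W f (fun z => dir_e1 (g z)) (fun z => dir_e2 (g z)) g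
     (V (dir_e1 a0)) (V (dir_e2 a0)) (V a0) Hr Hsm HWs) as (A' & eps & Heps & HA1 & HA2).
  - intros z Hz. destruct (Hf z Hz) as (_ & K1 & _).
    destruct (wt_contC rho r m a0 a G1 G1d HG1 z Hz) as (K2 & K3 & _ & _ & K4 & _).
    destruct dC1_T as (Tz & Tb & HT). destruct (HT z Hz) as (_ & [K5 _] & _). cbn [fst RtoC] in K5.
    pose proof (Hkq z Hz) as K6.
    assert (K7 : contC Y1 z) by (unfold Y1; repeat contC1; assumption).
    assert (K8 : contC Y2 z) by (unfold Y2, ds_k0; repeat contC1; assumption).
    assert (K9 : contC g z) by exact K4.
    unfold V, dir_e1, dir_e2. split; [assumption|].
    repeat (split; [repeat contC1; assumption|]). repeat contC1; assumption.
  - intros z. apply WE_isotropic.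
  - intros z. rewrite WE_norm. pose proof (nrm2_pos (g z)). nra.
  - intros x y Hxy. destruct (HWE x y (Rlt_le _ _ Hxy)) as (E1 & E2 & E3). cbv zeta in E1, E2, E3.
    rewrite E1, E2, E3. fold g. unfold dir_e1, dir_e2.
    replace (RtoC (1 / 2)) with (/ 2)%C by (unfold Rdiv; rewrite RtoC_mult, RtoC_inv by lra; ring).
    split; [ring|split; [ring|reflexivity]].
  - intros x y Hxy. split; [|split]; apply (ds_W_dz kq kb _ Hk x y Hxy).
  - exists ds_W. split; [exact HWs|split].
    + intros x y Hxy. assert (E : wt_tau r m (x, y) = 0) by (apply (wt_tau_circle rho r m Hr); exact Hxy).
      unfold ds_W, ds_mult. cbv zeta. rewrite E, !Rmult_0_r, !Rmult_0_l. reflexivity.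
    + exists A', (dint r (fun z => 4 * index_form m a0 a G1 ds_k (fun z => f z * kq z)%C z)), eps.
      split; [exact Heps|split; [exact HA1|split]].
      * match type of HA2 with is_derive _ _ (dint r ?F2) =>
          rewrite (dint_ext r (fun z => 4 * index_form m a0 a G1 ds_k (fun z => f z * kq z)%C z) F2 (proj1 Hr)); [exact HA2|]
        end.
        intros z Hz. cbv beta. unfold V. rewrite direction_norm, WE_norm, direction_dot.
        unfold index_form. cbv zeta.
        replace (f z * kq z * Cconj a * Cconj (wt_w m z))%C with (f z * Y1 z)%C by (unfold Y1, w; ring).
        replace (f z * kq z * a * wt_w m z + RtoC (ds_k z) * a * (RtoC (INR m) * wt_w1 m z))%C with (f z * Y2 z)%C
          by (rewrite ds_k_factor; unfold Y2, w, w1, M; ring).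
        replace (g z - a0)%C with (wt_w m z * wt_G a G1 z)%C by (unfold g, wt_g; ring).
        change (1 + Cconj a0 * g z)%C with (wt_A m a0 a G1 z). fold g.
        replace (wt_A m a0 a G1 z * wt_A m a0 a G1 z * (f z * Y2 z)
           - wt_w m z * wt_G a G1 z * (wt_w m z * wt_G a G1 z) * (f z * Y1 z))%C
          with (f z * (wt_A m a0 a G1 z * wt_A m a0 a G1 z * Y2 z
           - wt_w m z * wt_G a G1 z * (wt_w m z * wt_G a G1 z) * Y1 z))%C by ring.
        rewrite !nrm2_mult. replace (nrm2 (wt_p0 a0)) with ((1 + nrm2 a0) ^ 2)
          by (unfold wt_p0, nrm2; simpl; ring).
        assert (Eq : nrm2 (/ 4)%C = / 16).
        { replace (/ RtoC 4)%C with (RtoC (/ 4)) by (now rewrite RtoC_inv by lra). unfold nrm2; simpl; field. }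
        rewrite Eq. pose proof (nrm2_pos (g z)). change (wt_g m a0 a G1 z) with (g z). field. lra.
      * assert (Hk0 : forall z, nrm2 z = r ^ 2 -> ds_k z = 0).
        { intros z Hz. unfold ds_k, ds_T, tau. rewrite (wt_tau_circle rho r m Hr z Hz). ring. }
        assert (Hci : cont_cdisc r (index_form m a0 a G1 ds_k (fun z => f z * kq z)%C)).
        { intros z Hz. apply (cdisc_odisc r rho z Hr) in Hz.
          destruct (Hk z Hz) as (_ & [K1 _] & K2 & _).
          now apply (continuous_index_form rho r m a0 a G1 G1d HG1). }
        rewrite (dint_scal r (proj1 Hr) 4 _ Hci).
        rewrite (dint_index_form rho r m a0 a G1 G1d Hr HG1 ds_k _ kb Hk Hk0).
        assert (E : dint r (radial_form m a0 a G1 G1d (fun z => ds_k z * nrm2 (wt_w m z)) (kappa_z m ds_k (fun z => (f z * kq z)%C))) < 0).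
        { rewrite (dint_ext r _ (fun z => wt_u m a0 a G1 z ^ 2 * nrm2 (chi_z ds_F ds_Fd L z * RtoC (tau z) + RtoC (chi ds_F L z) * tz z)%C
                   + (chi ds_F L z * tau z) ^ 2 * wt_J m a0 a G1 G1d z)); [exact Hneg|lra|].
          intros z Hz. assert (Hod : odisc rho z) by (unfold odisc; nra).
          unfold radial_form. rewrite (ds_k_chi z : ds_k z * nrm2 (wt_w m z) = _).
          replace (kappa_z m ds_k (fun z => (f z * kq z)%C) z) with (chi_z ds_F ds_Fd L z * RtoC (tau z) + RtoC (chi ds_F L z) * tz z)%C; auto.
          pose proof (holo_w rho m) as Hw. pose proof (holo_conj _ _ _ Hw) as Hw'.
          destruct (dC1_chi rho ds_F ds_Fd holo_F L HL) as [qc Hchi]. pose proof (dC1_tau rho r m) as Ht.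
          (* The function chi tau is differentiated twice, from the product chi tau and from k w
             conj(w); uniqueness of the z-derivative identifies the two results. *)
          assert (D1 : exists q, dC1 rho (fun z => RtoC (chi ds_F L z) * RtoC (wt_tau r m z))%C
              (fun z => chi_z ds_F ds_Fd L z * RtoC (tau z) + RtoC (chi ds_F L z) * tz z)%C q)
            by (eexists; apply (dC1_mult _ _ _ _ _ _ _ Hchi Ht)).
          assert (D2 : exists q, dC1 rho (fun z => RtoC (chi ds_F L z) * RtoC (wt_tau r m z))%C
              (kappa_z m ds_k (fun z => (f z * kq z)%C)) q).
          { assert (E : (fun z => RtoC (chi ds_F L z) * RtoC (wt_tau r m z))%C = (fun z => RtoC (ds_k z) * wt_w m z * Cconj (wt_w m z))%C).
            { apply functional_extensionality. intros y. rewrite <- RtoC_mult.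
              change (wt_tau r m y) with (tau y). rewrite <- ds_k_chi, RtoC_mult, nrm2_conj. unfold w. ring. }
            rewrite E. unfold holo in Hw. eexists. eapply dC1_eq_deriv; [repeat dC1_step| |reflexivity].
            intros y _. unfold kappa_z. cbv beta. ring. }
          destruct D1 as [q1 D1]. destruct D2 as [q2 D2].
          exact (wirt_unique _ _ _ _ _ _ (proj1 (D1 z Hod)) (proj1 (D2 z Hod))). }
        lra.
Qed.

End WithL.
End Destabilize.

Theorem theorem1p4 (r : R) (h : map3) (f g : C -> C) (a b : nat -> C) (m k : nat) :
  0 < r ->
  branched_minimal_immersion r h ->
  (* f = sum_{j>=k} b_j z^j and g = a_0 + sum_{j>=m} a_j z^j,
     both power series converging on a neighborhood of the closed disc *)
  (forall j, (j < k)%nat -> b j = RtoC 0) ->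
  (forall j, (0 < j)%nat -> (j < m)%nat -> a j = RtoC 0) ->
  (exists rho, r < rho /\
     forall z : C, Cmod z < rho -> is_pseries b z (f z) /\ is_pseries a z (g z)) ->
  (0 < m)%nat ->
  a m <> RtoC 0 ->
  b k <> RtoC 0 ->
  WE_rep r h f g ->
  (* r is strictly larger than the smallest positive root of P_m *)
  (exists s0, 0 < s0 /\ Pm m k a b s0 = 0 /\
     (forall s, 0 < s < s0 -> Pm m k a b s <> 0) /\ s0 < r) ->
  unstable r h.
Proof.
  intros Hr0 (Hsm & _) Hb Ha (rho & Hrho & Hps) Hm Ham Hbk HWE (s0 & Hs0 & HP & _ & Hsr).
  assert (Hr : 0 < r < rho) by lra. assert (Hrho0 : 0 < rho) by lra.
  assert (Hfs : forall z, Cmod z < rho -> cpseries b z (f z)) by (intros z Hz; exact (cpseries_of_is_pseries _ _ _ (proj1 (Hps z Hz)))).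
  assert (Hgs : forall z, Cmod z < rho -> cpseries a z (g z)) by (intros z Hz; exact (cpseries_of_is_pseries _ _ _ (proj2 (Hps z Hz)))).
  destruct (cpseries_holo b rho f Hrho0 Hfs) as (f1 & f2 & Hf & Hf1).
  (* a_0 is split off first; the vanishing coefficients a_1, ..., a_(m-1) then give the factor
     z^(m-1), and splitting off a_m leaves g = a_0 + z^m (a_m + z G1). *)
  destruct (cpseries_decr a rho g Hrho0 Hgs) as (gs & Hgs1 & Eg0).
  destruct (cpseries_factor (m - 1) (fun n => a (S n)) rho gs Hrho0 Hgs1) as (G & HG & Egs).
  { intros j Hj. apply Ha; lia. }
  destruct (cpseries_decr _ rho G Hrho0 HG) as (G1 & HG1 & EG).
  replace (S (m - 1 + 0))%nat with m in EG by lia.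
  destruct (cpseries_holo _ rho G1 Hrho0 HG1) as (G1d & G1dd & HholoG1 & _).
  destruct (cpseries_factor k b rho f Hrho0 Hfs Hb) as (u & Hu & Eu).
  destruct (cpseries_holo _ rho u Hrho0 Hu) as (u1 & u2 & Hholou & _).
  assert (Hu0 : u (RtoC 0) = b k).
  { assert (H0 : Cmod (RtoC 0) < rho) by now rewrite Cmod_0.
    pose proof (cseries_unique _ _ _ (Hu _ H0) (cpseries_at_0 _)) as E.
    now replace (k + 0)%nat with k in E by lia. }
  assert (Hbk0 : 0 < nrm2 (b k)).
  { rewrite nrm2_Cmod. apply pow_lt. now apply Cmod_gt_0. }
  assert (Ham0 : 0 < nrm2 (a m)).
  { rewrite nrm2_Cmod. apply pow_lt. now apply Cmod_gt_0. }
  (* f = z^k u with u(0) = b_k, so |u|^2 >= |b_k|^2 / 2 near 0 by continuity. The witness (d/2)^2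
     bounds |z|^2, and |z| <= d/2 puts both coordinates within d. *)
  assert (Hlow : exists q0, 0 < q0 /\ forall z, cdisc r z -> nrm2 z <= q0 -> nrm2 (b k) / 2 * nrm2 z ^ k <= nrm2 (f z)).
  { assert (Ho0 : odisc rho (RtoC 0)) by (unfold odisc; simpl; nra).
    assert (Hc : continuous (fun z => nrm2 (u z)) (RtoC 0)).
    { apply continuous_nrm2. exact (dC1_contC _ _ _ _ _ Hholou Ho0). }
    destruct (continuous_locally_lt _ _ (nrm2 (b k) / 2) Hc ltac:(lra)) as [d Hd].
    assert (Hd0 : 0 < d) by apply cond_pos.
    exists ((d / 2) ^ 2). split; [apply pow_lt; lra|]. intros z Hz Hzd.
    assert (Hzr : Cmod z < rho) by (apply odisc_Cmod; auto; now apply cdisc_odisc with r).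
    rewrite (Eu z Hzr), nrm2_mult, nrm2_pow, Rmult_comm.
    apply Rmult_le_compat_l; [apply pow_le, nrm2_pos|].
    assert (Hball : ball (RtoC 0) d z).
    { unfold nrm2 in Hzd. destruct z as [x y]; cbn [fst snd] in Hzd.
      split; simpl; apply Rabs_lt_between; unfold minus, plus, opp; simpl; nra. }
    generalize (Hd z Hball). cbv beta. rewrite Hu0. intros Hl. apply Rabs_lt_between in Hl. lra. }
  destruct Hlow as (q0 & Hq0 & Hlow).
  assert (HWE' : WE_rep r h f (wt_g m (a 0%nat) (a m) G1)).
  { intros x y Hxy. generalize (HWE x y Hxy). cbv zeta.
    assert (Hzr : Cmod (x, y) < rho).
    { apply odisc_Cmod; auto. apply cdisc_odisc with r; auto. }
    replace (g (x, y)) with (wt_g m (a 0%nat) (a m) G1 (x, y)); auto.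
    rewrite (Eg0 _ Hzr), (Egs _ Hzr), (EG _ Hzr). unfold wt_g, wt_G, wt_w.
    replace m with (S (m - 1)) at 1 by lia. rewrite Cpow_S. ring. }
  assert (Hbig : nrm2 (wt_p0 (a 0%nat)) < nrm2 (a m) * r ^ (2 * m)).
  { replace (nrm2 (wt_p0 (a 0%nat))) with ((1 + Cmod (a 0%nat) ^ 2) ^ 2)
      by (rewrite <- nrm2_Cmod; unfold wt_p0, nrm2; simpl; ring).
    set (P := (1 + Cmod (a 0%nat) ^ 2) ^ 2) in *.
    unfold Pm in HP. rewrite Cmod_mult, Rpow_mult_distr, <- (nrm2_Cmod (b k)), <- (nrm2_Cmod (a m)) in HP.
    fold P in HP.
    assert (HP0 : 0 <= P) by apply pow2_ge_0.
    set (T := fun j => INR (m - j) * Cmod (b (k + j)%nat) ^ 2 * P * s0 ^ (2 * j)) in HP.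
    assert (HT : forall j, 0 <= T j).
    { intros j. unfold T. apply Rmult_le_pos; [apply Rmult_le_pos; [apply Rmult_le_pos; [apply pos_INR|apply pow2_ge_0]|auto]|apply pow_le; lra]. }
    assert (HTs : forall n, T 0%nat <= sum_f_R0 T n).
    { induction n as [|n IH]; simpl; [lra|]. generalize (HT (S n)). lra. }
    generalize (HTs (m - 1)%nat). unfold T at 1. rewrite Nat.sub_0_r, Nat.add_0_r, <- nrm2_Cmod. simpl (s0 ^ (2 * 0)).
    intros H1. assert (Hm' : 0 < INR m) by now apply lt_0_INR.
    assert (H2 : P <= nrm2 (a m) * s0 ^ (2 * m)).
    { apply (Rmult_le_reg_l (INR m * nrm2 (b k))); [now apply Rmult_lt_0_compat|]. lra. }
    assert (H3 : s0 ^ (2 * m) < r ^ (2 * m)).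
    { replace (2 * m)%nat with (S (2 * m - 1)) by lia. simpl.
      apply Rle_lt_trans with (s0 * r ^ (2 * m - 1)).
      - apply Rmult_le_compat_l; [lra|]. apply pow_incr. lra.
      - apply Rmult_lt_compat_r; [apply pow_lt; lra|lra]. }
    nra. }
  destruct (ds_cutoff rho r m k (a 0%nat) (a m) f f1 f2 G1 G1d (nrm2 (b k) / 2) q0) as (L & HL & Hneg); auto; [lra|].
  exact (ds_W_unstable rho r m (a 0%nat) (a m) f f1 G1 G1d h Hr Hsm Hf HholoG1 HWE' L HL Hneg).
Qed.
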